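(* Let $\mathcal{H}$ be a complex separable infinite-dimensional Hilbert space and let $n \ge 3$ be an integer. Let $(X_1,\ldots,X_n)$ and $(Y_1,\ldots,Y_n)$ be two $n$-tuples of (possibly unbounded) commuting self-adjoint operators on $\mathcal{H}$ such that $X_j - Y_j \in \mathcal{C}_n^-$ for all $1 \le j \le n$. Let $E_{ac}(X_1,\ldots,X_n)$ be the orthogonal projection onto the Lebesgue absolutely continuous subspace of $(X_1,\ldots,X_n)$. Then the strong limit $$W = \operatorname*{s-lim}_{\xi\in\mathbb{R}^n,\ |\xi|\to\infty} \exp\Big(-i\sum_{1\le j\le n}\xi_j Y_j\Big)\exp\Big(i\sum_{1\le j\le n}\xi_j X_j\Big)E_{ac}(X_1,\ldots,X_n)$$ exists, where $\xi=(\xi_1,\ldots,\xi_n)$ and the limit is taken as $\xi$ tends to the point at infinity of the Alexandroff (one-point) compactification of $\mathbb{R}^n$.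
   Context: $\mathcal{C}_n^-$ is the Lorentz $(n,1)$ ideal: the compact operators $K$ on $\mathcal{H}$ with $|K|_n^- = \sum_{j\ge 1} s_j(K)\, j^{-1+1/n} < \infty$, where $s_1(K)\ge s_2(K)\ge\cdots$ are the singular values of $K$ in decreasing order. ''Commuting'' for (possibly unbounded) self-adjoint operators means strongly commuting, i.e. their spectral measures commute. For unbounded self-adjoint $X_j, Y_j$, the condition $X_j-Y_j\in\mathcal{C}_n^-$ means that $X_j = Y_j + K_j$ (with the same domain) for some $K_j\in\mathcal{C}_n^-$. Exponentials of real linear combinations $\sum_j \xi_j X_j$ are the unitary operators given by the joint functional calculus. If $E$ is the joint spectral measure of $(X_1,\ldots,X_n)$ on $\mathbb{R}^n$, the Lebesgue absolutely continuous subspace is the closed subspace of vectors $h\in\mathcal{H}$ such that the measure $\langle E(\cdot)h,h\rangle$ is absolutely continuous with respect to Lebesgue measure on $\mathbb{R}^n$. *)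

(* Defs.v *)
From HB Require Import structures.
From mathcomp Require Import all_boot all_order all_algebra.
From mathcomp Require Import sesquilinear complex.
From mathcomp Require Import all_classical all_reals all_analysis.

Set Implicit Arguments.
Unset Strict Implicit.
Unset Printing Implicit Defensive.

Import Order.TTheory GRing.Theory Num.Theory.
Import numFieldNormedType.Exports.

Local Open Scope classical_set_scope.
Local Open Scope complex_scope.
Local Open Scope ring_scope.

Section Hilbert.
Context {R : realType} {H : completeNormedModType R[i]}.
Implicit Types (V : set H) (K : H -> H).

(* Linear in the first argument, conjugate-linear in the second. *)
Definition inner_product_of_norm (ip : {dot H for Num.conj}) :=
  forall h : H, `|h| ^+ 2 = ip h h.

Definition separable_space := exists2 S : set H, countable S & dense S.

Definition infinite_dimensional :=
  forall (m : nat) (b : 'I_m -> H),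
    exists h : H, forall c : 'I_m -> R[i], h <> \sum_(i < m) c i *: b i.

Definition has_dimension V (m : nat) :=
  exists2 b : 'I_m -> H,
    (forall c : 'I_m -> R[i],
       \sum_(i < m) c i *: b i = 0 -> forall i, c i = 0) &
    V = range (fun c : 'I_m -> R[i] => \sum_(i < m) c i *: b i).

Variable ip : {dot H for Num.conj}.

Definition orth_projection (P : H -> H) :=
  [/\ linear P, forall h, P (P h) = P h &
      forall h k, ip (P h) k = ip h (P k)].

(* The orthogonal projection onto a closed subspace V; 0 is a junk value, used
   only at points having no orthogonal projection on V. *)
Definition orth_proj_on V (h : H) : H :=
  xget 0 [set p | V p /\ forall k, V k -> ip (h - p) k = 0].

Definition compact_operator K :=
  linear K /\ compact (closure (K @` [set h | `|h| <= 1])).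

(* The eigenspace ker (K^* K - lam^2) of K^* K, that is, the eigenspace of
   |K| = (K^* K)^(1/2) for the eigenvalue lam >= 0; the adjoint is moved to
   the other side of the inner product. *)
Definition modulus_eigenspace K (lam : R) : set H :=
  [set h | forall k, ip (K h) (K k) = (lam ^+ 2)%:C * ip h k].

(* s 0 >= s 1 >= ... enumerates the eigenvalues of |K| with multiplicity:
   each lam > 0 occurs exactly dim ker (|K| - lam) times. There is no
   condition at lam = 0: all the s j outside a finite set vanish when K has
   finite rank, and all the s j are positive otherwise. *)
Definition singular_values K (s : R^nat) :=
  [/\ nonincreasing_seq s, forall j, 0 <= s j &
      forall lam : R, 0 < lam -> exists2 m : nat,
        has_dimension (modulus_eigenspace K lam) m &
        ([set j | s j = lam] #= `I_m)%card].

(* The index is shifted: s j is the (j+1)-st singular value. *)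
Definition lorentz_ideal (n : nat) K :=
  compact_operator K /\
  exists2 s : R^nat, singular_values K s &
    (\sum_(0 <= j <oo) (s j * j.+1%:R `^ (n%:R^-1 - 1))%:E < +oo)%E.

(* The values of op_fun outside op_dom are irrelevant. *)
Record unbounded_operator := UnboundedOperator {
  op_dom : set H ;
  op_fun :> H -> H ;
  op_dom0 : op_dom 0 ;
  op_domP : forall (a : R[i]) (x y : H),
    op_dom x -> op_dom y -> op_dom (a *: x + y) ;
  op_linear : forall (a : R[i]) (x y : H),
    op_dom x -> op_dom y -> op_fun (a *: x + y) = a *: op_fun x + op_fun y }.

(* (y, z) is in the graph of the adjoint of T iff it is in the graph of T. *)
Definition self_adjoint (T : unbounded_operator) :=
  dense (op_dom T) /\
  forall y z : H,
    (forall x, op_dom T x -> ip (T x) y = ip x z) <-> (op_dom T y /\ z = T y).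

Definition difference_in (J : set (H -> H)) (S T : unbounded_operator) :=
  op_dom S = op_dom T /\
  exists2 K, J K & forall h, op_dom T h -> S h = T h + K h.

Section SpectralMeasures.
Context {d : measure_display} {T : measurableType d}.

Definition projection_valued_measure (E : set T -> H -> H) :=
  [/\ forall A, measurable A -> orth_projection (E A),
      forall h, E setT h = h &
      forall F : (set T)^nat, (forall i, measurable (F i)) ->
        trivIset setT F ->
        forall h, series (fun i => E (F i) h) @ \oo --> E (\bigcup_i F i) h].

(* The positive measure <E(.) h, h>. *)
Definition spectral_dist (E : set T -> H -> H) (h : H) : set T -> \bar R :=
  fun A => (complex.Re (ip (E A h) h))%:E.

Definition complex_integral (mu : set T -> \bar R) (f : T -> R[i]) : R[i] :=
  fine (\int[mu]_x (complex.Re (f x))%:E)%E +i*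
  fine (\int[mu]_x (complex.Im (f x))%:E)%E.

(* The operator given by the integral of a bounded f against E; a bounded
   operator is determined by its quadratic form. The junk value 0 is not used
   for E a projection-valued measure and f bounded measurable. *)
Definition functional_calculus (E : set T -> H -> H) (f : T -> R[i]) : H -> H :=
  xget (fun=> 0) [set U : H -> H | linear U /\
    forall h, ip (U h) h = complex_integral (spectral_dist E h) f].

End SpectralMeasures.

(* A = \int x dE(x), including the equality of the domains. *)
Definition spectral_measure_of (A : unbounded_operator)
    (E : set (measurableTypeR R) -> H -> H) :=
  [/\ projection_valued_measure E,
      forall h, op_dom A h <->
        (\int[spectral_dist E h]_x (x ^+ 2)%:E < +oo)%E &
      forall h, op_dom A h ->
        ip (A h) h = complex_integral (spectral_dist E h) (fun x => x%:C)].

Definition strongly_commute (A B : unbounded_operator) :=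
  forall E F, spectral_measure_of A E -> spectral_measure_of B F ->
  forall S S', measurable S -> measurable S' ->
  forall h, E S (F S' h) = F S' (E S h).

Section Joint.
Context {n : nat}.
Local Notation Rn := (n.-tuple (measurableTypeR R)).

Definition joint_spectral_measure_of (X : 'I_n -> unbounded_operator)
    (E : set Rn -> H -> H) :=
  projection_valued_measure E /\
  forall j, spectral_measure_of (X j)
    (fun S => E ((fun t : Rn => tnth t j) @^-1` S)).

Definition expi (theta : R) : R[i] := cos theta +i* sin theta.

(* exp (i \sum_j xi_j X_j) when E is the joint spectral measure of X. *)
Definition exp_i (E : set Rn -> H -> H) (xi : 'rV[R]_n) : H -> H :=
  functional_calculus E
    (fun t => expi (\sum_(j < n) xi ord0 j * (tnth t j : R))).

End Joint.

End Hilbert.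

Arguments unbounded_operator {R} H.
Arguments separable_space {R} H.
Arguments infinite_dimensional {R} H.

(* Lebesgue measure on R^n, as an iterated integral. *)
Fixpoint lebesgue_measure_tuple {R : realType} (n : nat) :
    set (n.-tuple (measurableTypeR R)) -> \bar R :=
  match n with
  | 0 => fun A => \d_[tuple] A
  | m.+1 => fun A => (\int[@lebesgue_measure R]_x
      lebesgue_measure_tuple [set t : m.-tuple _ | A [tuple of x :: t]])%E
  end.

Definition lebesgue_ac_subspace {R : realType} {H : completeNormedModType R[i]}
    (ip : {dot H for Num.conj}) {n : nat}
    (E : set (n.-tuple (measurableTypeR R)) -> H -> H) : set H :=
  [set h | spectral_dist ip E h `<< @lebesgue_measure_tuple R n].

(* The filter of punctured neighbourhoods of the point at infinity. *)
Definition rV_infty {R : realType} {n : nat} : set_system 'rV[R]_n :=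
  odflt 0 @ (None : one_point_compactification 'rV[R]_n)^'.

(* Main.v *)
(* Put W(xi) = exp(-i xi.Y) exp(i xi.X) and K_j = X_j - Y_j. Vectors g whose spectral measure
   for X lives in a cube and has a bounded density are dense in the absolutely continuous
   subspace. For such g and N large, Parseval's identity on a cube makes the vectors
   g_w = exp(i w.X / N) g, w in Z^n, a Bessel family, so that for any 2^q distinct points w
     sum_w |K_j g_w| <= C 2^q (2^-q sum_(k < 2^q) s_k(K_j)^2)^(1/2).
   By Duhamel's formula the same bound holds for the increments of W(w / N) g under w -> w + e_j.
   Averages of W(w / N) g over boxes of 2^q and of 2^(q+1) lattice points are related by a
   translation of length 2^(q/n), hence differ by at most 2^(q/n) times the mean increment; the
   sum over q of these bounds converges by Hardy's inequality, which is where n >= 3 and the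
   Lorentz (n,1) condition enter. Comparing two distant lattice points through the averages over
   the boxes attached to them, W(w / N) g is Cauchy along Z^n. As xi -> W(xi) g is Lipschitz,
   letting N grow gives the limit on R^n, and density of the g concludes. *)
Require Import Defs.
From HB Require Import structures.
From mathcomp Require Import all_boot all_order all_algebra.
From mathcomp Require Import finmap sesquilinear complex.
From mathcomp Require Import all_classical all_reals all_analysis.
From mathcomp Require Import measurable_realfun zify ring lra.
Import Order.TTheory GRing.Theory Num.Theory.
Import numFieldNormedType.Exports.
Set Implicit Arguments.
Unset Strict Implicit.
Unset Printing Implicit Defensive.
Local Open Scope classical_set_scope.
Local Open Scope complex_scope.
Local Open Scope ring_scope.

(** The Bessel bound gives no rate of decay for a single increment of W, only for means over 2^q
    distinct points. Increments cannot be summed along a path, so box averages take the place of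
    paths: translating a box by 2^(q/n) costs that many mean increments. Grouping the s_k in dyadic
    blocks bounds the cost at level q by a constant times sum_(k < q) 2^(q/n) 2^((k-q)/2) s_(2^k),
    plus a term in s_0. Summed over q this is a geometric series of ratio 2^(1/n - 1/2), convergent
    exactly when n >= 3, and what remains, sum_k 2^(k/n) s_(2^k), is the Lorentz (n,1) norm up to
    constants. The Bessel constant grows like N^n. This is harmless because N is fixed by the
    accuracy before q tends to infinity: the Lipschitz constant of W(xi) g does not involve N.
    Unbounded operators are applied only on spectral subspaces of cubes, where they are bounded. The
    increments of W g need not lie in such a subspace for Y; they are tested against vectors that
    do. *)

Local Notation normc := ComplexField.Normc.normc.

(** * Complex Hilbert spaces *)

Section ComplexParts.
Context {R : rcfType}.
Implicit Types x y : R[i].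

Lemma ReD x y : complex.Re (x + y) = complex.Re x + complex.Re y.
Proof. by case: x y => [a b] [c d]. Qed.

Lemma ReN x : complex.Re (- x) = - complex.Re x.
Proof. by case: x. Qed.

Lemma ReM x y : complex.Re (x * y) =
  complex.Re x * complex.Re y - complex.Im x * complex.Im y.
Proof. by case: x y => [a b] [c d]. Qed.

Lemma ImD x y : complex.Im (x + y) = complex.Im x + complex.Im y.
Proof. by case: x y => [a b] [c d]. Qed.

Lemma ImM x y : complex.Im (x * y) =
  complex.Re x * complex.Im y + complex.Im x * complex.Re y.
Proof. by case: x y => [a b] [c d]. Qed.

Lemma Re_conj x : complex.Re (Num.conj x) = complex.Re x.
Proof. by case: x. Qed.

Lemma Im_conj x : complex.Im (Num.conj x) = - complex.Im x.
Proof. by case: x. Qed.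

Lemma Re_sum I (r : seq I) (f : I -> R[i]) :
  complex.Re (\sum_(i <- r) f i) = \sum_(i <- r) complex.Re (f i).
Proof. by elim: r => [|i r IH]; rewrite ?big_nil // !big_cons ReD IH. Qed.

Lemma Im_sum I (r : seq I) (f : I -> R[i]) :
  complex.Im (\sum_(i <- r) f i) = \sum_(i <- r) complex.Im (f i).
Proof. by elim: r => [|i r IH]; rewrite ?big_nil // !big_cons ImD IH. Qed.

Lemma complex_ext x y : complex.Re x = complex.Re y ->
  complex.Im x = complex.Im y -> x = y.
Proof. by case: x y => [a b] [c d] /= -> ->. Qed.

Lemma normc_ge0 x : 0 <= normc x.
Proof. by case: x => a b; exact: sqrtr_ge0. Qed.

Lemma sqr_normcE x : normc x ^+ 2 = complex.Re x ^+ 2 + complex.Im x ^+ 2.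
Proof. by case: x => a b /=; rewrite sqr_sqrtr // addr_ge0 ?sqr_ge0. Qed.

Lemma normc_conj x : normc (Num.conj x) = normc x.
Proof. by case: x => a b /=; rewrite sqrrN. Qed.

Lemma normc_real (a : R) : normc a%:C = `|a|.
Proof. by rewrite /= expr0n addr0 sqrtr_sqr. Qed.

Lemma Re_le_normc x : `|complex.Re x| <= normc x.
Proof.
by case: x => a b /=; rewrite -sqrtr_sqr ler_wsqrtr // lerDl sqr_ge0.
Qed.

Lemma le_normc_parts x : normc x <= `|complex.Re x| + `|complex.Im x|.
Proof.
rewrite -(ler_pXn2r (_ : 0 < 2)%N) ?nnegrE ?normc_ge0 ?addr_ge0 //.
rewrite sqr_normcE sqrrD !real_normK ?num_real //.
by rewrite addrAC lerDl mulrn_wge0 // mulr_ge0.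
Qed.

(** First-order condition at an extremum. Testing at t = b / (|c| + 1) makes the quadratic term
    strictly smaller than the linear one unless b = 0. *)
Lemma quadratic_le0 (b c : R) : (forall t, t * b <= t ^+ 2 * c) -> b = 0.
Proof.
move=> h; have C0 : 0 < `|c| + 1 by rewrite ltr_wpDl.
have := h (b / (`|c| + 1)).
have -> : (b / (`|c| + 1)) ^+ 2 * c = b ^+ 2 / (`|c| + 1) * (c / (`|c| + 1)).
  by field; rewrite gt_eqF.
have -> : b / (`|c| + 1) * b = b ^+ 2 / (`|c| + 1) by field; rewrite gt_eqF.
move=> le; apply/eqP; rewrite -sqrf_eq0; apply/eqP/le_anti; rewrite sqr_ge0 andbT.
rewrite leNgt; apply/negP => b0.
move: le; rewrite -[leLHS]mulr1 ler_pM2l ?divr_gt0 //.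
rewrite ler_pdivlMr // mul1r; apply/negP; rewrite -ltNge.
by rewrite (le_lt_trans (ler_norm _)) // ltrDl.
Qed.

End ComplexParts.

Section Hilbert.
Context {R : realType} {H : completeNormedModType R[i]}.
Implicit Types (h k g : H) (V : set H).

(** The norm of a module over [R[i]] has values in [R[i]]; all estimates are carried out in the
    ordered field R instead. *)
Definition nrm h : R := complex.Re `|h|.

Lemma nrmE h : `|h| = (nrm h)%:C.
Proof. by rewrite /nrm RRe_real // normr_real. Qed.

Lemma nrm_ge0 h : 0 <= nrm h.
Proof. by rewrite -lecR -nrmE normr_ge0. Qed.

Lemma nrmD h k : nrm (h + k) <= nrm h + nrm k.
Proof. by rewrite -lecR rmorphD /= -!nrmE ler_normD. Qed.

Lemma nrmN h : nrm (- h) = nrm h.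
Proof. by rewrite /nrm normrN. Qed.

Lemma nrmBC h k : nrm (h - k) = nrm (k - h).
Proof. by rewrite -opprB nrmN. Qed.

Lemma nrmZ (a : R[i]) h : nrm (a *: h) = normc a * nrm h.
Proof.
apply: complexI; rewrite rmorphM /= -!nrmE normrZ; congr (_ * _).
Qed.

Lemma nrmZr (a : R) h : nrm (a%:C *: h) = `|a| * nrm h.
Proof. by rewrite nrmZ normc_real. Qed.

Lemma nrm0 : nrm (0 : H) = 0.
Proof. by rewrite /nrm normr0. Qed.

Lemma nrm_eq0 h : nrm h = 0 -> h = 0.
Proof. by move=> h0; apply/eqP; rewrite -normr_eq0 nrmE h0. Qed.

Lemma nrmMn h m : nrm (h *+ m) = m%:R * nrm h.
Proof. by rewrite -scaler_nat -(rmorph_nat (real_complex R)) nrmZr ger0_norm. Qed.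

Lemma nrm_sub_trans g h k : nrm (h - k) <= nrm (h - g) + nrm (g - k).
Proof. by rewrite -[h - k](subrKA g) nrmD. Qed.

Lemma ltC_pos (e : R[i]) : 0 < e -> e = (complex.Re e)%:C /\ 0 < complex.Re e.
Proof. by rewrite ltcE /= => /andP[/eqP i0 r0]; split => //; case: e i0 {r0} => a b /= ->. Qed.

Lemma cvg_nrmP {I : Type} {F : set_system I} {FF : Filter F} (f : I -> H) l :
  f @ F --> l <-> forall e : R, 0 < e -> \forall x \near F, nrm (f x - l) < e.
Proof.
split=> [/cvgrPdist_lt fl e e0|fl].
  have := fl e%:C; rewrite ltcR => /(_ e0); apply: filterS => x.
  by rewrite nrmE ltcR nrmBC.
apply/cvgrPdist_lt => e /ltC_pos[-> e0].
by apply: filterS (fl _ e0) => x; rewrite nrmE ltcR nrmBC.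
Qed.

Lemma cauchy_nrm_cvg {I : Type} {F : set_system I} {FF : ProperFilter F} (f : I -> H) :
  (forall e : R, 0 < e -> exists2 A, F A & forall x y, A x -> A y -> nrm (f x - f y) <= e) ->
  exists l : H, f @ F --> l.
Proof.
move=> fc; suff /cauchy_cvgP fF : cauchy (f @ F) by exists (lim (f @ F)).
apply: cauchy_exP => e /ltC_pos[-> e0].
have [A FA hA] := fc _ (divr_gt0 e0 (ltr0Sn R 1)).
have [x Ax] := filter_ex FA; exists (f x); rewrite /fmap /=.
apply: filterS FA => y Ay /=; rewrite -ball_normE /ball_ /= nrmE ltcR.
by rewrite (le_lt_trans (hA _ _ Ax Ay)) // ltr_pdivrMr // ltr_pMr // ltr1n.
Qed.

Lemma cauchy_seq_cvg (f : nat -> H) :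
  (forall e : R, 0 < e -> exists N, forall m n, (N <= m)%N -> (N <= n)%N -> nrm (f m - f n) <= e) ->
  exists l : H, f @ \oo --> l.
Proof.
move=> fc; apply: cauchy_nrm_cvg => e /fc[N hN].
by exists [set m | (N <= m)%N] => [|x y /= ? ?]; [exact: nbhs_infty_ge|exact: hN].
Qed.

(** The parallelogram identity bounds squared distances, so this is the form in which minimizing and
    maximizing sequences are seen to converge. *)
Lemma sqr_cauchy_cvg (f : nat -> H) (C : R) :
  (forall N m n, (N <= m)%N -> (N <= n)%N -> nrm (f m - f n) ^+ 2 <= C / N.+1%:R) ->
  exists l : H, f @ \oo --> l.
Proof.
move=> fC; apply: cauchy_seq_cvg => e e0.
have K0 : 0 <= `|C| / e ^+ 2 by rewrite divr_ge0 // exprn_ge0 // ltW.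
exists (Num.bound (`|C| / e ^+ 2)) => m n hm hn.
rewrite -(ler_pXn2r (_ : 0 < 2)%N) ?nnegrE ?nrm_ge0 ?(ltW e0) //.
apply: (le_trans (fC _ _ _ hm hn)); rewrite ler_pdivrMr ?ltr0n //.
apply: (le_trans (ler_norm _)); rewrite mulrC -ler_pdivrMr ?exprn_gt0 //.
by rewrite (le_trans (ltW (archi_boundP K0))) // ler_nat.
Qed.

Lemma cvg_nrm {I : Type} {F : set_system I} {FF : Filter F} (f : I -> H) l :
  f @ F --> l -> nrm (f x) @[x --> F] --> nrm l.
Proof.
move=> /cvg_nrmP fl; apply/cvgrPdist_lt => e /fl.
apply: filterS => x; apply: le_lt_trans; rewrite ler_norml; apply/andP; split.
  rewrite lerBrDr addrC lerBlDr addrC.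
  by have := nrmD (f x - l) l; rewrite subrK addrC.
by rewrite lerBlDr nrmBC; have := nrmD (l - f x) (f x); rewrite subrK.
Qed.

Definition bounded_operator (K : H -> H) :=
  linear K /\ exists B : R, forall h, nrm (K h) <= B * nrm h.

Lemma lin0 (K : H -> H) : linear K -> K 0 = 0.
Proof. by move=> lK; have := lK (-1) 0 0; rewrite scaler0 addr0 scaleN1r addNr. Qed.

Lemma linD (K : H -> H) h k : linear K -> K (h + k) = K h + K k.
Proof. by move=> lK; rewrite -[h]scale1r lK !scale1r. Qed.

Lemma linZ (K : H -> H) a h : linear K -> K (a *: h) = a *: K h.
Proof. by move=> lK; rewrite -[a *: h]addr0 lK lin0 // addr0. Qed.

Lemma linB (K : H -> H) h k : linear K -> K (h - k) = K h - K k.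
Proof. by move=> lK; rewrite addrC -scaleN1r lK scaleN1r addrC. Qed.

Lemma lin_sum (K : H -> H) I (r : seq I) (f : I -> H) : linear K ->
  K (\sum_(i <- r) f i) = \sum_(i <- r) K (f i).
Proof.
move=> lK; elim: r => [|i r IH]; first by rewrite !big_nil lin0.
by rewrite !big_cons linD // IH.
Qed.

Lemma bounded_operator_cvg (K : H -> H) {I : Type} {F : set_system I}
    {FF : Filter F} (f : I -> H) l :
  bounded_operator K -> f @ F --> l -> K (f x) @[x --> F] --> K l.
Proof.
move=> [lK [B hB]] /cvg_nrmP fl; apply/cvg_nrmP => e e0.
have B0 : 0 < `|B| + 1 by rewrite ltr_wpDl.
apply: filterS (fl _ (divr_gt0 e0 B0)) => x.
rewrite ltr_pdivlMr // -linB // => /(le_lt_trans _); apply.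
rewrite (le_trans (hB _)) // mulrC ler_wpM2l ?nrm_ge0 //.
by rewrite (le_trans (ler_norm _)) // lerDl.
Qed.

Variable ip : {dot H for Num.conj}.

Lemma ipDl h k g : ip (h + k) g = ip h g + ip k g.
Proof. exact: linearDl. Qed.

Lemma ipDr h k g : ip h (k + g) = ip h k + ip h g.
Proof. exact: linearDr. Qed.

Lemma ipZl a h k : ip (a *: h) k = a * ip h k.
Proof. exact: linearZl_LR. Qed.

Lemma ipZr a h k : ip h (a *: k) = Num.conj a * ip h k.
Proof. exact: linearZr_LR. Qed.

Lemma ipC h k : ip h k = Num.conj (ip k h).
Proof. by rewrite hermC expr0 mul1r. Qed.

Lemma ipNl h k : ip (- h) k = - ip h k.
Proof. exact: linearNl. Qed.

Lemma ipNr h k : ip h (- k) = - ip h k.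
Proof. exact: linearNr. Qed.

Lemma ipBl h k g : ip (h - k) g = ip h g - ip k g.
Proof. by rewrite ipDl ipNl. Qed.

Lemma ip0l h : ip 0 h = 0.
Proof. exact: linear0l. Qed.

Lemma ip0r h : ip h 0 = 0.
Proof. exact: linear0r. Qed.

Lemma ip_suml I (r : seq I) (f : I -> H) k :
  ip (\sum_(i <- r) f i) k = \sum_(i <- r) ip (f i) k.
Proof. by elim: r => [|i r IH]; rewrite ?big_nil ?ip0l // !big_cons ipDl IH. Qed.

Lemma ip_sumr I (r : seq I) (f : I -> H) k :
  ip k (\sum_(i <- r) f i) = \sum_(i <- r) ip k (f i).
Proof. by elim: r => [|i r IH]; rewrite ?big_nil ?ip0r // !big_cons ipDr IH. Qed.

Definition rip h k : R := complex.Re (ip h k).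

Lemma ripDl h k g : rip (h + k) g = rip h g + rip k g.
Proof. by rewrite /rip ipDl ReD. Qed.

Lemma ripDr h k g : rip h (k + g) = rip h k + rip h g.
Proof. by rewrite /rip ipDr ReD. Qed.

Lemma ripC h k : rip h k = rip k h.
Proof. by rewrite /rip ipC Re_conj. Qed.

Lemma ripNl h k : rip (- h) k = - rip h k.
Proof. by rewrite /rip ipNl ReN. Qed.

Lemma ripNr h k : rip h (- k) = - rip h k.
Proof. by rewrite /rip ipNr ReN. Qed.

Lemma ripBl h k g : rip (h - k) g = rip h g - rip k g.
Proof. by rewrite ripDl ripNl. Qed.

Lemma ripBr h k g : rip h (k - g) = rip h k - rip h g.
Proof. by rewrite ripDr ripNr. Qed.

Lemma ripZl (a : R) h k : rip (a%:C *: h) k = a * rip h k.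
Proof. by rewrite /rip ipZl ReM /= mul0r subr0. Qed.

Lemma ripZr (a : R) h k : rip h (a%:C *: k) = a * rip h k.
Proof. by rewrite ripC ripZl ripC. Qed.

Lemma rip0l h : rip 0 h = 0.
Proof. by rewrite /rip ip0l. Qed.

Lemma rip0r h : rip h 0 = 0.
Proof. by rewrite /rip ip0r. Qed.

Lemma rip_suml I (r : seq I) (f : I -> H) k :
  rip (\sum_(i <- r) f i) k = \sum_(i <- r) rip (f i) k.
Proof. by rewrite /rip ip_suml Re_sum. Qed.

Lemma rip_sumr I (r : seq I) (f : I -> H) k :
  rip k (\sum_(i <- r) f i) = \sum_(i <- r) rip k (f i).
Proof. by rewrite /rip ip_sumr Re_sum. Qed.

Lemma ripiZr h k : rip h ('i%C *: k) = complex.Im (ip h k).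
Proof. by rewrite /rip ipZr; case: (ip h k) => a b /=; ring. Qed.

Lemma ripiZl h k : rip ('i%C *: h) k = - complex.Im (ip h k).
Proof. by rewrite /rip ipZl; case: (ip h k) => a b /=; ring. Qed.

Lemma ipE h k : ip h k = (rip h k) +i* (rip h ('i%C *: k)).
Proof. by rewrite ripiZr /rip; case: (ip h k). Qed.

Lemma ip_ext h g : (forall k, ip h k = ip g k) -> h = g.
Proof.
move=> e; apply/eqP; rewrite -subr_eq0 -(dnorm_eq0 ip).
by rewrite ipBl e subrr.
Qed.

Hypothesis Hip : inner_product_of_norm ip.

Lemma ipxx h : ip h h = (nrm h ^+ 2)%:C.
Proof. by rewrite -Hip nrmE rmorphXn. Qed.

Lemma ripxx h : rip h h = nrm h ^+ 2.
Proof. by rewrite /rip ipxx. Qed.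

Lemma sqr_nrmD h k : nrm (h + k) ^+ 2 = nrm h ^+ 2 + nrm k ^+ 2 + 2 * rip h k.
Proof. by rewrite -!ripxx ripDl !ripDr (ripC k h); ring. Qed.

Lemma sqr_nrmB h k : nrm (h - k) ^+ 2 = nrm h ^+ 2 + nrm k ^+ 2 - 2 * rip h k.
Proof. by rewrite sqr_nrmD nrmN ripNr mulrN. Qed.

Lemma rip_le h k : rip h k <= nrm h * nrm k.
Proof.
have [k0|k0] := eqVneq (nrm k) 0.
  by rewrite k0 mulr0 (nrm_eq0 k0) rip0r.
have kp : 0 < nrm k by rewrite lt_neqAle eq_sym k0 nrm_ge0.
have := sqr_ge0 (nrm ((nrm k)%:C *: h - (nrm h)%:C *: k)).
rewrite sqr_nrmB !nrmZr !ger0_norm ?nrm_ge0 // ripZl ripZr.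
have -> : (nrm k * nrm h) ^+ 2 + (nrm h * nrm k) ^+ 2 - 2 * (nrm k * (nrm h * rip h k)) =
  2 * (nrm k * nrm h) * (nrm h * nrm k - rip h k) by ring.
have [h0|h0] := eqVneq (nrm h) 0.
  by rewrite h0 mul0r (nrm_eq0 h0) rip0l.
have hp : 0 < nrm h by rewrite lt_neqAle eq_sym h0 nrm_ge0.
by rewrite pmulr_rge0 ?subr_ge0 // mulr_gt0 // mulr_gt0.
Qed.

Lemma normr_rip_le h k : `|rip h k| <= nrm h * nrm k.
Proof. by rewrite ler_norml lerNl -ripNl (le_trans (rip_le _ _)) ?nrmN ?rip_le. Qed.

Lemma cvg_rip {I : Type} {F : set_system I} {FF : Filter F} (f : I -> H) l k :
  f @ F --> l -> rip (f x) k @[x --> F] --> rip l k.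
Proof.
move=> /cvg_nrmP fl; apply/cvgrPdist_lt => e e0.
have k0 : 0 < nrm k + 1 by rewrite ltr_wpDl ?nrm_ge0.
apply: filterS (fl _ (divr_gt0 e0 k0)) => x.
rewrite ltr_pdivlMr // distrC -ripBl => /(le_lt_trans _); apply.
by rewrite (le_trans (normr_rip_le _ _)) // ler_wpM2l ?nrm_ge0 // lerDl.
Qed.

(* A quadratic functional minimal at p along every line of V: midpoints turn a
   minimizing sequence into a Cauchy sequence. *)
Lemma projection_exists V : V 0 ->
  (forall a x y, V x -> V y -> V (a *: x + y)) ->
  (forall (f : nat -> H) l, (forall n, V (f n)) -> f @ \oo --> l -> V l) ->
  forall h, exists p, V p /\ forall k, V k -> ip (h - p) k = 0.
Proof.
move=> V0 VD Vc h.
pose S := [set nrm (h - v) | v in V].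
have S0 : has_inf S.
  split; first by exists (nrm (h - 0)), 0.
  by exists 0 => _ [v _ <-]; exact: nrm_ge0.
pose m := inf S.
have mle v : V v -> m <= nrm (h - v).
  by move=> Vv; apply: ge_inf; [exact: S0.2|exists v].
have m0 : 0 <= m by apply: lb_le_inf; [exact: S0.1|move=> _ [v _ <-]; exact: nrm_ge0].
have exv (n : nat) : exists v, V v /\ nrm (h - v) < m + n.+1%:R^-1.
  have [|_ [v Vv <-] lt] := @inf_adherent _ S n.+1%:R^-1 _ S0; first by rewrite invr_gt0.
  by exists v.
have [f fP] := choice exv.
have fV n : V (f n) by have [] := fP n.
have scal2 (x : H) : 2^-1%:C *: x + 2^-1%:C *: x = x.
  by rewrite -scalerDl -rmorphD /= (_ : 2^-1 + 2^-1 = 1 :> R) ?scale1r //; field.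
have par a b (d : R) : V a -> V b -> 0 <= d -> nrm (h - a) <= m + d -> nrm (h - b) <= m + d ->
    nrm (a - b) ^+ 2 <= 8 * m * d + 4 * d ^+ 2.
  move=> Va Vb d0 ha hb.
  have mid : V (2^-1%:C *: a + 2^-1%:C *: b).
    by apply: (VD) => //; rewrite -[_ *: b]addr0; apply: VD.
  have hm := mle _ mid.
  have e1 : h - (2^-1%:C *: a + 2^-1%:C *: b) = 2^-1%:C *: ((h - a) + (h - b)).
    rewrite scalerDr !scalerBr addrACA scal2; congr (_ + _).
    by rewrite opprD.
  have h4 : 4 * m ^+ 2 <= nrm ((h - a) + (h - b)) ^+ 2.
    rewrite e1 nrmZr ger0_norm in hm; last by rewrite invr_ge0.
    have : (2 * m) ^+ 2 <= nrm ((h - a) + (h - b)) ^+ 2.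
      rewrite ler_pXn2r ?nnegrE ?nrm_ge0 //; last by rewrite mulr_ge0.
      by rewrite mulrC -ler_pdivlMr // mulrC.
    by rewrite exprMn (_ : 2 ^+ 2 = 4 :> R) //; ring.
  have -> : a - b = (h - b) - (h - a) by rewrite opprB [RHS]addrC addrA subrK.
  rewrite sqr_nrmD in h4; rewrite sqr_nrmB (ripC (h - b)).
  have : nrm (h - a) ^+ 2 <= (m + d) ^+ 2.
    by rewrite ler_pXn2r ?nnegrE ?nrm_ge0 ?addr_ge0.
  have : nrm (h - b) ^+ 2 <= (m + d) ^+ 2.
    by rewrite ler_pXn2r ?nnegrE ?nrm_ge0 ?addr_ge0.
  rewrite !sqrrD; nra.
have inv_le (N n : nat) : (N <= n)%N -> n.+1%:R^-1 <= N.+1%:R^-1 :> R.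
  by move=> Nn; rewrite lef_pV2 ?posrE // ler_nat ltnS.
have [p fp] : exists p : H, f @ \oo --> p.
  apply: (@sqr_cauchy_cvg _ (8 * m + 4)) => N a b Na Nb.
  set d : R := N.+1%:R^-1.
  have d0 : 0 <= d by rewrite invr_ge0.
  have d1 : d <= 1 by rewrite invf_le1 // ler1n.
  apply: (le_trans (par _ _ d (fV a) (fV b) d0 _ _)).
  - have [_ /ltW /le_trans] := fP a; apply; rewrite lerD2l; exact: inv_le.
  - have [_ /ltW /le_trans] := fP b; apply; rewrite lerD2l; exact: inv_le.
  rewrite [leRHS]mulrDl lerD2l ler_pM2l // expr2.
  by rewrite ler_piMl.
exists p; have Vp := Vc _ _ fV fp; split => //.
have hp : nrm (h - p) = m.
  apply/le_anti/andP; split; last exact: mle.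
  apply/ler_addgt0Pr => e e0.
  move/cvg_nrmP: fp => /(_ _ (divr_gt0 e0 (ltr0Sn R 1)))[N _ hN].
  pose M := maxn N (Num.bound (2 / e)).
  have [_ fM] := fP M.
  apply: (le_trans (nrm_sub_trans (f M) _ _)).
  have -> : m + e = (m + e / 2) + e / 2 by rewrite -addrA -splitr.
  rewrite lerD //; last by apply/ltW/hN; rewrite /= leq_maxl.
  apply: (le_trans (ltW fM)); rewrite lerD2l -[leRHS]invrK lef_pV2 ?posrE ?invr_gt0 ?divr_gt0 //.
  rewrite invf_div; apply: (le_trans (ltW (archi_boundP _))); first by rewrite divr_ge0 // ltW.
  by rewrite ler_nat (leq_trans _ (leqnSn _)) // leq_maxr.
have key k : V k -> rip (h - p) k = 0.
  move=> Vk; apply: (@quadratic_le0 _ _ (nrm k ^+ 2 / 2)) => t.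
  have := mle (t%:C *: k + p) (VD _ _ _ Vk Vp).
  rewrite -hp -(ler_pXn2r (_ : 0 < 2)%N) ?nnegrE ?nrm_ge0 //.
  rewrite opprD [- _ - p]addrC addrA [X in _ <= X -> _]sqr_nrmB.
  rewrite nrmZr ripZr exprMn real_normK ?num_real //; lra.
move=> k Vk; rewrite ipE key // key //.
by rewrite -[_ *: k]addr0; exact: VD.
Qed.

End Hilbert.

(** * Averages over boxes of a lattice *)

Section Lattice.
Context {R : realType} {n : nat}.
Local Notation G := 'rV[int]_n.+1.

Definition lattice_basis (j : 'I_n.+1) : G := delta_mx 0 j.
Local Notation e_ := lattice_basis.

Definition box_dir (q : nat) : 'I_n.+1 := inord (q %% n.+1).
Definition box_shift (q : nat) : G := e_ (box_dir q) *+ (2 ^ (q %/ n.+1)).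

(* box q has 2 ^ q points; step q doubles the side in the direction box_dir q *)
Fixpoint box (q : nat) : seq G :=
  if q is q'.+1 then box q' ++ [seq w + box_shift q' | w <- box q'] else [:: 0].

Lemma size_box q : size (box q) = (2 ^ q)%N.
Proof. by elim: q => //= q IH; rewrite size_cat size_map IH addnn -mul2n expnS. Qed.

Lemma box_dirE q : box_dir q = (q %% n.+1)%N :> nat.
Proof. by rewrite /box_dir inordK // ltn_pmod. Qed.

Lemma box_shiftE q i :
  box_shift q 0 i = if i == box_dir q then (2 ^ (q %/ n.+1))%:Z else 0.
Proof.
rewrite /box_shift mulmxnE mxE eqxx /=.
by case: eqVneq => _ /=; rewrite ?mul0rn ?natz.
Qed.

(** The exponent counts the k < q congruent to i modulo n + 1, that is, the steps at which the side
    in direction i has been doubled. *)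
Lemma box_bound q w i : w \in box q ->
  0 <= w 0 i < (2 ^ ((q + (n - i)) %/ n.+1))%:Z.
Proof.
elim: q w => [|q IH] w /=.
  by rewrite inE => /eqP ->; rewrite mxE lexx ltz_nat expn_gt0.
have qle : ((q + (n - i)) %/ n.+1 <= (q.+1 + (n - i)) %/ n.+1)%N.
  by rewrite leq_div2r // addSn leqnSn.
have plus (v : G) : v \in box q ->
    0 <= v 0 i < (2 ^ ((q.+1 + (n - i)) %/ n.+1))%:Z.
  move=> /IH /andP[-> h] /=; apply: lt_le_trans h _.
  by rewrite lez_nat leq_exp2l.
rewrite mem_cat => /orP[/plus //|/mapP[v vq ->]].
rewrite mxE box_shiftE; case: eqVneq => [iE|_]; last by rewrite addr0 plus.
have /andP[v0 v1] := IH _ vq.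
have ie : (i : nat) = (q %% n.+1)%N by rewrite iE box_dirE.
have h1 : ((q + (n - i)) %/ n.+1 = q %/ n.+1)%N.
  rewrite {1}(divn_eq q n.+1) -ie -addnA subnKC; last by rewrite -ltnS.
  by rewrite divnMDl // (@divn_small n) // addn0.
have h2 : ((q.+1 + (n - i)) %/ n.+1 = (q %/ n.+1).+1)%N.
  rewrite {1}(divn_eq q n.+1) -ie addSn -addnA subnKC; last by rewrite -ltnS.
  by rewrite -addnS divnMDl // divnn /= addn1.
rewrite h1 in v1; rewrite h2 expnS mul2n -addnn.
apply/andP; split; first by rewrite addr_ge0.
by rewrite PoszD ltrD2r.
Qed.

(** Step q translates by exactly the side of [box q] in the direction [box_dir q], so the two halves
    are separated by that coordinate. Distinctness is what the Bessel bound requires. *)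
Lemma uniq_box q : uniq (box q).
Proof.
elim: q => //= q IH; rewrite cat_uniq IH map_inj_uniq ?IH; last exact: addIr.
rewrite andbT /=; apply/hasPn => w /mapP[v vq ->]; apply/negP => hq.
have ie : (box_dir q : nat) = (q %% n.+1)%N by rewrite box_dirE.
have h1 : ((q + (n - box_dir q)) %/ n.+1 = q %/ n.+1)%N.
  rewrite {1}(divn_eq q n.+1) -ie -addnA subnKC; last by rewrite -ltnS.
  by rewrite divnMDl // (@divn_small n) // addn0.
have /andP[_] := box_bound (box_dir q) hq.
have /andP[+ _] := box_bound (box_dir q) vq.
rewrite mxE box_shiftE eqxx h1 => v0.
by rewrite -ltrBrDr subrr ltNge v0.
Qed.

Context {V : zmodType} (N : V -> R).
Hypothesis ND : forall x y, N (x + y) <= N x + N y.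
Hypothesis NN : forall x, N (- x) = N x.
Hypothesis NMn : forall x m, N (x *+ m) = m%:R * N x.

Lemma seminorm_sum I (r : seq I) (f : I -> V) :
  N (\sum_(i <- r) f i) <= \sum_(i <- r) N (f i).
Proof.
elim: r => [|i r IH]; first by rewrite !big_nil -[0](mulr0n (0 : V)) NMn mul0r.
by rewrite !big_cons (le_trans (ND _ _)) // lerD2l.
Qed.

Lemma seminorm0 : N 0 = 0.
Proof. by rewrite -(mulr0n (0 : V)) NMn mul0r. Qed.

(** In the application [F j z] is the norm of the increment itself and [b q] bounds its mean over 2
    ^ q distinct points. The factor in [bB] is the number of basis steps in [box_shift q]. *)
Context (u : G -> V) (F : 'I_n.+1 -> G -> R) (b : nat -> R) (B : R).
Hypothesis uF : forall j z, N (u (z + e_ j) - u z) <= F j z.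
Hypothesis b_ge0 : forall q, 0 <= b q.
Hypothesis Fb : forall j q (s : seq G), uniq s -> size s = (2 ^ q)%N ->
  \sum_(w <- s) F j w <= 2 ^+ q * b q.
Hypothesis bB : forall q, \sum_(0 <= i < q) 2 ^+ (i %/ n.+1) * b i <= B.

(** Sums rather than averages: V is only a zmodule, so the denominators 2 ^ q are cleared
    throughout. *)
Let U q z := \sum_(w <- box q) u (z + w).

Let US q z : U q.+1 z = U q z + U q (z + box_shift q).
Proof.
rewrite /U /= big_cat big_map; congr (_ + _).
by apply: eq_bigr => w _; congr u; rewrite -addrA; congr (_ + _); rewrite addrC.
Qed.

Let shift_basis q j z : N (U q (z + e_ j) - U q z) <= 2 ^+ q * b q.
Proof.
rewrite /U -sumrB.
apply: (le_trans (seminorm_sum _ _)).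
apply: (@le_trans _ _ (\sum_(w <- [seq z + w | w <- box q]) F j w)).
  rewrite big_map; apply: ler_sum => w _.
  by apply: le_trans (uF j (z + w)); rewrite addrAC.
by apply: Fb; rewrite ?size_map ?size_box // map_inj_uniq ?uniq_box //; exact: addrI.
Qed.

Let shift_basisMn q j k z : N (U q (z + e_ j *+ k) - U q z) <= k%:R * (2 ^+ q * b q).
Proof.
elim: k => [|k IH]; first by rewrite mulr0n addr0 subrr seminorm0 mul0r.
rewrite mulrSr addrA -(subrKA (U q (z + e_ j *+ k))) (le_trans (ND _ _)) //.
have -> : k.+1%:R = 1 + k%:R :> R by rewrite -natr1 addrC.
by rewrite mulrDl mul1r lerD.
Qed.

(** L is the length of a lattice path from 0 to x. It does not depend on q, so after division by 2 ^
    q the effect of the shift is of the order of [b q]. *)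
Let shift_any x : exists L : R, 0 <= L /\ forall q z, N (U q (z + x) - U q z) <= L * (2 ^+ q * b q).
Proof.
have bq q : 0 <= 2 ^+ q * b q by rewrite mulr_ge0 // exprn_ge0.
have PN y : (exists L : R, 0 <= L /\ forall q z, N (U q (z + y) - U q z) <= L * (2 ^+ q * b q)) ->
    exists L : R, 0 <= L /\ forall q z, N (U q (z - y) - U q z) <= L * (2 ^+ q * b q).
  move=> [L [L0 H]]; exists L; split=> // q z.
  by have := H q (z - y); rewrite subrK -NN opprB.
have PD y y' : (exists L : R, 0 <= L /\ forall q z, N (U q (z + y) - U q z) <= L * (2 ^+ q * b q)) ->
    (exists L : R, 0 <= L /\ forall q z, N (U q (z + y') - U q z) <= L * (2 ^+ q * b q)) ->
    exists L : R, 0 <= L /\ forall q z, N (U q (z + (y + y')) - U q z) <= L * (2 ^+ q * b q).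
  move=> [L [L0 H]] [L' [L0' H']]; exists (L' + L); split=> [|q z]; first exact: addr_ge0.
  rewrite addrA -(subrKA (U q (z + y))) (le_trans (ND _ _)) //.
  by rewrite mulrDl lerD.
rewrite [x]matrix_sum_delta big_ord1.
elim/big_ind: _ => [|y y' h h'|j _]; [|exact: PD|].
  by exists 0; split => // q z; rewrite addr0 subrr seminorm0 mul0r.
rewrite -[delta_mx 0 j]/(e_ j); case: (x 0 j) => k.
  exists k%:R; split => // q z.
  by rewrite -natz scaler_nat; exact: shift_basisMn.
rewrite NegzE scaleNr; apply: PN; exists k.+1%:R; split => // q z.
by rewrite -natz scaler_nat; exact: shift_basisMn.
Qed.

(** An infinite set of such z would contain 2 ^ q distinct points for every q, with mean above eps;
    but [bB] forces [b q <= eps] for some q. *)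
Let Fsmall j (eps : R) : 0 < eps -> finite_set [set z | eps < F j z].
Proof.
move=> e0; apply: contrapT => /infinite_set_fset infF.
have [q bq] : exists q, b q <= eps.
  apply: contrapT => /forallNP bq.
  have be q : eps <= b q by have := bq q; move/negP; rewrite -ltNge => /ltW.
  have [k kB] : exists k : nat, B < eps * k%:R.
    exists (Num.bound (`|B| / eps)); rewrite mulrC -ltr_pdivrMr //.
    apply: le_lt_trans (archi_boundP _); last by rewrite divr_ge0 // ltW.
    by rewrite ler_pM2r ?invr_gt0 // ler_norm.
  suff /le_lt_trans : eps * k%:R <= B by move=> /(_ _ kB); rewrite ltxx.
  apply: le_trans (bB k).
  rewrite mulr_natr -[X in _ *+ X](subn0 k) -sumr_const_nat; apply: ler_sum => i _.
  by rewrite (le_trans (be i)) // ler_peMl // exprn_ege1 // ler1n.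
have [C CF sC] := infF (2 ^ q)%N.
pose s := take (2 ^ q) (finmap.enum_fset C).
have us : uniq s by apply: take_uniq; exact: finmap.fset_uniq.
have ss : size s = (2 ^ q)%N by rewrite size_takel.
have := Fb j us ss; apply/negP; rewrite -ltNge.
apply: (@lt_le_trans _ _ (\sum_(w <- s) F j w)); last exact: lexx.
apply: (@le_lt_trans _ _ (\sum_(w <- s) eps)).
  by rewrite big_const_seq count_predT iter_addr_0 ss -[_ *+ (_ ^ _)]mulr_natl natrX ler_wpM2l // exprn_ge0.
have: forall w, w \in s -> eps < F j w by move=> w /mem_take ws; exact: CF.
have : (0 < size s)%N by rewrite ss expn_gt0.
elim: (s) => //= w s' IH _ h; rewrite !big_cons.
apply: ltr_leD; first by apply: h; rewrite mem_head.
case: s' IH h => [|v s'] IH h; first by rewrite !big_nil.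
by apply/ltW/IH => // y ys; apply: h; rewrite inE ys orbT.
Qed.

(** Telescoping along a lattice path from 0 to x: the exceptional set lies in a finite union of
    translates of the sets of [Fsmall]. *)
Let near_shift x (eps : R) : 0 < eps ->
  finite_set [set z | eps < N (u (z + x) - u z)].
Proof.
move: eps.
have PD y y' : (forall eps : R, 0 < eps -> finite_set [set z | eps < N (u (z + y) - u z)]) ->
    (forall eps : R, 0 < eps -> finite_set [set z | eps < N (u (z + y') - u z)]) ->
    forall eps : R, 0 < eps -> finite_set [set z | eps < N (u (z + (y + y')) - u z)].
  move=> H H' eps e0; have e20 : 0 < eps / 2 by rewrite divr_gt0.
  apply: (@sub_finite_set _ _ ([set z | eps / 2 < N (u (z + y) - u z)] `|`
      [set z | eps / 2 < N (u (z + y + y') - u (z + y))])).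
    move=> z /= h; apply: contrapT => /not_orP[/negP + /negP]; rewrite -!leNgt => h1 h2.
    move: h; apply/negP; rewrite -leNgt addrA -(subrKA (u (z + y))) (le_trans (ND _ _)) //.
    by rewrite [leRHS]splitr lerD.
  rewrite finite_setU; split; first exact: H.
  apply: (@sub_finite_set _ _ ((fun z => z - y) @` [set z | eps / 2 < N (u (z + y') - u z)])).
    by move=> z /= h; exists (z + y) => //; rewrite addrK.
  exact/finite_image/H'.
have PN y : (forall eps : R, 0 < eps -> finite_set [set z | eps < N (u (z + y) - u z)]) ->
    forall eps : R, 0 < eps -> finite_set [set z | eps < N (u (z - y) - u z)].
  move=> H eps e0.
  apply: (@sub_finite_set _ _ ((fun z => z + y) @` [set z | eps < N (u (z + y) - u z)])).
    by move=> z /= h; exists (z - y); rewrite subrK // -NN opprB.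
  exact/finite_image/H.
have P0 : forall eps : R, 0 < eps -> finite_set [set z | eps < N (u (z + 0) - u z)].
  move=> eps e0; apply: (@sub_finite_set _ _ set0) => // z /=.
  by rewrite addr0 subrr seminorm0 ltNge ltW.
rewrite [x]matrix_sum_delta big_ord1.
elim/big_ind: _ => [|y y' h h'|j _]; [exact: P0|exact: PD|].
have PM k : forall eps : R, 0 < eps -> finite_set [set z | eps < N (u (z + e_ j *+ k) - u z)].
  elim: k => [|k IH]; first by rewrite mulr0n.
  rewrite mulrS; apply: PD => // eps e0.
  apply: sub_finite_set (Fsmall j e0) => z /= h.
  exact: lt_le_trans h (uF _ _).
rewrite -[delta_mx 0 j]/(e_ j); case: (x 0 j) => k.
  by rewrite -natz scaler_nat; exact: PM.
by rewrite NegzE scaleNr -natz scaler_nat; apply: PN; exact: PM.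
Qed.

(** By [US], one doubling replaces U q z by 2 U q z plus a translation difference, whose cost is
    that of 2 ^ (q %/ n.+1) basis steps; the differences telescope. *)
Let step Q k z : N (U (Q + k) z - U Q z *+ 2 ^ k) <=
  2 ^+ (Q + k) * \sum_(Q <= i < Q + k) 2 ^+ (i %/ n.+1) * b i.
Proof.
elim: k => [|k IH]; first by rewrite addn0 expn0 mulr1n subrr seminorm0 big_geq ?mulr0.
rewrite addnS US big_nat_recr ?leq_addr //= expnS mulnC mulrnA.
set q := (Q + k)%N in IH *.
have -> : U q z + U q (z + box_shift q) - U Q z *+ 2 ^ k *+ 2 =
    (U q (z + box_shift q) - U q z) + (U q z - U Q z *+ 2 ^ k) *+ 2.
  rewrite mulrnBl [in RHS]addrA; congr (_ - _).
  by rewrite mulr2n addrA subrK addrC.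
apply: (le_trans (ND _ _)); rewrite NMn [leLHS]addrC mulrDr lerD //; first by rewrite exprS -mulrA ler_wpM2l.
apply: (le_trans (shift_basisMn q (box_dir q) (2 ^ (q %/ n.+1)) z)).
rewrite natrX mulrCA ler_wpM2r //; first by rewrite mulr_ge0 // exprn_ge0.
by rewrite exprS ler_peMl ?ler1n // exprn_ge0.
Qed.

Let tail (eps : R) : 0 < eps -> exists Q, forall k,
  \sum_(Q <= i < Q + k) 2 ^+ (i %/ n.+1) * b i < eps.
Proof.
move=> e0; pose c i := 2 ^+ (i %/ n.+1) * b i.
have c0 i : 0 <= c i by rewrite mulr_ge0 // exprn_ge0.
have /cauchy_cvgP/cauchy_seriesP/(_ _ e0) [[A A'] /= [[Q _ AQ] [Q' _ AQ']] h] : cvgn (series c).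
  apply: nondecreasing_is_cvgn; first exact: nondecreasing_series.
  by exists B => _ [k _ <-]; exact: bB.
exists (maxn Q Q') => k.
have /= := h (maxn Q Q', maxn Q Q' + k)%N.
rewrite ger0_norm; last by apply: sumr_ge0.
apply; split; first by apply: AQ => /=; lia.
by apply: AQ' => /=; lia.
Qed.

Let b_tends (eps : R) Q : 0 < eps -> exists k, b (Q + k) <= eps.
Proof.
move=> /tail[Q' /(_ Q.+1) h]; exists Q'.
apply: ltW; apply: le_lt_trans h.
have -> : (Q' + Q.+1 = (Q + Q').+1)%N by lia.
rewrite big_nat_recr /=; last by lia.
apply: (@le_trans _ _ (2 ^+ ((Q + Q') %/ n.+1) * b (Q + Q')%N)).
  by rewrite ler_peMl // exprn_ege1 // ler1n.
by rewrite lerDr; apply: sumr_ge0 => i _; rewrite mulr_ge0 // exprn_ge0.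
Qed.

(* Up to the tail of bB, the averages of u over large boxes based at z stay close to u z if z
   avoids a finite set, while by shift_any they are asymptotically independent of z. *)
Lemma lattice_cauchy (eps : R) : 0 < eps -> exists S : set G,
  finite_set S /\ forall z z', ~ S z -> ~ S z' -> N (u z - u z') <= eps.
Proof.
move=> e0.
(* Comparing u with its large box sum costs 2 eps / 5 at each of z and z', and comparing the two box
   sums costs eps / 5. *)
have e5 : 0 < eps / 5 by rewrite divr_gt0.
have [Q hQ] := tail e5.
(* Only at the fixed level Q are the points of a box compared with its base point one by one, so
   only finitely many z are excluded. *)
pose A := \bigcup_(w in [set` box Q]) [set z | eps / 5 < N (u (z + w) - u z)].
have finA : finite_set A.
  by apply: bigcup_finite; [exact: finite_seq|move=> w _; exact: near_shift].
have hA z : ~ A z -> N (U Q z - u z *+ 2 ^ Q) <= 2 ^+ Q * (eps / 5).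
  move=> nA.
  have -> : U Q z - u z *+ 2 ^ Q = \sum_(w <- box Q) (u (z + w) - u z).
    by rewrite sumrB big_const_seq count_predT iter_addr_0 size_box.
  apply: (le_trans (seminorm_sum _ _)).
  apply: (@le_trans _ _ (\sum_(w <- box Q) eps / 5)).
    rewrite big_seq [leRHS]big_seq; apply: ler_sum => w wQ.
    by rewrite leNgt; apply/negP => h; apply: nA; exists w.
  by rewrite big_const_seq count_predT iter_addr_0 size_box -[_ *+ (_ ^ _)]mulr_natl natrX.
exists A; split => // z z' nz nz'.
(* L, hence k, depends on z and z', whereas Q and A were fixed before: [step] holds for all k with
   the same tail bound. *)
have [L [L0 hL]] := shift_any (z - z').
have eL : 0 < eps / 5 / (L + 1) by rewrite divr_gt0 // ltr_wpDl.
have [k hk] := b_tends Q eL.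
have main x : ~ A x -> N (U (Q + k) x - u x *+ 2 ^ (Q + k)) <= 2 ^+ (Q + k) * (2 * (eps / 5)).
  move=> nx; rewrite expnD mulrnA.
  rewrite -(subrKA (U Q x *+ 2 ^ k)) (le_trans (ND _ _)) // mulr_natl mulr2n mulrDr lerD //.
    by rewrite (le_trans (step Q k x)) // ler_wpM2l ?exprn_ge0 // ltW.
  rewrite -mulrnBl NMn natrX exprD (mulrC (2 ^+ Q)) -mulrA ler_wpM2l ?exprn_ge0 //.
  exact: hA.
have dist : N (U (Q + k) z - U (Q + k) z') <= 2 ^+ (Q + k) * (eps / 5).
  have := hL (Q + k)%N z'; rewrite (addrC z' (z - z')) subrK => /le_trans; apply.
  rewrite mulrCA ler_wpM2l ?exprn_ge0 //.
  apply: (@le_trans _ _ (L * (eps / 5 / (L + 1)))); first by rewrite ler_wpM2l.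
  rewrite mulrA ler_pdivrMr ?ltr_wpDl // mulrC ler_wpM2l ?(ltW e5) //.
  by rewrite lerDl.
have p0 : 0 < 2 ^+ (Q + k) :> R by rewrite exprn_gt0.
rewrite -(ler_pM2l p0) -natrX -NMn mulrnBl natrX.
have -> : u z *+ 2 ^ (Q + k) - u z' *+ 2 ^ (Q + k) =
  - (U (Q + k) z - u z *+ 2 ^ (Q + k)) + ((U (Q + k) z - U (Q + k) z') +
    (U (Q + k) z' - u z' *+ 2 ^ (Q + k))).
  by rewrite subrKA opprB subrKA.
apply: (le_trans (ND _ _)); rewrite NN; apply: (le_trans (lerD (lexx _) (ND _ _))).
have := main _ nz; have := main _ nz'.
move: dist; set p := 2 ^+ (Q + k) => *.
have -> : p * eps = p * (2 * (eps / 5)) + (p * (eps / 5) + p * (2 * (eps / 5))) by field.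
by rewrite lerD // lerD.
Qed.

End Lattice.

(** * Lorentz sequences and singular values *)

Section Hardy.
Context {R : realType}.

(* Hardy's inequality for the quadratic means of a sequence in the Lorentz
   space (n,1); it fails for n <= 2, where 2 ^ (1/n) >= sqrt 2. *)
Lemma lorentz_quadratic_means (n : nat) (s : R^nat) : (3 <= n)%N ->
  nonincreasing_seq s -> (forall j, 0 <= s j) ->
  (\sum_(0 <= j <oo) (s j * j.+1%:R `^ (n%:R^-1 - 1))%:E < +oo)%E ->
  exists B : R, forall Q, \sum_(0 <= q < Q)
    2 ^+ (q %/ n) * Num.sqrt ((\sum_(0 <= j < 2 ^ q) s j ^+ 2) / 2 ^+ q) <= B.
Proof.
move=> n3 snoninc s0 sfin.
pose w j : R := j.+1%:R `^ (n%:R^-1 - 1).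
have w0 j : 0 <= w j by exact: powR_ge0.
have [L hL] : exists L : R, forall m, \sum_(0 <= j < m) s j * w j <= L.
  exists (fine (\sum_(0 <= j <oo) (s j * w j)%:E)%E) => m.
  rewrite -lee_fin fineK; last first.
    rewrite ge0_fin_numE //; apply: nneseries_ge0 => i _ _.
    by rewrite lee_fin mulr_ge0.
  rewrite -sumEFin; apply: (nneseries_lim_ge m) => i _ _.
  by rewrite lee_fin mulr_ge0.
have n0 : (0 < n)%N by exact: leq_trans n3.
pose th : R := 2 `^ n%:R^-1.
have th0 : 0 < th by rewrite powR_gt0.
have th1 : 1 <= th by rewrite -(powRr0 2) ler_powR // ?invr_ge0 // ler1n.
have thn : th ^+ n = 2.
  by rewrite /th -powR_mulrn ?powR_ge0 // -powRrM mulVf ?powRr1 // pnatr_eq0 -lt0n.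
have dth q : 2 ^+ (q %/ n) <= th ^+ q.
  rewrite [in leRHS](divn_eq q n) exprD mulnC exprM thn ler_peMr ?exprn_ge0 //.
  exact: exprn_ege1.
pose sg : R := Num.sqrt 2.
have sg2 : sg ^+ 2 = 2 by rewrite sqr_sqrtr.
have sg0 : 0 < sg by rewrite sqrtr_gt0.
(* Here n >= 3 enters: th ^+ 3 <= th ^+ n = 2 gives th ^+ 6 <= 4 < 8 = sg ^+ 6. *)
have thsg : th < sg.
  rewrite -(ltr_pXn2r (_ : 0 < 6)%N) // ?nnegrE ?ltW //.
  have -> : sg ^+ 6 = 8 by rewrite (exprM sg 2 3) sg2; ring.
  have le3 : th ^+ 3 <= 2.
    by rewrite -[leRHS]thn; apply: ler_weXn2l.
  apply: (@le_lt_trans _ _ 4); last by rewrite ltr_nat.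
  rewrite (exprM th 3 2) (_ : 4 = 2 ^+ 2); last by ring.
  by rewrite ler_pXn2r // nnegrE // exprn_ge0 // ltW.
pose rho := th / sg.
have rho1 : rho < 1 by rewrite ltr_pdivrMr // mul1r.
have rho0 : 0 <= rho by rewrite divr_ge0 // ltW.
pose A k := s (2 ^ k)%N.
have A0 k : 0 <= A k by exact: s0.
have wE k j : (j < 2 ^ k)%N -> (th / 2) ^+ k <= w j.
  move=> jk; rewrite (_ : th / 2 = 2 `^ (n%:R^-1 - 1)); last first.
    by rewrite powRB ?powRr1 //; apply/implyP.
  rewrite -powR_mulrn ?powR_ge0 // -powRrM mulrC powRrM powR_mulrn //.
  rewrite /w -[_ - 1]opprK [leLHS]powRN [leRHS]powRN lef_pV2 ?posrE ?powR_gt0 ?exprn_gt0 //.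
  rewrite ge0_ler_powR ?nnegrE ?exprn_ge0 //.
    by rewrite opprB subr_ge0 invf_le1 ?ltr0n // ler1n.
  by rewrite -natrX ler_nat.
(* Condensation: on the block from 2 ^ K to 2 ^ K.+1 one has [s j >= A K.+1] and
   [w j >= (th / 2) ^+ K.+1]. The block has 2 ^ K indices, half of 2 ^ K.+1, whence the factor 2. *)
have sumA K : \sum_(0 <= k < K) th ^+ k.+1 * A k.+1 <= 2 * L.
  apply: (@le_trans _ _ (2 * \sum_(0 <= j < 2 ^ K) s j * w j)); last first.
    by rewrite ler_pM2l.
  elim: K => [|K IH].
    by rewrite big_geq // mulr_ge0 // sumr_ge0 // => i _; rewrite mulr_ge0.
  rewrite big_nat_recr //= [in leRHS](big_cat_nat (n := (2 ^ K)%N)) //=; last first.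
    by rewrite leq_exp2l.
  rewrite mulrDr lerD //.
  apply: (@le_trans _ _ (2 * \sum_(2 ^ K <= i < 2 ^ K.+1) A K.+1 * (th / 2) ^+ K.+1)).
    rewrite sumr_const_nat expnS mul2n -addnn addnK -[_ *+ (_ ^ _)]mulr_natl natrX.
    rewrite expr_div_n exprS [in leRHS]exprS le_eqVlt; apply/orP; left; apply/eqP.
    by field; rewrite expf_neq0.
  rewrite ler_pM2l //; apply: ler_sum_nat => i /andP[_ iK].
  apply: ler_pM => //; first by rewrite exprn_ge0 // divr_ge0 // ltW.
    by apply: snoninc; exact: ltnW.
  exact: wE.
have sumA' K : \sum_(0 <= k < K) th ^+ k * A k <= A 0 + 2 * L.
  case: K => [|K].
    rewrite big_geq // addr_ge0 // mulr_ge0 //.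
    by apply: le_trans (hL 0%N); rewrite big_geq.
  by rewrite big_nat_recl // expr0 mul1r lerD2l.
(* x q dominates the l2 norm of the first 2 ^ q terms: block k has 2 ^ k terms, each at most A k,
   hence l2 norm at most sg ^+ k * A k. *)
pose x q := s 0%N + \sum_(0 <= k < q) sg ^+ k * A k.
have x0 q : 0 <= x q.
  rewrite addr_ge0 // sumr_ge0 // => i _.
  by rewrite mulr_ge0 // exprn_ge0 // ltW.
have xS q : x q.+1 = x q + sg ^+ q * A q by rewrite /x big_nat_recr //= addrA.
have sumsq q : \sum_(0 <= j < 2 ^ q) s j ^+ 2 <= x q ^+ 2.
  elim: q => [|q IH]; first by rewrite expn0 big_nat1 /x big_geq // addr0.
  rewrite (big_cat_nat (n := (2 ^ q)%N)) //=; last by rewrite leq_exp2l.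
  apply: (@le_trans _ _ (x q ^+ 2 + (sg ^+ q * A q) ^+ 2)).
    rewrite lerD //.
    apply: (@le_trans _ _ (\sum_(2 ^ q <= i < 2 ^ q.+1) A q ^+ 2)).
      apply: ler_sum_nat => i /andP[iq _].
      by rewrite ler_pXn2r ?nnegrE // snoninc.
    rewrite sumr_const_nat expnS mul2n -addnn addnK -[_ *+ (_ ^ _)]mulr_natl natrX.
    by rewrite exprMn -exprM mulnC exprM sg2.
  rewrite xS [leRHS]sqrrD [leRHS]addrAC lerDl.
  by rewrite mulrn_wge0 // mulr_ge0 // mulr_ge0 // exprn_ge0 // ltW.
exists ((s 0%N + (A 0 + 2 * L)) / (1 - rho)) => Q.
rewrite ler_pdivlMr ?subr_gt0 //.
apply: (@le_trans _ _ ((1 - rho) * \sum_(0 <= q < Q) rho ^+ q * x q)).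
  rewrite mulrC ler_pM2l ?subr_gt0 //; apply: ler_sum => q _.
  rewrite /rho expr_div_n -mulrA; apply: ler_pM => //.
  rewrite -[leRHS]ger0_norm ?mulr_ge0 ?invr_ge0 ?exprn_ge0 ?(ltW sg0) //.
  rewrite -sqrtr_sqr ler_sqrt ?sqr_ge0 //.
  rewrite exprMn exprVn -exprM mulnC exprM sg2 mulrC.
  by rewrite ler_pM2l ?invr_gt0 ?exprn_gt0.
(* Summation by parts against the geometric weights rho ^+ q, which replaces the exchange of the
   sums over q and k. *)
have abel : (1 - rho) * \sum_(0 <= q < Q) rho ^+ q * x q + rho ^+ Q * x Q =
    s 0%N + \sum_(0 <= q < Q) rho ^+ q.+1 * (sg ^+ q * A q).
  elim: Q => [|Q IH].
    by rewrite !big_geq // mulr0 add0r expr0 mul1r /x big_geq // addr0.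
  rewrite !big_nat_recr //= addrA -IH xS exprS; ring.
apply: (@le_trans _ _ (s 0%N + \sum_(0 <= q < Q) rho ^+ q.+1 * (sg ^+ q * A q))).
  by rewrite -abel lerDl mulr_ge0 // exprn_ge0.
rewrite lerD2l; apply: le_trans (sumA' Q); apply: ler_sum => q _.
rewrite mulrA ler_wpM2r //.
apply: (@le_trans _ _ (rho ^+ q * sg ^+ q)).
  by rewrite ler_wpM2r ?exprn_ge0 ?(ltW sg0) // exprS ler_piMl ?exprn_ge0 // ltW.
by rewrite -exprMn /rho divfK // gt_eqF.
Qed.

End Hardy.

(** * Singular vectors of a compact operator *)

Section SingularValues.
Context {R : realType} {H : completeNormedModType R[i]} (ip : {dot H for Num.conj}).
Hypothesis Hip : inner_product_of_norm ip.

Lemma orthogonal_le_dim (V : set H) m p (v : 'I_p -> H) : has_dimension V m ->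
  (forall i, V (v i)) -> (forall i, v i <> 0) ->
  (forall i j, i != j -> ip (v i) (v j) = 0) -> (p <= m)%N.
Proof.
move=> [b _ VE] vV v0 vo.
have ex i : exists c : 'I_m -> R[i], v i = \sum_(l < m) c l *: b l.
  by have := vV i; rewrite VE => -[c _ <-]; exists c.
have [c cE] := choice ex.
pose A := \matrix_(i < p, l < m) c i l.
have /eqP <- : row_free A; last exact: rank_leq_col.
apply: inj_row_free => x xA0.
have sum0 : \sum_(i < p) x 0 i *: v i = 0.
  under eq_bigr do rewrite cE scaler_sumr.
  rewrite exchange_big big1 //= => l _.
  under eq_bigr do rewrite scalerA.
  rewrite -scaler_suml.
  have /rowP/(_ l) := xA0; rewrite !mxE => E.
  rewrite (_ : \sum_(i < p) _ = 0) ?scale0r // -[RHS]E.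
  by apply: eq_bigr => i _; rewrite mxE.
apply/rowP => i; rewrite mxE.
have : ip (\sum_(i < p) x 0 i *: v i) (v i) = 0 by rewrite sum0 ip0l.
rewrite ip_suml (bigD1 i) //= big1 ?addr0 => [|j ji]; last first.
  by rewrite ipZl vo // mulr0.
rewrite ipZl => /eqP; rewrite mulf_eq0 => /orP[/eqP //|].
by rewrite dnorm_eq0 => /eqP /v0.
Qed.

(** A cluster point stands in for the limit of a subsequence; the indices are picked later, together
    with the maximizing condition. *)
Lemma compact_cluster_seq (K : H -> H) (h : nat -> H) : compact_operator K ->
  (forall m, nrm (h m) <= 1) ->
  exists g, forall e : R, 0 < e -> forall M, exists m, (M <= m)%N /\ nrm (K (h m) - g) < e.
Proof.
move=> [lK cK] h1.
have PF : ProperFilter ((K \o h) @ \oo) by exact: fmap_proper_filter.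
have [|g [_ hg]] := cK _ PF.
  exists 0%N => // m _ /=; apply: subset_closure; exists (h m) => //=.
  by rewrite nrmE -[1]/(1%:C) lecR.
exists g => e e0 M.
have [||_ [[m /= Mm <-]]] := hg ((K \o h) @` [set m | (M <= m)%N]) (ball g e%:C).
- by exists M => // m /= Mm; exists m.
- by apply: nbhsx_ballx; rewrite ltcR.
rewrite -ball_normE /ball_ /= nrmE ltcR nrmBC => lt.
by exists m.
Qed.

Lemma compact_operator_bounded (K : H -> H) :
  compact_operator K -> bounded_operator K.
Proof.
move=> cK; have lK := cK.1; split => //.
suff [B hB] : exists B : R, forall h, nrm h <= 1 -> nrm (K h) <= B.
  exists B => h; have [h0|h0] := eqVneq (nrm h) 0.
    by rewrite (nrm_eq0 h0) lin0 // nrm0 mulr0.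
  have hp : 0 < nrm h by rewrite lt_neqAle eq_sym h0 nrm_ge0.
  have := hB ((nrm h)^-1%:C *: h).
  rewrite linZ // !nrmZr ger0_norm ?invr_ge0 ?nrm_ge0 // mulVf // lexx.
  by move=> /(_ isT); rewrite mulrC ler_pdivrMr.
apply: contrapT => /forallNP nB.
have ex (m : nat) : exists h, nrm h <= 1 /\ m%:R < nrm (K h).
  have /existsNP[h /not_implyP[h1 /negP]] := nB m%:R.
  by rewrite -ltNge => ?; exists h.
have [h hP] := choice ex.
have h1 m : nrm (h m) <= 1 by have [] := hP m.
have [g hg] := compact_cluster_seq cK h1.
have g0 : 0 <= nrm g + 1 by rewrite addr_ge0 ?nrm_ge0.
have [m [Mm lt]] := hg 1 ltr01 (Num.bound (nrm g + 1)).
have [_ hm] := hP m.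
have : nrm (K (h m)) <= nrm g + 1.
  by rewrite -[K (h m)](subrK g) addrC (le_trans (nrmD _ _)) // lerD2l ltW.
apply/negP; rewrite -ltNge (le_lt_trans _ hm) //.
by rewrite (le_trans (ltW (archi_boundP g0))) // ler_nat.
Qed.

(** Weak compactness is not invoked. For a maximizing f with K (f p) close to a cluster point,
    [nrm (K (f a + f b))] is close to 2 M; so [nrm (f a + f b)] is close to 2 and the parallelogram
    identity makes f Cauchy. When M = 0 the vector e is 0 by convention. *)
Lemma sup_attained (K : H -> H) (V : set H) : compact_operator K -> V 0 ->
  (forall a x y, V x -> V y -> V (a *: x + y)) ->
  (forall (f : nat -> H) l, (forall n, V (f n)) -> f @ \oo --> l -> V l) ->
  exists M : R, exists e : H, [/\ 0 <= M, V e, M = 0 \/ nrm e = 1,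
    M = 0 -> e = 0 &
    nrm (K e) = M /\ forall h, V h -> nrm (K h) <= M * nrm h].
Proof.
move=> cK V0 VD Vc; have [lK [B hB]] := compact_operator_bounded cK.
have B0 h : nrm (K h) <= `|B| * nrm h.
  by rewrite (le_trans (hB _)) // ler_wpM2r ?nrm_ge0 // ler_norm.
pose S := [set nrm (K h) | h in [set h | V h /\ nrm h <= 1]].
have S0 : has_sup S.
  split; first by exists (nrm (K 0)), 0 => //; split => //; rewrite nrm0.
  exists `|B| => _ [h [_ h1] <-]; apply: (le_trans (B0 h)).
  by rewrite ler_piMr.
pose M := sup S.
have Mub h : V h -> nrm h <= 1 -> nrm (K h) <= M.
  by move=> Vh h1; apply: ub_le_sup; [exact: S0.2|exists h].
have M0 : 0 <= M.
  apply: le_trans (Mub 0 V0 _); first exact: nrm_ge0.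
  by rewrite nrm0.
have VZ a x : V x -> V (a *: x) by move=> Vx; rewrite -[_ *: _]addr0; apply: VD.
have Mle h : V h -> nrm (K h) <= M * nrm h.
  move=> Vh; have [h0|h0] := eqVneq (nrm h) 0.
    by rewrite (nrm_eq0 h0) lin0 // nrm0 mulr0.
  have hp : 0 < nrm h by rewrite lt_neqAle eq_sym h0 nrm_ge0.
  have := Mub ((nrm h)^-1%:C *: h) (VZ _ _ Vh).
  rewrite linZ // !nrmZr ger0_norm ?invr_ge0 ?nrm_ge0 // mulVf // lexx.
  by move=> /(_ isT); rewrite mulrC ler_pdivrMr.
exists M; have [Mz|Mz] := eqVneq M 0.
  by exists 0; split => //; [left|split => //; rewrite Mz lin0 // nrm0].
have Mp : 0 < M by rewrite lt_neqAle eq_sym Mz.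
have exh (m : nat) : exists h, [/\ V h, nrm h <= 1 & M - m.+1%:R^-1 < nrm (K h)].
  have [|_ [h [Vh h1] <-] lt] := @sup_adherent _ S m.+1%:R^-1 _ S0; first by rewrite invr_gt0.
  by exists h.
have [h hP] := choice exh.
have h1 m : nrm (h m) <= 1 by have [] := hP m.
have [g hg] := compact_cluster_seq cK h1.
have exf (p : nat) : exists f, [/\ V f, nrm f <= 1, M - p.+1%:R^-1 < nrm (K f) &
    nrm (K f - g) < p.+1%:R^-1].
  have [|m [pm lt]] := hg p.+1%:R^-1 _ p; first by rewrite invr_gt0.
  exists (h m); have [Vh hm1 Kh] := hP m; split => //.
  apply: le_lt_trans Kh; rewrite lerD2l lerN2 lef_pV2 ?posrE //.
  by rewrite ler_nat ltnS.
have [f fP] := choice exf.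
have inv_le (N n : nat) : (N <= n)%N -> n.+1%:R^-1 <= N.+1%:R^-1 :> R.
  by move=> Nn; rewrite lef_pV2 ?posrE // ler_nat ltnS.
have [e fe] : exists e : H, f @ \oo --> e.
  apply: (@sqr_cauchy_cvg _ _ _ (16 / M)) => N a b Na Nb.
  set d : R := N.+1%:R^-1.
  have d0 : 0 < d by rewrite invr_gt0.
  have [Vfa fa1 Ka ga] := fP a; have [Vfb fb1 Kb gb] := fP b.
  have le1 : 2 * M - 4 * d <= nrm (K (f a + f b)).
    rewrite linD //.
    have -> : K (f a) + K (f b) = K (f a) *+ 2 - (K (f a) - K (f b)).
      by rewrite mulr2n opprB [RHS]addrC addrA subrK addrC.
    have h2 : nrm (K (f a) - K (f b)) <= 2 * d.
      rewrite (le_trans (nrm_sub_trans g _ _)) // mulr_natl mulr2n lerD //.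
        by rewrite (le_trans (ltW ga)) // inv_le.
      by rewrite nrmBC (le_trans (ltW gb)) // inv_le.
    have h3 : 2 * (M - d) <= nrm (K (f a) *+ 2).
      rewrite nrmMn ler_pM2l // (le_trans _ (ltW Ka)) // lerD2l lerN2.
      exact: inv_le.
    have := nrmD (K (f a) *+ 2 - (K (f a) - K (f b))) (K (f a) - K (f b)).
    rewrite subrK; lra.
  have le2 : 2 * M - 4 * d <= M * nrm (f a + f b).
    by apply: (le_trans le1); apply: Mle; rewrite -[f a]scale1r; apply: VD.
  rewrite (sqr_nrmB Hip); move: le2; have := sqr_nrmD Hip (f a) (f b).
  have := nrm_ge0 (f a + f b); have := nrm_ge0 (f a); have := nrm_ge0 (f b).
  set x := nrm (f a + f b); set y := nrm (f a) in fa1 *; set z := nrm (f b) in fb1 *.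
  move=> z0 y0 x0 E le2.
  have -> : 2 * rip ip (f a) (f b) = x ^+ 2 - y ^+ 2 - z ^+ 2 by rewrite E; ring.
  rewrite -(ler_pM2l Mp) (_ : M * (16 / M * d) = 16 * d); last by field; rewrite gt_eqF.
  have y2 : y ^+ 2 <= 1 by rewrite expr_le1.
  have z2 : z ^+ 2 <= 1 by rewrite expr_le1.
  (* Tangent of the square at 2; with M x >= 2 M - 4 d it gives M (4 - x ^+ 2) <= 16 d, which is the
     origin of 16 / M. *)
  have tan : 4 * x - 4 <= x ^+ 2.
    have := sqr_ge0 (x - 2); rewrite sqrrB; lra.
  have : M * (4 * x - 4) <= M * x ^+ 2 by rewrite ler_pM2l.
  have : M * y ^+ 2 <= M * 1 by rewrite ler_pM2l.
  have : M * z ^+ 2 <= M * 1 by rewrite ler_pM2l.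
  lra.
have fV n : V (f n) by have [] := fP n.
have Ve := Vc _ _ fV fe.
have e1 : nrm e <= 1.
  have : nrm (f n) @[n --> \oo] --> nrm e by exact: cvg_nrm.
  move=> /(@closed_cvg _ _ \oo _ (nrm \o f) [set x | x <= 1]); apply => //.
  by apply: nearW => n; have [] := fP n.
have Ke : M <= nrm (K e).
  have cvK : nrm (K (f n)) @[n --> \oo] --> nrm (K e).
    by apply: cvg_nrm; apply: bounded_operator_cvg => //; exact: compact_operator_bounded.
  have cvM : (M - n.+1%:R^-1) @[n --> \oo] --> M - 0.
    apply: cvgB; first exact: cvg_cst.
    exact: cvg_harmonic.
  rewrite -[M]subr0; apply: (ler_cvg_to cvM cvK).
  by apply: nearW => n; have [_ _ /ltW] := fP n.
have e_ge1 : 1 <= nrm e.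
  by rewrite -(ler_pM2l Mp) mulr1 (le_trans Ke) // Mle.
have e1E : nrm e = 1 by apply/le_anti; rewrite e1.
exists e; split => //; first by right.
  by move=> Mz'; rewrite Mz' eqxx in Mz.
split => //; apply/le_anti; rewrite Ke andbT.
by have := Mle _ Ve; rewrite e1E mulr1.
Qed.

(* Greedy choice of an eigenvector of K^* K orthogonal to the family e. *)
Lemma next_singular_vector (K : H -> H) N (e : nat -> H) (M : nat -> R) :
  compact_operator K ->
  (forall i j, (i < N)%N -> (j < N)%N -> i != j -> ip (e i) (e j) = 0) ->
  (forall i, (i < N)%N -> e i = 0 \/ nrm (e i) = 1) ->
  (forall i k, (i < N)%N -> ip (K (e i)) (K k) = (M i ^+ 2)%:C * ip (e i) k) ->
  exists x : H * R, [/\ 0 <= x.2, forall i, (i < N)%N -> ip x.1 (e i) = 0,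
    x.2 = 0 \/ nrm x.1 = 1, x.2 = 0 -> x.1 = 0 &
    (forall k, ip (K x.1) (K k) = (x.2 ^+ 2)%:C * ip x.1 k) /\
    (forall g, (forall i, (i < N)%N -> ip g (e i) = 0) -> nrm (K g) <= x.2 * nrm g)].
Proof.
move=> cK eo e1 eK; have lK := cK.1.
pose V := [set g | forall i, (i < N)%N -> ip g (e i) = 0].
have VD a x y : V x -> V y -> V (a *: x + y).
  by move=> Vx Vy i iN; rewrite ipDl ipZl Vx // Vy // mulr0 addr0.
have Vc (f : nat -> H) l : (forall n, V (f n)) -> f @ \oo --> l -> V l.
  move=> Vf fl i iN; rewrite ipE.
  have lim0 (k : H) : (forall n, rip ip (f n) k = 0) -> rip ip l k = 0.
    move=> z; have : rip ip (f n) k @[n --> \oo] --> rip ip l k by exact: cvg_rip.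
    under eq_fun do rewrite z.
    by move=> /cvg_lim <- //; rewrite lim_cst.
  by rewrite !lim0 // => n; rewrite ?ripiZr // /rip Vf.
have V0 : V 0 by move=> i iN; rewrite ip0l.
have [m [x [m0 Vx mx mx0 [Kx mle]]]] := sup_attained cK V0 VD Vc.
exists (x, m); split => //=; split => // k.
have [mz|mn] := eqVneq m 0.
  by rewrite mx0 // lin0 // !ip0l mulr0.
have x1 : nrm x = 1 by case: mx => // mz; rewrite mz eqxx in mn.
(* First variation at x, in the direction w, of the inequality nrm (K v) ^+ 2 <= m ^+ 2 * nrm v ^+
   2, an equality at x. *)
have onV v : V v -> ip (K x) (K v) = (m ^+ 2)%:C * ip x v.
  have key w : V w -> rip ip (K x) (K w) = m ^+ 2 * rip ip x w.
    move=> Vw; apply/eqP; rewrite -subr_eq0; apply/eqP.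
    apply: (@quadratic_le0 _ _ ((m ^+ 2 * nrm w ^+ 2 - nrm (K w) ^+ 2) / 2)) => t.
    have := mle (t%:C *: w + x) (VD _ _ _ Vw Vx).
    rewrite -(ler_pXn2r (_ : 0 < 2)%N) ?nnegrE ?nrm_ge0 ?mulr_ge0 ?nrm_ge0 //.
    rewrite linD // linZ // exprMn !(sqr_nrmD Hip) !nrmZr !ripZl Kx x1.
    rewrite !exprMn real_normK ?num_real // (ripC _ w) (ripC _ (K w)); lra.
  move=> Vv; rewrite !ipE key // -linZ // key; last first.
    by rewrite -[_ *: v]addr0; apply: VD.
  by apply: complex_ext; rewrite ?ReM ?ImM /=; ring.
(* A general k is split as (k - p) + p with k - p in V. Since the e i are eigenvectors orthogonal to
   x, both sides of the identity vanish at p. *)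
pose p := \sum_(i < N) ip k (e i) *: e i.
have Vkp : V (k - p).
  move=> i iN; rewrite ipBl ip_suml (bigD1 (Ordinal iN)) //= big1 ?addr0.
    rewrite ipZl; have [->|e1i] := e1 _ iN; first by rewrite !ip0r mulr0 subrr.
    by rewrite (ipxx Hip) e1i expr1n mulr1 subrr.
  move=> j ji; rewrite ipZl eo ?mulr0 //.
have xp : ip x p = 0.
  by rewrite ip_sumr big1 // => i _; rewrite ipZr Vx // mulr0.
have Kxp : ip (K x) (K p) = 0.
  rewrite lin_sum // ip_sumr big1 // => i _.
  by rewrite linZ // ipZr (ipC _ (K x)) eK // (ipC _ (e i)) Vx // conjC0 mulr0 conjC0 mulr0.
by rewrite -[k](subrK p) linD // [ip (K x) _]ipDr [ip x (_ + p)]ipDr onV // xp Kxp !addr0.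
Qed.

Lemma greedy_singular_vectors (K : H -> H) : compact_operator K ->
  exists (e : nat -> H) (M : nat -> R), [/\
    forall i, 0 <= M i,
    forall i j, i != j -> ip (e i) (e j) = 0,
    forall i, e i = 0 /\ M i = 0 \/ nrm (e i) = 1,
    forall i k, ip (K (e i)) (K k) = (M i ^+ 2)%:C * ip (e i) k &
    forall N g, (forall i, (i < N)%N -> ip g (e i) = 0) -> nrm (K g) <= M N * nrm g].
Proof.
move=> cK.
pose good (l : seq (H * R)) (x : H * R) :=
  [/\ 0 <= x.2, forall i, (i < size l)%N -> ip x.1 (nth 0 l i).1 = 0,
    x.2 = 0 \/ nrm x.1 = 1, x.2 = 0 -> x.1 = 0 &
    (forall k, ip (K x.1) (K k) = (x.2 ^+ 2)%:C * ip x.1 k) /\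
    (forall g, (forall i, (i < size l)%N -> ip g (nth 0 l i).1 = 0) -> nrm (K g) <= x.2 * nrm g)].
(* [choice] needs a total relation, while a good successor is only known to exist for the lists
   produced by the construction itself; hence the implication. The state is the whole list because a
   new vector must be orthogonal to all earlier ones. *)
have ex l : exists x, (exists y, good l y) -> good l x.
  have [[y hy]|no] := pselect (exists y, good l y); first by exists y.
  by exists 0 => -[y hy]; case: no; exists y.
have [next nextP] := choice ex.
pose L := fix L n := if n is m.+1 then rcons (L m) (next (L m)) else [::].
have sL n : size (L n) = n by elim: n => //= n IH; rewrite size_rcons IH.
pose x n := next (L n).
have Lnth n i : (i < n)%N -> nth 0 (L n) i = x i.
  elim: n => //= n IH; rewrite ltnS leq_eqVlt nth_rcons sL => /orP[/eqP ->|lt].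
    by rewrite ltnn eqxx.
  by rewrite lt IH.
have G n : good (L n) (x n).
  have [N] := ubnP n; elim: N n => // N IH n; rewrite ltnS => nN.
  apply: nextP.
  have IH' i : (i < n)%N -> good (L i) (x i).
    by move=> ltin; apply: IH; exact: leq_trans ltin nN.
  have o i j : (i < j)%N -> (j < n)%N -> ip (x j).1 (x i).1 = 0.
    move=> ij jn; have [_ + _ _ _] := IH' _ jn.
    by move=> /(_ i); rewrite sL Lnth // => ->.
  have eo i j : (i < n)%N -> (j < n)%N -> i != j -> ip (x i).1 (x j).1 = 0.
    move=> iN jN; rewrite neq_ltn => /orP[ij|ji]; last exact: o.
    by rewrite ipC o // conjC0.
  have e1 i : (i < n)%N -> (x i).1 = 0 \/ nrm (x i).1 = 1.
    move=> iN; have [_ _ h0 h1 _] := IH' _ iN.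
    by case: h0 => [/h1|]; [left|right].
  have eK i k : (i < n)%N -> ip (K (x i).1) (K k) = ((x i).2 ^+ 2)%:C * ip (x i).1 k.
    by move=> iN; have [_ _ _ _ []] := IH' _ iN.
  have [y [h1 h2 h3 h4 [h5 h6]]] := next_singular_vector cK eo e1 eK.
  exists y; split => //.
    by move=> i; rewrite sL => iN; rewrite Lnth // h2.
  split => // g hg; apply: h6 => i iN; have := hg i; rewrite sL Lnth //; exact.
exists (fun i => (x i).1), (fun i => (x i).2); split.
- by move=> i; have [] := G i.
- move=> i j; have o a b : (a < b)%N -> ip (x b).1 (x a).1 = 0.
    by move=> ab; have [_ + _ _ _] := G b; move=> /(_ a); rewrite sL Lnth // => ->.
  rewrite neq_ltn => /orP[ij|ji]; last exact: o.
  by rewrite ipC o // conjC0.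
- move=> i; have [_ _ [z|//] h _] := G i; [left|by right].
  by rewrite z h.
- by move=> i k; have [_ _ _ _ []] := G i.
- move=> N g hg; have [_ _ _ _ [_]] := G N; apply => i; rewrite sL => iN.
  by rewrite Lnth // hg.
Qed.

Lemma size_le_count (T : eqType) (a b : seq T) :
  (forall x, x \in a -> count_mem x a <= count_mem x b)%N -> (size a <= size b)%N.
Proof.
move=> h; have /count_subseqP[c cb ac] : forall x, (count_mem x a <= count_mem x b)%N.
  move=> x; have [/h //|/count_memPn ->] := boolP (x \in a); exact: leq0n.
by rewrite (perm_size ac) size_subseq.
Qed.

(** If s i < M i, then M 0, ..., M i all exceed s i. Each value occurs among them at most as often
    as the dimension of its eigenspace, which is its number of occurrences in s, all at indices
    below i: i + 1 values would fit into i places. The third clause covers unit vectors and 0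
    uniformly. *)
Lemma singular_vectors (K : H -> H) (s : R^nat) : compact_operator K ->
  singular_values ip K s ->
  exists (e : nat -> H) (M : nat -> R), [/\
    forall i, 0 <= M i <= s i,
    forall i j, i != j -> ip (e i) (e j) = 0,
    forall i, nrm (e i) <= 1 /\ forall g, ip g (e i) * ip (e i) (e i) = ip g (e i),
    forall i k, ip (K (e i)) (K k) = (M i ^+ 2)%:C * ip (e i) k &
    forall N g, (forall i, (i < N)%N -> ip g (e i) = 0) -> nrm (K g) <= s N * nrm g].
Proof.
move=> cK [sdec s0 smult].
have [e [M [M0 eo e1 eK Kle]]] := greedy_singular_vectors cK.
have KM i : nrm (K (e i)) = M i * nrm (e i).
  apply/eqP; rewrite -(eqrXn2 (_ : 0 < 2)%N) ?mulr_ge0 ?nrm_ge0 //.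
  rewrite exprMn; apply/eqP/complexI; rewrite -(ipxx Hip) eK (ipxx Hip).
  by rewrite [RHS]rmorphM.
have Mdec i : M i.+1 <= M i.
  have [[_ ->]|e1i] := e1 i.+1; first exact: M0.
  have := Kle i (e i.+1); rewrite KM e1i !mulr1; apply => j ji.
  by apply: eo; rewrite neq_ltn (ltn_trans ji) ?orbT.
have Mmono i j : (i <= j)%N -> M j <= M i.
  elim: j => [|j IH]; first by rewrite leqn0 => /eqP ->.
  rewrite leq_eqVlt => /orP[/eqP ->//|/IH]; exact: le_trans.
have Ms i : M i <= s i.
  rewrite leNgt; apply/negP => lt.
  have Mi : 0 < M i by exact: le_lt_trans lt.
  have : (size [seq M l | l <- iota 0 i.+1] <= size [seq s l | l <- iota 0 i])%N.
    apply: size_le_count => lam /mapP[l]; rewrite mem_iota add0n ltnS => /andP[_ li] lamE.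
    have lamM : M i <= lam by rewrite lamE Mmono.
    have lam0 : 0 < lam by exact: lt_le_trans lamM.
    have [m dimm cardm] := smult _ lam0.
    rewrite !count_map -!size_filter.
    set a := seq.filter _ (iota 0 i.+1); set b := seq.filter _ (iota 0 i).
    have -> : size b = m.
      have ub : uniq b by rewrite filter_uniq // iota_uniq.
      pose B : finmap.finset_of (Phant nat) := finmap.seq_fset tt b.
      have E : [set j | s j = lam] = [set` B].
        apply/seteqP; split => j /=; rewrite finmap.seq_fsetE mem_filter mem_iota add0n /=.
          move=> sj; rewrite sj eqxx ltnNge; apply/negP => ij.
          by have := sdec _ _ ij; rewrite sj leNgt (lt_le_trans lt lamM).
        by move=> /andP[/eqP].
      rewrite E in cardm; move/card_eq_fsetP: cardm => <-.
      by rewrite finmap.size_seq_fset undup_id.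
    have au : uniq a by rewrite filter_uniq // iota_uniq.
    have al t : t \in a -> M t = lam by rewrite mem_filter => /andP[/= /eqP].
    apply: (@orthogonal_le_dim _ _ _ (fun t : 'I_(size a) => e (nth 0%N a t)) dimm).
    - by move=> t k; rewrite eK al // mem_nth.
    - move=> t; have [[_ Mz]|e1t] := e1 (nth 0%N a t).
        by rewrite al ?mem_nth // in Mz; rewrite Mz ltxx in lam0.
      by move=> ez; move: e1t; rewrite ez nrm0 => /eqP; rewrite eq_sym oner_eq0.
    - move=> t t' tt'; apply: eo; rewrite nth_uniq //.
  by rewrite !size_map !size_iota ltnn.
exists e, M; split => //.
- by move=> i; rewrite M0 Ms.
- move=> i; have [[-> _]|e1i] := e1 i.
    by split => [|g]; rewrite ?nrm0 // !ip0r mulr0.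
  by rewrite e1i; split => // g; rewrite (ipxx Hip) e1i expr1n mulr1.
- by move=> N g /Kle /le_trans; apply; rewrite ler_wpM2r ?nrm_ge0.
Qed.

End SingularValues.

(** * Bounded functional calculus *)

Section BoundedMeasurable.
Context {R : realType} {d : measure_display} {T : measurableType d}.
Implicit Types (f g : T -> R).

Definition bounded_meas f := measurable_fun setT f /\ exists c, forall t, `|f t| <= c.

Lemma bounded_meas_cst (c : R) : bounded_meas (fun=> c).
Proof. by split; [exact: measurable_cst|exists `|c|]. Qed.

Lemma bounded_measD f g : bounded_meas f -> bounded_meas g ->
  bounded_meas (fun t => f t + g t).
Proof.
move=> [mf [c fc]] [mg [e hg]]; split; first exact: measurable_funD.
by exists (c + e) => t; rewrite (le_trans (ler_normD _ _)) // lerD.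
Qed.

Lemma bounded_measM f g : bounded_meas f -> bounded_meas g ->
  bounded_meas (fun t => f t * g t).
Proof.
move=> [mf [c fc]] [mg [e hg]]; split; first exact: measurable_funM.
by exists (c * e) => t; rewrite normrM ler_pM.
Qed.

Lemma bounded_measN f : bounded_meas f -> bounded_meas (fun t => - f t).
Proof.
move=> [mf [c fc]]; split; first exact: measurableT_comp.
by exists c => t; rewrite normrN.
Qed.

Lemma bounded_measB f g : bounded_meas f -> bounded_meas g ->
  bounded_meas (fun t => f t - g t).
Proof. by move=> bf bg; apply: bounded_measD => //; exact: bounded_measN. Qed.

Lemma bounded_meas_sum I (r : seq I) (F : I -> T -> R) :
  (forall i, bounded_meas (F i)) -> bounded_meas (fun t => \sum_(i <- r) F i t).
Proof.
move=> bF; elim: r => [|i r IH].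
  by under eq_fun do rewrite big_nil; exact: bounded_meas_cst.
by under eq_fun do rewrite big_cons; exact: bounded_measD.
Qed.

Lemma bounded_meas_indic (A : set T) : measurable A -> bounded_meas (\1_A : T -> R).
Proof.
move=> mA; split; first exact: measurable_indic.
by exists 1 => t; rewrite indicE; case: (_ \in _); rewrite ?normr1 ?normr0.
Qed.

Variable mu : {finite_measure set T -> \bar R}.

Lemma bounded_meas_integrable f : bounded_meas f -> mu.-integrable setT (EFin \o f).
Proof.
move=> [mf [c fc]]; apply: measurable_bounded_integrable => //.
  by rewrite ltey_eq fin_num_measure.
by exists c; split; rewrite ?num_real // => M cM t _; apply: le_trans (fc t) (ltW cM).
Qed.

Lemma meanD f g : bounded_meas f -> bounded_meas g ->
  \int[mu]_x (f x + g x) = \int[mu]_x f x + \int[mu]_x g x.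
Proof. by move=> bf bg; rewrite RintegralD //; exact: bounded_meas_integrable. Qed.

Lemma meanZ (c : R) f : bounded_meas f -> \int[mu]_x (c * f x) = c * \int[mu]_x f x.
Proof. by move=> bf; rewrite RintegralZl //; exact: bounded_meas_integrable. Qed.

Lemma mean_sum I (r : seq I) (F : I -> T -> R) : (forall i, bounded_meas (F i)) ->
  \int[mu]_x (\sum_(i <- r) F i x) = \sum_(i <- r) \int[mu]_x F i x.
Proof.
move=> bF; elim: r => [|i r IH].
  rewrite big_nil; under eq_Rintegral do rewrite big_nil.
  by rewrite Rintegral_cst // mul0r.
rewrite big_cons -IH; under eq_Rintegral do rewrite big_cons.
by rewrite meanD //; exact: bounded_meas_sum.
Qed.

Lemma mean_indic (A : set T) : measurable A -> \int[mu]_x (\1_A x) = fine (mu A).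
Proof. by move=> mA; rewrite /Rintegral integral_indic // setIT. Qed.

Lemma le_mean f g : bounded_meas f -> bounded_meas g -> (forall t, f t <= g t) ->
  \int[mu]_x f x <= \int[mu]_x g x.
Proof. by move=> bf bg fg; apply: le_Rintegral => //; exact: bounded_meas_integrable. Qed.

End BoundedMeasurable.

Section IntegralOfFunction.
Context {d} {T : measurableType d} {R : realType} (D : set T).
Import HBNNSimple.

(* Unlike eq_measure_integral, m1 and m2 are mere set functions. *)
Lemma eq_on_measurable_integral (m2 m1 : set T -> \bar R) (f : T -> \bar R) :
  (forall A, measurable A -> m1 A = m2 A) ->
  (\int[m1]_(x in D) f x)%E = (\int[m2]_(x in D) f x)%E.
Proof.
move=> m12; have E (h : {nnsfun T >-> R}) : sintegral m1 h = sintegral m2 h.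
  by apply: eq_fsbigr => r _; rewrite m12.
rewrite /integral.
by congr (ereal_sup _ - ereal_sup _)%E; apply/seteqP; split => _ [h hf <-];
  exists h.
Qed.

End IntegralOfFunction.

(** * Projection-valued measures *)

Section ProjectionValuedMeasure.
Context {R : realType} {H : completeNormedModType R[i]} {ip : {dot H for Num.conj}}.
Context {d : measure_display} {T : measurableType d}.
Hypothesis Hip : inner_product_of_norm ip.
Implicit Types (P Q : H -> H) (A B : set T) (h k : H).

Lemma orth_projection_sqr P h : orth_projection ip P -> nrm (P h) ^+ 2 = rip ip (P h) h.
Proof. by move=> [_ PP Ps]; rewrite -(ripxx Hip) /rip -Ps PP. Qed.

Lemma orth_projection_le P h : orth_projection ip P -> nrm (P h) <= nrm h.
Proof.
move=> oP; have [->|P0] := eqVneq (nrm (P h)) 0; first exact: nrm_ge0.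
have Pp : 0 < nrm (P h) by rewrite lt_neqAle eq_sym P0 nrm_ge0.
by rewrite -(ler_pM2l Pp) -expr2 orth_projection_sqr // rip_le.
Qed.

Variable E : set T -> H -> H.
Hypothesis HE : projection_valued_measure ip E.

Let Eproj A : measurable A -> orth_projection ip (E A).
Proof. by have [h _ _] := HE; exact: h. Qed.

Lemma pvm_lin A : measurable A -> linear (E A).
Proof. by move=> /Eproj[]. Qed.

Lemma pvm_idem A h : measurable A -> E A (E A h) = E A h.
Proof. by move=> /Eproj[]. Qed.

Lemma pvm_sym A h k : measurable A -> ip (E A h) k = ip h (E A k).
Proof. by move=> /Eproj[]. Qed.

Lemma pvm_setT h : E setT h = h.
Proof. by have [_ h0 _] := HE; exact: h0. Qed.

Lemma pvm_le A h : measurable A -> nrm (E A h) <= nrm h.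
Proof. by move=> /Eproj; exact: orth_projection_le. Qed.

(** Countable additivity applied to the constant sequence [set0]: a series with constant term
    converges only if the term is 0. *)
Lemma pvm_set0 h : E set0 h = 0.
Proof.
have [_ _ /(_ (fun=> set0))] := HE => /(_ (fun=> measurable0)) hE.
have {}hE := hE (@trivIset_set0 _ _ _) h.
set l := E (\bigcup__ set0) h in hE.
apply: nrm_eq0; apply/le_anti; rewrite nrm_ge0 andbT.
apply/ler_addgt0Pr => e e0; rewrite add0r.
move/cvg_nrmP : hE => /(_ _ (divr_gt0 e0 (ltr0Sn R 1)))[N _ hN].
have h1 := hN N (leqnn N); have h2 := hN N.+1 (leqnSn N).
have : nrm (E set0 h) <= e / 2 + e / 2.
  have -> : E set0 h = (series (fun=> E set0 h) N.+1 - l) - (series (fun=> E set0 h) N - l).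
    by rewrite opprB addrA subrK /series /= big_nat_recr //= addrAC subrr add0r.
  by rewrite (le_trans (nrmD _ _)) // nrmN lerD // ltW.
by rewrite -splitr.
Qed.

Lemma pvm_setU A B h : measurable A -> measurable B -> A `&` B = set0 ->
  E (A `|` B) h = E A h + E B h.
Proof.
move=> mA mB AB0; have [_ _ /(_ (bigcup2 A B))] := HE.
have mF i : measurable (bigcup2 A B i) by case: i => [|[|i]] /=.
move=> /(_ mF); rewrite -trivIset_bigcup2 => /(_ AB0 h); rewrite bigcup2E => cv.
have cst : series (fun i => E (bigcup2 A B i) h) @ \oo --> E A h + E B h.
  apply/cvg_nrmP => e e0; exists 2%N => // n /= n2.
  suff -> : series (fun i => E (bigcup2 A B i) h) n = E A h + E B h.
    by rewrite subrr nrm0.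
  rewrite /series /= -(subnKC n2) big_nat_recl // big_nat_recl //=.
  by rewrite big1 ?addr0 // => i _; exact: pvm_set0.
exact: (cvg_unique _ cv cst).
Qed.

(** Multiplicativity is not part of the definition. For x = E B h, additivity makes the squared norm
    of the projection of x for the union equal to nrm (E A x) ^+ 2 + nrm x ^+ 2, and a contraction
    leaves no room for the first term. *)
Lemma pvm_orth A B h : measurable A -> measurable B -> A `&` B = set0 ->
  E A (E B h) = 0.
Proof.
move=> mA mB AB0; set x := E B h.
have mAB : measurable (A `|` B) by exact: measurableU.
have h1 : nrm (E (A `|` B) x) ^+ 2 = nrm (E A x) ^+ 2 + nrm x ^+ 2.
  rewrite (orth_projection_sqr _ (Eproj mAB)) pvm_setU // ripDl.
  rewrite -(orth_projection_sqr _ (Eproj mA)); congr (_ + _).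
  by rewrite -(orth_projection_sqr _ (Eproj mB)) /x pvm_idem.
have h2 : nrm (E (A `|` B) x) ^+ 2 <= nrm x ^+ 2.
  by rewrite ler_pXn2r ?nnegrE ?nrm_ge0 // pvm_le.
apply: nrm_eq0; apply/eqP; rewrite -sqrf_eq0; apply/eqP/le_anti.
rewrite sqr_ge0 andbT; move: h2; rewrite h1; lra.
Qed.

Lemma pvm_setI A B h : measurable A -> measurable B -> E A (E B h) = E (A `&` B) h.
Proof.
move=> mA mB.
have mI : measurable (A `&` B) by exact: measurableI.
have mBA : measurable (B `\` A) by exact: measurableD.
have mAB : measurable (A `\` B) by exact: measurableD.
have -> : E B h = E (A `&` B) h + E (B `\` A) h.
  rewrite -pvm_setU //; last by apply/seteqP; split => t //= -[[]] ? ? [].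
  by congr (E _ h); apply/seteqP; split => t /=; have [] := pselect (A t); tauto.
rewrite linD; last exact: pvm_lin.
rewrite (pvm_orth h mA mBA) ?addr0; last by apply/seteqP; split => t //= -[] ? [].
have E1 k : E A k = E (A `&` B) k + E (A `\` B) k.
  rewrite -pvm_setU //; last by apply/seteqP; split => t //= -[[]] ? ? [].
  by congr (E _ k); apply/seteqP; split => t /=; have [] := pselect (B t); tauto.
rewrite E1 pvm_idem // (pvm_orth h mAB mI) ?addr0 //.
by apply/seteqP; split => t //= -[[]] ? ? [].
Qed.

Lemma pvm_ip A B h : measurable A -> measurable B ->
  ip (E A h) (E B h) = (nrm (E (A `&` B) h) ^+ 2)%:C.
Proof.
move=> mA mB; have mI := measurableI _ _ mA mB.
rewrite -pvm_sym // pvm_setI // setIC -(ipxx Hip).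
by rewrite -(pvm_sym _ _ mI) pvm_idem.
Qed.

End ProjectionValuedMeasure.

Section SpectralMeasure.
Context {R : realType} {H : completeNormedModType R[i]} {ip : {dot H for Num.conj}}.
Context {d : measure_display} {T : measurableType d} {E : set T -> H -> H}.

(* Agrees with spectral_dist on measurable sets and is nonnegative on the others;
   the proofs are parameters so that it is canonically a measure. *)
Definition spectral_measure (Hip : inner_product_of_norm ip)
  (HE : projection_valued_measure ip E) (h : H) (A : set T) : \bar R :=
  (nrm (E A h) ^+ 2)%:E.

Variables (Hip : inner_product_of_norm ip) (HE : projection_valued_measure ip E).
Local Notation mu := (spectral_measure Hip HE).

Let mu0 h : mu h set0 = 0%E.
Proof. by rewrite /spectral_measure (pvm_set0 HE) nrm0 expr0n. Qed.

Let mu_ge0 h A : (0 <= mu h A)%E.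
Proof. by rewrite lee_fin sqr_ge0. Qed.

Lemma spectral_distE h A : measurable A -> spectral_dist ip E h A = mu h A.
Proof.
move=> mA; congr (_%:E); have [Ep _ _] := HE.
by rewrite (orth_projection_sqr Hip h (Ep _ mA)).
Qed.

Let mu_sigma h : semi_sigma_additive (mu h).
Proof.
move=> F mF tF mUF; have [_ _ /(_ F mF tF h) cv] := HE.
rewrite -spectral_distE //.
have -> : (fun n => \sum_(0 <= i < n) mu h (F i))%E =
    EFin \o (fun n => rip ip (series (fun i => E (F i) h) n) h).
  apply/funext => n; rewrite /= /series /= rip_suml -sumEFin.
  by apply: eq_bigr => i _; rewrite -spectral_distE.
apply: cvg_EFin; first exact: nearW.
exact: cvg_rip.
Qed.

HB.instance Definition _ h := isMeasure.Build _ _ _ (mu h) (mu0 h) (mu_ge0 h)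
  (@mu_sigma h).

Let mu_fin h : fin_num_fun (mu h).
Proof. by []. Qed.

HB.instance Definition _ h := Measure_isFinite.Build _ _ _ (mu h) (@mu_fin h).

Lemma spectral_integral h (D : set T) f :
  (\int[spectral_dist ip E h]_(x in D) f x = \int[mu h]_(x in D) f x)%E.
Proof. by apply: eq_on_measurable_integral => A; exact: spectral_distE. Qed.

End SpectralMeasure.

(** * Uniform approximation by simple functions *)

Section Calculus.
Context {R : realType} {H : completeNormedModType R[i]} {ip : {dot H for Num.conj}}.
Context {d : measure_display} {T : measurableType d} {E : set T -> H -> H}.
Variables (Hip : inner_product_of_norm ip) (HE : projection_valued_measure ip E).
Local Notation mu := (spectral_measure Hip HE).

(** The sets A i may overlap. Sums and products of simple functions are then indexed by [I + J] and
    [I * J], with no refinement of partitions. *)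
Definition simple_fun (I : finType) (c : I -> R[i]) (A : I -> set T) (t : T) : R[i] :=
  \sum_i c i * (\1_(A i) t)%:C.

Definition simple_op (I : finType) (c : I -> R[i]) (A : I -> set T) (h : H) : H :=
  \sum_i c i *: E (A i) h.

Definition bounded_measC (f : T -> R[i]) :=
  bounded_meas (fun t => complex.Re (f t)) /\ bounded_meas (fun t => complex.Im (f t)).

Lemma sqr_nrm_simple_op (I : finType) c (A : I -> set T) h : (forall i, measurable (A i)) ->
  nrm (simple_op c A h) ^+ 2 = \int[mu h]_t (normc (simple_fun c A t) ^+ 2).
Proof.
move=> mA.
have bI i j : bounded_meas (\1_(A i `&` A j) : T -> R).
  by apply: bounded_meas_indic; exact: measurableI.
have -> : (fun t => normc (simple_fun c A t) ^+ 2) = (fun t =>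
    \sum_i \sum_j complex.Re (c i * Num.conj (c j)) * \1_(A i `&` A j) t).
  apply/funext => t.
  have -> : normc (simple_fun c A t) ^+ 2 =
      complex.Re (simple_fun c A t * Num.conj (simple_fun c A t)).
    by rewrite sqr_normcE ReM Re_conj Im_conj; ring.
  rewrite /simple_fun rmorph_sum mulr_suml Re_sum; apply: eq_bigr => i _.
  rewrite mulr_sumr Re_sum; apply: eq_bigr => j _.
  rewrite rmorphM /= indicI /= (_ : Num.conj (\1_(A j) t)%:C = (\1_(A j) t)%:C); last first.
    by apply: complex_ext; rewrite ?Re_conj ?Im_conj /= ?oppr0.
  by rewrite mulrACA -rmorphM ReM /= mulr0 subr0.
rewrite mean_sum; last first.
  move=> i; apply: bounded_meas_sum => j.
  by apply: bounded_measM => //; exact: bounded_meas_cst.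
rewrite -(ripxx Hip) /simple_op rip_suml; apply: eq_bigr => i _.
rewrite mean_sum; last first.
  by move=> j; apply: bounded_measM => //; exact: bounded_meas_cst.
rewrite rip_sumr; apply: eq_bigr => j _.
rewrite meanZ // mean_indic; last exact: measurableI.
by rewrite /rip ipZl ipZr mulrA (pvm_ip Hip HE) // ReM /= mulr0 subr0.
Qed.

Lemma simple_op_le (I : finType) c (A : I -> set T) (e : R) h : (forall i, measurable (A i)) ->
  0 <= e -> (forall t, normc (simple_fun c A t) <= e) -> nrm (simple_op c A h) <= e * nrm h.
Proof.
move=> mA e0 fe; rewrite -(ler_pXn2r (_ : 0 < 2)%N) ?nnegrE ?nrm_ge0 ?mulr_ge0 ?nrm_ge0 //.
rewrite sqr_nrm_simple_op //.
have -> : (e * nrm h) ^+ 2 = \int[mu h]_t (e ^+ 2).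
  by rewrite Rintegral_cst //= exprMn (pvm_setT HE).
apply: le_mean; [|exact: bounded_meas_cst|]; last first.
  by move=> t; rewrite ler_pXn2r ?nnegrE ?normc_ge0.
have bi i : bounded_meas (\1_(A i) : T -> R) by exact: bounded_meas_indic.
have -> : (fun t => normc (simple_fun c A t) ^+ 2) = (fun t =>
  (\sum_i complex.Re (c i) * \1_(A i) t) * (\sum_i complex.Re (c i) * \1_(A i) t) +
  (\sum_i complex.Im (c i) * \1_(A i) t) * (\sum_i complex.Im (c i) * \1_(A i) t)).
  apply/funext => t; rewrite sqr_normcE -!expr2 /simple_fun Re_sum Im_sum.
  by congr (_ ^+ 2 + _ ^+ 2); apply: eq_bigr => i _; rewrite ?ReM ?ImM /=; ring.
by apply: bounded_measD; apply: bounded_measM; apply: bounded_meas_sum => i;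
  apply: bounded_measM => //; exact: bounded_meas_cst.
Qed.

Lemma simple_opB (I J : finType) c (A : I -> set T) c' (B : J -> set T) h :
  simple_op c A h - simple_op c' B h =
  simple_op (fun i => match i with inl i => c i | inr j => - c' j end)
    (fun i => match i with inl i => A i | inr j => B j end) h.
Proof.
rewrite /simple_op big_sumType /= -sumrN; congr (_ + _).
by apply: eq_bigr => i _; rewrite scaleNr.
Qed.

Lemma simple_funB (I J : finType) c (A : I -> set T) c' (B : J -> set T) t :
  simple_fun c A t - simple_fun c' B t =
  simple_fun (fun i => match i with inl i => c i | inr j => - c' j end)
    (fun i => match i with inl i => A i | inr j => B j end) t.
Proof.
rewrite /simple_fun big_sumType /= -sumrN; congr (_ + _).
by apply: eq_bigr => i _; rewrite mulNr.
Qed.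

Lemma simple_op_close (I J : finType) c (A : I -> set T) c' (B : J -> set T) (e : R) h :
  (forall i, measurable (A i)) -> (forall i, measurable (B i)) -> 0 <= e ->
  (forall t, normc (simple_fun c A t - simple_fun c' B t) <= e) ->
  nrm (simple_op c A h - simple_op c' B h) <= e * nrm h.
Proof.
move=> mA mB e0 he; rewrite simple_opB; apply: simple_op_le => // [[]//|t].
by rewrite -simple_funB.
Qed.

(* U is the integral of f against E: f and U are approximated uniformly by the
   same simple functions. *)
Definition is_calculus (f : T -> R[i]) (U : H -> H) := forall e : R, 0 < e ->
  exists (I : finType) (c : I -> R[i]) (A : I -> set T),
    [/\ forall i, measurable (A i), forall t, normc (f t - simple_fun c A t) <= e &
        forall h, nrm (U h - simple_op c A h) <= e * nrm h].

Lemma normc_triangle (x y : R[i]) : normc (x + y) <= normc x + normc y.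
Proof. exact: le_normcD. Qed.

Lemma normcB_trans (z x y : R[i]) : normc (x - y) <= normc (x - z) + normc (z - y).
Proof. by rewrite -[x - y](subrKA z) normc_triangle. Qed.

Lemma normcBC (x y : R[i]) : normc (x - y) = normc (y - x).
Proof. by rewrite -opprB normcN. Qed.

Lemma calculus_close f g U V (e : R) h : is_calculus f U -> is_calculus g V -> 0 <= e ->
  (forall t, normc (f t - g t) <= e) -> nrm (U h - V h) <= e * nrm h.
Proof.
move=> fU gV e0 fg; apply/ler_addgt0Pr => r r0.
(* Four approximation errors r' are made, two for U and two for V; the + 1 allows h = 0. *)
have N0 : 0 < 4 * (nrm h + 1) by rewrite mulr_gt0 // ltr_wpDl ?nrm_ge0.
pose r' := r / (4 * (nrm h + 1)).
have r'0 : 0 < r' by rewrite divr_gt0.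
have [I [c [A [mA fA UA]]]] := fU _ r'0.
have [J [c' [B [mB gB VB]]]] := gV _ r'0.
have h1 : nrm (simple_op c A h - simple_op c' B h) <= (r' + (e + r')) * nrm h.
  apply: simple_op_close => //; first by rewrite !addr_ge0 // ltW.
  move=> t; apply: (le_trans (normcB_trans (f t) _ _)); rewrite lerD //.
    by rewrite normcBC.
  by apply: (le_trans (normcB_trans (g t) _ _)); rewrite lerD.
have h2 : nrm (U h - V h) <= (4 * r' + e) * nrm h.
  apply: (le_trans (nrm_sub_trans (simple_op c A h) _ _)).
  apply: (@le_trans _ _ (r' * nrm h + ((r' + (e + r')) * nrm h + r' * nrm h))).
    rewrite lerD //; apply: (le_trans (nrm_sub_trans (simple_op c' B h) _ _)).
    by rewrite lerD // nrmBC.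
  by rewrite le_eqVlt; apply/orP; left; apply/eqP; ring.
apply: (le_trans h2); rewrite mulrDl addrC lerD2l.
rewrite /r' -(mulrA 4) (mulrC _ (nrm h)) !mulrA ler_pdivrMr //.
rewrite (mulrC 4) -mulrA (mulrC _ r) mulrA (mulrC _ r) -!mulrA ler_pM2l //.
by rewrite mulrC ler_pM2l // lerDl.
Qed.

Lemma calculus_unique f U V : is_calculus f U -> is_calculus f V -> forall h, U h = V h.
Proof.
move=> fU fV h; apply/eqP; rewrite -subr_eq0; apply/eqP/nrm_eq0/le_anti.
rewrite nrm_ge0 andbT -[leRHS](mul0r (nrm h)); apply: calculus_close fU fV _ _ => //.
by move=> t; rewrite subrr ComplexField.Normc.normc0.
Qed.

Lemma simple_calculus (I : finType) c (A : I -> set T) : (forall i, measurable (A i)) ->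
  is_calculus (simple_fun c A) (simple_op c A).
Proof.
move=> mA e e0; exists I, c, A; split => // [t|h].
  by rewrite subrr ComplexField.Normc.normc0 ltW.
by rewrite subrr nrm0 mulr_ge0 ?nrm_ge0 // ltW.
Qed.

Lemma calculus_le f U (e : R) h : is_calculus f U -> 0 <= e ->
  (forall t, normc (f t) <= e) -> nrm (U h) <= e * nrm h.
Proof.
move=> fU e0 fe.
have z : is_calculus (fun=> 0) (fun=> 0).
  move=> r r0; exists 'I_0, (fun=> 0), (fun=> setT); split => // [t|k].
    by rewrite /simple_fun big_ord0 subrr ComplexField.Normc.normc0 ltW.
  by rewrite /simple_op big_ord0 subrr nrm0 mulr_ge0 ?nrm_ge0 // ltW.
rewrite -[U h]subr0; apply: (calculus_close h fU z) => // t.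
by rewrite subr0.
Qed.

Lemma calculus_indic (A : set T) : measurable A ->
  is_calculus (fun t => (\1_A t)%:C) (E A).
Proof.
move=> mA e e0; exists 'I_1, (fun=> 1), (fun=> A); split => // [t|h].
  by rewrite /simple_fun big_ord1 mul1r subrr ComplexField.Normc.normc0 ltW.
by rewrite /simple_op big_ord1 scale1r subrr nrm0 mulr_ge0 ?nrm_ge0 // ltW.
Qed.

Lemma calculusD f g U V : is_calculus f U -> is_calculus g V ->
  is_calculus (fun t => f t + g t) (fun h => U h + V h).
Proof.
move=> fU gV e e0; have e20 : 0 < e / 2 by rewrite divr_gt0.
have [I [c [A [mA fA UA]]]] := fU _ e20.
have [J [c' [B [mB gB VB]]]] := gV _ e20.
exists (I + J)%type, (fun i => match i with inl i => c i | inr j => c' j end),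
  (fun i => match i with inl i => A i | inr j => B j end).
split => [[]//|t|h].
  rewrite /simple_fun big_sumType /= opprD addrACA (le_trans (normc_triangle _ _)) //.
  by rewrite [leRHS]splitr lerD.
rewrite /simple_op big_sumType /= opprD addrACA (le_trans (nrmD _ _)) //.
by rewrite {1}(splitr e) mulrDl lerD.
Qed.

Lemma calculusZ a f U : is_calculus f U ->
  is_calculus (fun t => a * f t) (fun h => a *: U h).
Proof.
move=> fU e e0; have a0 : 0 < normc a + 1 by rewrite ltr_wpDl ?normc_ge0.
have [I [c [A [mA fA UA]]]] := fU _ (divr_gt0 e0 a0).
have le x : x <= e / (normc a + 1) -> normc a * x <= e.
  move=> h; apply: (@le_trans _ _ (normc a * (e / (normc a + 1)))).
    by rewrite ler_wpM2l ?normc_ge0.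
  by rewrite mulrCA ler_piMr ?(ltW e0) // ler_pdivrMr // mul1r lerDl.
exists I, (fun i => a * c i), A; split => // [t|h].
  rewrite (_ : simple_fun _ _ _ = a * simple_fun c A t); last first.
    by rewrite /simple_fun mulr_sumr; apply: eq_bigr => i _; rewrite mulrA.
  by rewrite -mulrBr ComplexField.Normc.normcM le.
rewrite (_ : simple_op _ _ _ = a *: simple_op c A h); last first.
  by rewrite /simple_op scaler_sumr; apply: eq_bigr => i _; rewrite scalerA.
rewrite -scalerBr nrmZ (le_trans (ler_wpM2l (normc_ge0 _) (UA h))) // mulrA.
by rewrite ler_wpM2r ?nrm_ge0 // le.
Qed.

Lemma le0_small (x C : R) : (forall e, 0 < e -> x <= e * C) -> x <= 0.
Proof.
move=> h; apply/ler_addgt0Pr => e e0; rewrite add0r.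
have C0 : 0 < `|C| + 1 by rewrite ltr_wpDl.
apply: (le_trans (h _ (divr_gt0 e0 C0))); rewrite mulrAC ler_pdivrMr // ler_pM2l //.
by rewrite (le_trans (ler_norm _)) // lerDl.
Qed.

Lemma simple_op_lin (I : finType) c (A : I -> set T) : (forall i, measurable (A i)) ->
  linear (simple_op c A).
Proof.
move=> mA a h k; rewrite /simple_op scaler_sumr -big_split /=.
by apply: eq_bigr => i _; rewrite (pvm_lin HE) // scalerDr !scalerA mulrC.
Qed.

Lemma calculus_lin f U : is_calculus f U -> linear U.
Proof.
move=> fU a h k; apply/eqP; rewrite -subr_eq0; apply/eqP/nrm_eq0/le_anti.
rewrite nrm_ge0 andbT.
apply: (@le0_small _ (nrm (a *: h + k) + (normc a * nrm h + nrm k))) => e e0.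
have [I [c [A [mA _ UA]]]] := fU _ e0.
have -> : U (a *: h + k) - (a *: U h + U k) = (U (a *: h + k) - simple_op c A (a *: h + k)) -
    (a *: (U h - simple_op c A h) + (U k - simple_op c A k)).
  rewrite simple_op_lin // scalerBr addrACA -opprD [in RHS]opprB.
  by rewrite addrA subrK.
rewrite (le_trans (nrmD _ _)) // nrmN mulrDr lerD //.
rewrite (le_trans (nrmD _ _)) // mulrDr lerD // nrmZ mulrCA.
by rewrite ler_wpM2l ?normc_ge0.
Qed.

Lemma simple_op_comp (I J : finType) c (A : I -> set T) c' (B : J -> set T) h :
  (forall i, measurable (A i)) -> (forall i, measurable (B i)) ->
  simple_op c A (simple_op c' B h) =
  simple_op (fun p => c p.1 * c' p.2) (fun p => A p.1 `&` B p.2) h.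
Proof.
move=> mA mB; rewrite /simple_op.
rewrite -(pair_bigA _ (fun i j => (c i * c' j) *: E (A i `&` B j) h)) /=.
apply: eq_bigr => i _; rewrite lin_sum; last exact: (pvm_lin HE).
rewrite scaler_sumr; apply: eq_bigr => j _.
by rewrite linZ ?(pvm_setI Hip HE) ?scalerA //; exact: (pvm_lin HE).
Qed.

Lemma simple_funM (I J : finType) c (A : I -> set T) c' (B : J -> set T) t :
  simple_fun c A t * simple_fun c' B t =
  simple_fun (fun p => c p.1 * c' p.2) (fun p => A p.1 `&` B p.2) t.
Proof.
rewrite /simple_fun.
rewrite -(pair_bigA _ (fun i j => (c i * c' j) * (\1_(A i `&` B j) t)%:C)) /=.
rewrite mulr_suml; apply: eq_bigr => i _; rewrite mulr_sumr; apply: eq_bigr => j _.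
by rewrite indicI /= mulrACA -rmorphM.
Qed.

Lemma calculusM f g U V (F G : R) : is_calculus f U -> is_calculus g V ->
  (forall t, normc (f t) <= F) -> (forall t, normc (g t) <= G) ->
  is_calculus (fun t => f t * g t) (fun h => U (V h)).
Proof.
move=> fU gV fF gG e e0.
wlog [F0 G0] : F G fF gG / 0 <= F /\ 0 <= G.
  by apply; [move=> t; apply: le_trans (ler_norm F); exact: fF|
             move=> t; apply: le_trans (ler_norm G); exact: gG|].
have FG : 0 < F + G + 1 by rewrite ltr_wpDl // addr_ge0.
(* With r <= 1 the quadratic error r ^+ 2 is at most r, so both errors below are at most r * (F + G
   + 1). *)
pose r := Num.min 1 (e / (F + G + 1)).
have r0 : 0 < r by rewrite lt_min ltr01 divr_gt0.
have r1 : r <= 1 by rewrite ge_min lexx.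
have re : r * (F + G + 1) <= e by rewrite -ler_pdivlMr // ge_min lexx orbT.
have [I [c [A [mA fA UA]]]] := fU _ r0.
have [J [c' [B [mB gB VB]]]] := gV _ r0.
exists (I * J)%type, (fun p => c p.1 * c' p.2), (fun p => A p.1 `&` B p.2).
split => [p|t|h]; first exact: measurableI.
  rewrite -simple_funM.
  have -> : f t * g t - simple_fun c A t * simple_fun c' B t =
    f t * (g t - simple_fun c' B t) + (f t - simple_fun c A t) * simple_fun c' B t by ring.
  have sG : normc (simple_fun c' B t) <= G + r.
    rewrite -[simple_fun _ _ _](subrK (g t)) addrC (le_trans (normc_triangle _ _)) // lerD //.
    by rewrite normcBC.
  rewrite (le_trans (normc_triangle _ _)) // !ComplexField.Normc.normcM.
  apply: (@le_trans _ _ (F * r + r * (G + r))).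
    by rewrite lerD // ler_pM ?normc_ge0.
  apply: le_trans re; rewrite (mulrC F) -mulrDr ler_wpM2l ?(ltW r0) //.
  by rewrite addrA lerD2l.
rewrite -simple_op_comp //.
have -> : U (V h) - simple_op c A (simple_op c' B h) =
    (U (V h) - simple_op c A (V h)) + simple_op c A (V h - simple_op c' B h).
  by rewrite (linB _ _ (simple_op_lin c mA)) addrA subrK.
rewrite (le_trans (nrmD _ _)) //.
have VG : nrm (V h) <= G * nrm h by exact: calculus_le gV _ _.
have sF x : nrm (simple_op c A x) <= (F + r) * nrm x.
  apply: simple_op_le => //; first by rewrite addr_ge0 // ltW.
  move=> t; rewrite -[simple_fun _ _ _](subrK (f t)) addrC.
  by rewrite (le_trans (normc_triangle _ _)) // lerD // normcBC.
apply: (@le_trans _ _ (r * (G * nrm h) + (F + r) * (r * nrm h))).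
  rewrite lerD //; first by rewrite (le_trans (UA _)) // ler_wpM2l // ltW.
  by rewrite (le_trans (sF _)) // ler_wpM2l // addr_ge0 // ltW.
have -> : r * (G * nrm h) + (F + r) * (r * nrm h) = r * (G + F + r) * nrm h by ring.
rewrite ler_wpM2r ?nrm_ge0 //; apply: le_trans re.
by rewrite ler_wpM2l ?(ltW r0) // (addrC G) lerD2l.
Qed.

Lemma calculus_adj f U V : is_calculus f U -> is_calculus (fun t => Num.conj (f t)) V ->
  forall h k, ip (U h) k = ip h (V k).
Proof.
move=> fU fV; have lV := calculus_lin fV.
have key h k : rip ip (U h) k = rip ip h (V k).
  apply/eqP; rewrite -subr_eq0 -normr_eq0; apply/eqP/le_anti; rewrite normr_ge0 andbT.
  apply: (@le0_small _ (3 * (nrm h * nrm k))) => e e0.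
  have [I [c [A [mA fA UA]]]] := fU _ e0.
  have adjS x y : rip ip (simple_op c A x) y = rip ip x (simple_op (fun i => Num.conj (c i)) A y).
    rewrite /rip ip_suml ip_sumr; congr complex.Re; apply: eq_bigr => i _.
    by rewrite ipZl ipZr conjCK (pvm_sym HE).
  have VA x : nrm (V x - simple_op (fun i => Num.conj (c i)) A x) <= e * nrm x.
    apply: (calculus_close x fV (simple_calculus _ mA)) => [|t]; first exact: ltW.
    have -> : simple_fun (fun i => Num.conj (c i)) A t = Num.conj (simple_fun c A t).
      rewrite /simple_fun rmorph_sum; apply: eq_bigr => i _; rewrite rmorphM /=.
      by congr (_ * _); apply: complex_ext; rewrite ?Re_conj ?Im_conj /= ?oppr0.
    by rewrite -rmorphB normc_conj.
  have -> : rip ip (U h) k - rip ip h (V k) = rip ip (U h - simple_op c A h) k -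
      rip ip h (V k - simple_op (fun i => Num.conj (c i)) A k).
    by rewrite ripBl ripBr adjS; ring.
  rewrite (le_trans (ler_normB _ _)) //.
  apply: (@le_trans _ _ (e * nrm h * nrm k + nrm h * (e * nrm k))).
    rewrite lerD // (le_trans (normr_rip_le Hip _ _)) //.
      by rewrite ler_wpM2r ?nrm_ge0.
    by rewrite ler_wpM2l ?nrm_ge0.
  have := mulr_ge0 (ltW e0) (mulr_ge0 (nrm_ge0 h) (nrm_ge0 k)); lra.
by move=> h k; rewrite ipE [RHS]ipE !key linZ.
Qed.

(** The A i are the level sets of f over intervals of length e covering its range; each coefficient
    is the left end of its interval. *)
Lemma bounded_meas_approx (f : T -> R) (e : R) : bounded_meas f -> 0 < e ->
  exists (I : finType) (c : I -> R) (A : I -> set T), (forall i, measurable (A i)) /\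
    forall t, `|f t - \sum_i c i * \1_(A i) t| <= e.
Proof.
move=> [mf [c fc]] e0.
pose N := (Num.bound ((2 * `|c|) / e)).
pose A (i : 'I_N) := f @^-1` `[(i : nat)%:R * e - `|c|, i.+1%:R * e - `|c|[.
have mA i : measurable (A i) by rewrite -[A i]setTI; exact: mf.
exists ('I_N : finType), (fun i : 'I_N => (i : nat)%:R * e - `|c|), A; split => // t.
have x0 : 0 <= (f t + `|c|) / e.
  rewrite divr_ge0 ?(ltW e0) // -lerBlDr sub0r lerNl (le_trans _ (ler_norm c)) //.
  by rewrite (le_trans _ (fc t)) // -normrN ler_norm.
have [i /andP[i1 i2]] : exists i : nat, i%:R <= (f t + `|c|) / e < i.+1%:R.
  by exists (Num.trunc ((f t + `|c|) / e)); exact: truncn_itv.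
have iN : (i < N)%N.
  rewrite -(ltr_nat R); apply: (le_lt_trans i1).
  apply: le_lt_trans (archi_boundP _); last by rewrite divr_ge0 ?(ltW e0) // mulr_ge0.
  rewrite ler_pM2r ?invr_gt0 // mulr_natl mulr2n lerD2r.
  by rewrite (le_trans (ler_norm _)) // (le_trans (fc t)) // ler_norm.
have inA' (j : 'I_N) : (t \in A j) = ((j : nat)%:R <= (f t + `|c|) / e < j.+1%:R).
  by apply/idP/idP; rewrite inE /A /= in_itv /= lerBlDr ltrBrDr -ler_pdivlMr // -ltr_pdivrMr.
have inA (j : 'I_N) : (t \in A j) = (j == Ordinal iN).
  rewrite inA'; apply/idP/eqP => [/andP[j1 j2]|->]; last by rewrite /= i1 i2.
  have ji : (j < i.+1)%N by rewrite -(ltr_nat R) (le_lt_trans j1 i2).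
  have ij : (i < j.+1)%N by rewrite -(ltr_nat R) (le_lt_trans i1 j2).
  by apply/val_inj/eqP; rewrite eqn_leq /= -ltnS ji -ltnS.
rewrite (bigD1 (Ordinal iN)) //= big1 ?addr0; last first.
  by move=> j ji; rewrite indicE inA (negbTE ji) mulr0.
rewrite indicE inA eqxx mulr1.
move: i1 i2; rewrite ler_pdivlMr // ltr_pdivrMr // -natr1 mulrDl mul1r => i1 i2.
by rewrite ger0_norm; lra.
Qed.

Lemma calculus_exists f : bounded_measC f -> exists U, is_calculus f U.
Proof.
move=> [bR bI].
have appr (e : R) : 0 < e -> exists (S : H -> H) (I : finType) (c : I -> R[i]) (A : I -> set T),
    [/\ forall i, measurable (A i), forall t, normc (f t - simple_fun c A t) <= e &
        S = simple_op c A].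
  move=> e0; have e20 : 0 < e / 2 by rewrite divr_gt0.
  have [I [c [A [mA hA]]]] := bounded_meas_approx bR e20.
  have [J [c' [B [mB hB]]]] := bounded_meas_approx bI e20.
  pose C (i : I + J) := match i with inl i => (c i)%:C | inr j => 'i%C * (c' j)%:C end.
  pose D (i : I + J) := match i with inl i => A i | inr j => B j end.
  exists (simple_op C D), (I + J)%type, C, D; split => // [[]//|t].
  apply: (le_trans (le_normc_parts _)); rewrite [leRHS]splitr lerD //.
    apply: le_trans (hA t); rewrite ReD ReN /simple_fun big_sumType /= ReD !Re_sum.
    rewrite [\sum_i complex.Re ('i%C * _ * _)]big1 ?addr0 => [|j _]; last by rewrite !ReM /=; ring.
    rewrite (eq_bigr (fun i => c i * \1_(A i) t)) // => i _.
    by rewrite ReM /= mulr0 subr0.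
  apply: le_trans (hB t); rewrite ImD /simple_fun big_sumType /=.
  have ImN (x : R[i]) : complex.Im (- x) = - complex.Im x by case: x.
  rewrite ImN ImD !Im_sum.
  rewrite [\sum_i complex.Im ((c i)%:C * _)]big1 ?add0r => [|j _]; last by rewrite !ImM /=; ring.
  rewrite le_eqVlt; apply/orP; left; apply/eqP; congr (`|_ - _|).
  by apply: eq_bigr => j _; rewrite !ImM !ReM /=; ring.
have inv0 (m : nat) : 0 < m.+1%:R^-1 :> R by rewrite invr_gt0.
have [S SP] := choice (fun m => appr _ (inv0 m)).
have inv_le (N n : nat) : (N <= n)%N -> n.+1%:R^-1 <= N.+1%:R^-1 :> R.
  by move=> Nn; rewrite lef_pV2 ?posrE // ler_nat ltnS.
have close N m n h : (N <= m)%N -> (N <= n)%N ->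
    nrm (S m h - S n h) <= 2 / N.+1%:R * nrm h.
  have [I [c [A [mA fA ->]]]] := SP m; have [J [c' [B [mB fB ->]]]] := SP n.
  move=> Nm Nn; apply: simple_op_close => // t.
  apply: (le_trans (normcB_trans (f t) _ _)).
  rewrite normcBC mulr_natl mulr2n lerD //.
    by rewrite (le_trans (fA t)) // inv_le.
  by rewrite (le_trans (fB t)) // inv_le.
have lim h : exists l : H, (fun m => S m h) @ \oo --> l.
  apply: cauchy_seq_cvg => e e0.
  have K0 : 0 <= 2 * nrm h / e by rewrite divr_ge0 ?(ltW e0) // mulr_ge0 // nrm_ge0.
  exists (Num.bound (2 * nrm h / e)) => m n hm hn.
  apply: (le_trans (close _ _ _ h hm hn)); rewrite mulrAC ler_pdivrMr ?ltr0n // [leRHS]mulrC.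
  by rewrite -ler_pdivrMr // (le_trans (ltW (archi_boundP K0))) // ler_nat.
have [U UP] := choice lim.
exists U => e e0.
pose N := Num.bound (2 / e).
have Ne : 2 / N.+1%:R <= e.
  rewrite ler_pdivrMr ?ltr0n // mulrC -ler_pdivrMr //.
  apply: (le_trans (ltW (archi_boundP _))); first by rewrite divr_ge0 // ltW.
  by rewrite ler_nat.
have [I [c [A [mA fA SN]]]] := SP N.
exists I, c, A; split => // [t|h].
  rewrite (le_trans (fA t)) // (le_trans _ Ne) // ler_peMl ?ler1n //.
rewrite -SN; apply/ler_addgt0Pr => r r0.
move/cvg_nrmP : (UP h) => /(_ _ r0)[M _ hM].
have := hM (maxn M N) (leq_maxl _ _) => /= lt.
apply: (le_trans (nrm_sub_trans (S (maxn M N) h) _ _)).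
rewrite addrC lerD //; last by rewrite nrmBC ltW.
rewrite (le_trans (close N _ _ h (leq_maxr _ _) (leqnn _))) //.
by rewrite ler_wpM2r ?nrm_ge0.
Qed.

End Calculus.

Section FunctionalCalculus.
Context {R : realType} {H : completeNormedModType R[i]} {ip : {dot H for Num.conj}}.

(** Taking a = 1 and a = i separates the two cross terms. Linearity is required on V only, because
    one application has D involving an unbounded operator. *)
Lemma polarization (V : set H) (D : H -> H) :
  (forall a x y, V x -> V y -> V (a *: x + y)) ->
  (forall a x y, V x -> V y -> D (a *: x + y) = a *: D x + D y) ->
  (forall x, V x -> ip (D x) x = 0) -> forall x y, V x -> V y -> ip (D x) y = 0.
Proof.
move=> VD DD D0 x y Vx Vy.
have E a : a * ip (D x) y + Num.conj a * ip (D y) x = 0.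
  have := D0 _ (VD a _ _ Vx Vy); rewrite DD // !ipDl !ipDr !ipZl !ipZr.
  by rewrite !(D0 _ _) // !mulr0 addr0 add0r.
have := E 1; have := E 'i%C; rewrite rmorph1 !mul1r.
have -> : Num.conj 'i%C = - 'i%C :> R[i] by apply: complex_ext; rewrite /= ?oppr0.
rewrite mulNr -mulrBr => /eqP; rewrite mulf_eq0 => /orP[/eqP h|].
  by have := congr1 (@complex.Im R) h => /= /eqP; rewrite oner_eq0.
rewrite subr_eq0 => /eqP <- /eqP; rewrite -mulr2n mulrn_eq0 /= => /eqP.
by [].
Qed.

Context {d : measure_display} {T : measurableType d} {E : set T -> H -> H}.
Variables (Hip : inner_product_of_norm ip) (HE : projection_valued_measure ip E).
Local Notation mu := (spectral_measure Hip HE).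
Implicit Types (f g : T -> R[i]).

Lemma bounded_measC_normc f : bounded_measC f ->
  exists2 c : R, 0 <= c & forall t, normc (f t) <= c.
Proof.
move=> [[_ [c hc]] [_ [e he]]]; exists (`|c| + `|e|); first by rewrite addr_ge0.
move=> t; rewrite (le_trans (le_normc_parts _)) // lerD //.
  by rewrite (le_trans (hc t)) // ler_norm.
by rewrite (le_trans (he t)) // ler_norm.
Qed.

Lemma bounded_measC_real (f : T -> R) : bounded_meas f -> bounded_measC (fun t => (f t)%:C).
Proof. by move=> bf; split => //; exact: bounded_meas_cst. Qed.

Lemma bounded_measC_conj f : bounded_measC f -> bounded_measC (fun t => Num.conj (f t)).
Proof.
move=> [bR bI]; split.
  by under eq_fun do rewrite Re_conj.
by under eq_fun do rewrite Im_conj; exact: bounded_measN.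
Qed.

Lemma bounded_measCM f g : bounded_measC f -> bounded_measC g ->
  bounded_measC (fun t => f t * g t).
Proof.
move=> [fR fI] [gR gI]; split.
  by under eq_fun do rewrite ReM; apply: bounded_measB; exact: bounded_measM.
by under eq_fun do rewrite ImM; apply: bounded_measD; exact: bounded_measM.
Qed.

Lemma bounded_measC_cst (c : R[i]) : bounded_measC (fun _ : T => c).
Proof. by split; exact: bounded_meas_cst. Qed.

Lemma bounded_measCD f g : bounded_measC f -> bounded_measC g ->
  bounded_measC (fun t => f t + g t).
Proof.
move=> [fR fI] [gR gI]; split.
  by under eq_fun do rewrite ReD; exact: bounded_measD.
by under eq_fun do rewrite ImD; exact: bounded_measD.
Qed.

Lemma calculus_rip f U h : bounded_measC f -> is_calculus (E := E) f U ->
  rip ip (U h) h = \int[mu h]_t complex.Re (f t).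
Proof.
move=> [bR _] fU; apply/eqP; rewrite -subr_eq0 -normr_eq0; apply/eqP/le_anti.
rewrite normr_ge0 andbT; apply: (@le0_small _ _ (2 * nrm h ^+ 2)) => e e0.
have [I [c [A [mA fA UA]]]] := fU _ e0.
have bi i : bounded_meas (\1_(A i) : T -> R) by exact: bounded_meas_indic.
pose s t := \sum_i complex.Re (c i) * \1_(A i) t.
have sE t : s t = complex.Re (simple_fun c A t).
  by rewrite /simple_fun Re_sum; apply: eq_bigr => i _; rewrite ReM /= mulr0 subr0.
have bs : bounded_meas s.
  by apply: bounded_meas_sum => i; apply: bounded_measM => //; exact: bounded_meas_cst.
have Ss : rip ip (simple_op (E := E) c A h) h = \int[mu h]_t s t.
  rewrite mean_sum => [|i]; last by apply: bounded_measM => //; exact: bounded_meas_cst.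
  rewrite /simple_op rip_suml; apply: eq_bigr => i _; rewrite meanZ // mean_indic //=.
  rewrite /rip ipZl ReM; have := pvm_ip Hip HE h (mA i) (mA i).
  rewrite -(pvm_sym HE) // (pvm_idem HE) // setIid => ->.
  by rewrite /= mulr0 subr0.
have -> : rip ip (U h) h - \int[mu h]_t complex.Re (f t) =
    rip ip (U h - simple_op (E := E) c A h) h - \int[mu h]_t (complex.Re (f t) + -1 * s t).
  rewrite meanD //; last by apply: bounded_measM => //; exact: bounded_meas_cst.
  by rewrite meanZ // ripBl Ss; ring.
rewrite (le_trans (ler_normB _ _)) // mulr_natl mulr2n mulrDr lerD //.
  rewrite (le_trans (normr_rip_le Hip _ _)) // expr2 mulrA ler_wpM2r ?nrm_ge0 //.
have bd : bounded_meas (fun t => complex.Re (f t) + -1 * s t).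
  by apply: bounded_measD => //; apply: bounded_measM => //; exact: bounded_meas_cst.
have le_e t : `|complex.Re (f t) + -1 * s t| <= e.
  by rewrite mulN1r sE -ReN -ReD (le_trans (Re_le_normc _)).
have cE (x : R) : \int[mu h]_t x = x * nrm h ^+ 2.
  by rewrite Rintegral_cst //= (pvm_setT HE).
rewrite ler_norml -mulNr -!cE; apply/andP; split; apply: le_mean => //.
- exact: bounded_meas_cst.
- by move=> t; have := le_e t; rewrite ler_norml => /andP[].
- exact: bounded_meas_cst.
- by move=> t; have := le_e t; rewrite ler_norml => /andP[].
Qed.

Lemma calculus_ip f U h : bounded_measC f -> is_calculus (E := E) f U ->
  ip (U h) h = complex_integral (spectral_dist ip E h) f.
Proof.
move=> bf fU; apply: complex_ext => /=.
  by rewrite (spectral_integral Hip HE) -[LHS]/(rip ip (U h) h) (calculus_rip h bf fU).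
rewrite (spectral_integral Hip HE).
have := calculus_rip h (bounded_measCM (bounded_measC_cst (- 'i%C)) bf) (calculusZ (- 'i%C) fU).
rewrite scaleNr ripNl ripiZl opprK => ->.
apply: eq_Rintegral => t _; rewrite ReM /=; ring.
Qed.

(** [functional_calculus] chooses among the linear maps with a prescribed quadratic form:
    [calculus_ip] shows that there is one, polarization that there is no other. *)
Lemma functional_calculusP f : bounded_measC f ->
  is_calculus (E := E) f (functional_calculus ip E f).
Proof.
move=> bf; have [U fU] := calculus_exists Hip HE bf.
rewrite /functional_calculus; set S := [set _ | _].
have SU : S U.
  by split; [exact: (calculus_lin HE fU)|move=> h; exact: calculus_ip].
have := xgetPex (fun=> 0) (ex_intro S U SU); set W := xget _ _ => -[lW qW].
suff -> : W = U by [].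
apply/funext => h; apply: (@ip_ext _ _ ip) => k; apply/eqP.
rewrite -subr_eq0 -ipBl; apply/eqP.
have [lU qU] := SU.
apply: (@polarization setT (fun x => W x - U x)) => //.
  by move=> a x y _ _; rewrite lW lU opprD addrACA scalerBr.
by move=> x _; rewrite ipBl qW qU subrr.
Qed.

(** The adjoint V of U is the calculus of the conjugate of f, so V U is the calculus of |f|^2. *)
Lemma sqr_nrm_calculus f U h : bounded_measC f -> is_calculus (E := E) f U ->
  nrm (U h) ^+ 2 = \int[mu h]_t (normc (f t) ^+ 2).
Proof.
move=> bf fU; have bf' := bounded_measC_conj bf.
have [V fV] := calculus_exists Hip HE bf'.
have fU' : is_calculus (E := E) (fun t => Num.conj (Num.conj (f t))) U.
  by under eq_fun do rewrite conjCK.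
have adj := calculus_adj Hip HE fV fU'.
have [c _ hc] := bounded_measC_normc bf.
have hc' t : normc (Num.conj (f t)) <= c by rewrite normc_conj.
have := calculus_rip h (bounded_measCM bf' bf) (calculusM Hip HE fV fU hc' hc).
rewrite /rip adj ipxx //= => ->; apply: eq_Rintegral => t _.
by rewrite sqr_normcE ReM Re_conj Im_conj; ring.
Qed.

Lemma nrm_sub_pvm A h : measurable A -> nrm (h - E A h) ^+ 2 = nrm h ^+ 2 - nrm (E A h) ^+ 2.
Proof.
move=> mA; have [Ep _ _] := HE.
by rewrite (sqr_nrmB Hip) ripC -(orth_projection_sqr Hip h (Ep _ mA)); ring.
Qed.

(** By [nrm_sub_pvm] the squared error is mu h setT - mu h (B m), and mu h is continuous from
    below. *)
Lemma pvm_cvg_inc (B : nat -> set T) h : (forall m, measurable (B m)) ->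
  {homo B : m n / (m <= n)%N >-> m `<=` n} -> \bigcup_m B m = setT ->
  E (B m) h @[m --> \oo] --> h.
Proof.
move=> mB incB UB.
have cv : mu h (B m) @[m --> \oo] --> mu h setT.
  rewrite -UB; apply: nondecreasing_cvg_mu => //; first by rewrite UB.
  by move=> m n mn; apply/subsetPset; exact: incB.
have cvr : nrm (E (B m) h) ^+ 2 @[m --> \oo] --> nrm h ^+ 2.
  rewrite -{2}(pvm_setT HE h).
  by have /fine_cvgP[] := cv.
apply/cvg_nrmP => e e0; have e20 : 0 < e ^+ 2 by rewrite exprn_gt0.
have /cvgrPdist_lt/(_ _ e20) := cvr; apply: filterS => m lt.
rewrite nrmBC -(ltr_pXn2r (_ : 0 < 2)%N) ?nnegrE ?nrm_ge0 ?(ltW e0) //.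
by rewrite nrm_sub_pvm // (le_lt_trans (ler_norm _)).
Qed.

End FunctionalCalculus.

Lemma calculus_preimage {R : realType} {H : completeNormedModType R[i]}
    {d d' : measure_display} {T : measurableType d} {T' : measurableType d'}
    (E : set T -> H -> H) (p : T -> T') (f : T' -> R[i]) (U : H -> H) :
  measurable_fun setT p ->
  is_calculus (E := fun S => E (p @^-1` S)) f U -> is_calculus (E := E) (f \o p) U.
Proof.
move=> mp fU e /fU[I [c [A [mA fA UA]]]]; exists I, c, (fun i => p @^-1` A i).
by split => [i|t|//]; [rewrite -[_ @^-1` _]setTI; exact: mp|exact: fA].
Qed.

(** * Unbounded operators on their bounded spectral subspaces *)

Section SpectralOperator.
Context {R : realType} {H : completeNormedModType R[i]} {ip : {dot H for Num.conj}}.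
Hypothesis Hip : inner_product_of_norm ip.
Context {A : unbounded_operator H} {F : set (measurableTypeR R) -> H -> H}.
Hypothesis AF : spectral_measure_of ip A F.

Let HF : projection_valued_measure ip F.
Proof. by case: AF. Qed.

Local Notation mu := (spectral_measure Hip HF).

Definition centered_itv (r : R) : set (measurableTypeR R) := [set x : R | `|x| <= r].

Lemma measurable_centered_itv r : measurable (centered_itv r).
Proof.
have -> : centered_itv r = `[- r, r]%classic.
  by apply/seteqP; split => x; rewrite /centered_itv /= in_itv /= ler_norml.
exact: measurable_itv.
Qed.

Definition truncated_id (r : R) (x : measurableTypeR R) : R[i] :=
  ((x : R) * \1_(centered_itv r) x)%:C.

Lemma truncated_id_le r x : 0 <= r -> `|(x : R) * \1_(centered_itv r) x| <= r.
Proof.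
move=> r0; rewrite indicE; case: (boolP (x \in _)); rewrite ?mulr1 ?mulr0 ?normr0 //.
by rewrite inE.
Qed.

Lemma bounded_truncated_id r : 0 <= r -> bounded_measC (truncated_id r).
Proof.
move=> r0; apply: bounded_measC_real; split; last first.
  by exists r => x; exact: truncated_id_le.
apply: measurable_funM => //; apply: measurable_indic.
exact: measurable_centered_itv.
Qed.

Section Bounded.
Variables (r : R) (r0 : 0 <= r) (h : H).
Hypothesis hr : F (centered_itv r) h = h.

Let mI := measurable_centered_itv r.

Let null_compl : mu h (~` centered_itv r) = 0%E.
Proof.
have mC : measurable (~` centered_itv r) by exact: measurableC.
rewrite /spectral_measure -hr (pvm_setI Hip HF) // setICl.
by rewrite (pvm_set0 HF) nrm0 expr0n.
Qed.

Let negl : (mu h).-negligible (~` centered_itv r).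
Proof. by apply/negligibleP => //; exact: measurableC. Qed.

Lemma bounded_in_domain : op_dom A h.
Proof.
have [_ domA _] := AF; apply/domA; rewrite (spectral_integral Hip HF).
rewrite (ge0_negligible_integral (N := ~` centered_itv r)) //; last first.
- by move=> x _; rewrite lee_fin sqr_ge0.
- by apply/measurable_EFinP; exact: measurable_funX.
- exact: measurableC.
rewrite setTD setCK.
apply: (@le_lt_trans _ _ (\int[mu h]_(x in centered_itv r) (r ^+ 2)%:E)%E).
  apply: ge0_le_integral => //.
  - by move=> x _; rewrite lee_fin sqr_ge0.
  - by apply/measurable_EFinP; apply: measurable_funX.
  - by move=> x /= xr; rewrite lee_fin -real_normK ?num_real // ler_pXn2r ?nnegrE.
rewrite integral_cst // lte_mul_pinfty ?lee_fin ?sqr_ge0 //.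
by rewrite ltry.
Qed.

Lemma bounded_quadratic_form G : is_calculus (E := F) (truncated_id r) G ->
  ip (A h) h = ip (G h) h.
Proof.
move=> hG; have [_ _ qA] := AF; rewrite qA; last exact: bounded_in_domain.
rewrite (calculus_ip Hip HF h (bounded_truncated_id r0) hG).
apply: complex_ext => //=; congr fine.
rewrite !(spectral_integral Hip HF).
apply: ae_eq_integral => //.
- by have [[]] := bounded_truncated_id r0 => m _ _; exact/measurable_EFinP.
exists (~` centered_itv r); split => //; first exact: measurableC.
move=> x /= nx xr; apply: nx => _; rewrite indicE mem_set //.
by rewrite mulr1.
Qed.

End Bounded.

(** [spectral_measure_of] only provides the quadratic form of A. Polarizing in the range of F
    (centered_itv r) would test A h against that range alone, in which A h is not yet known to lie;
    so the test vectors come from larger intervals s, whose ranges are dense together. *)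
Lemma bounded_spectral_operator (r : R) (h : H) G : 0 <= r -> F (centered_itv r) h = h ->
  is_calculus (E := F) (truncated_id r) G -> op_dom A h /\ A h = G h.
Proof.
move=> r0 hr hG; split.
  exact: (bounded_in_domain r0 hr).
have rest s x : r <= s -> F (centered_itv r) x = x -> F (centered_itv s) x = x.
  move=> rs xr; rewrite -{2}xr -[in LHS]xr (pvm_setI Hip HF); try exact: measurable_centered_itv.
  congr F; apply/seteqP; split => y /= => [[]//|yr]; split => //.
  exact: le_trans yr rs.
have key s y : r <= s -> F (centered_itv s) y = y -> ip (A h - G h) y = 0.
  move=> rs ys; have s0 : 0 <= s by exact: le_trans rs.
  have [Gs hGs] := calculus_exists Hip HF (bounded_truncated_id s0).
  have mI := measurable_centered_itv.
  have GsE : Gs h = G h.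
    have [c _ cb] := bounded_measC_normc (bounded_truncated_id s0).
    have i1 (t : measurableTypeR R) : normc ((\1_(centered_itv r) t : R)%:C) <= 1.
      by rewrite normc_real indicE; case: (_ \in _); rewrite ?normr1 ?normr0.
    have := calculusM Hip HF hGs (calculus_indic (mI r)) cb i1.
    rewrite (_ : (fun t => _) = truncated_id r); last first.
      apply/funext => t; rewrite /truncated_id -rmorphM /= -mulrA; congr (_ * _)%:C.
      rewrite (_ : centered_itv r = centered_itv s `&` centered_itv r) ?indicI //=.
        by rewrite !indicE; case: (t \in centered_itv s); rewrite ?mul1r ?mul0r.
      by apply/seteqP; split => z //= => [yr|[]//]; split => //; exact: le_trans yr rs.
    by move=> /(calculus_unique Hip HF hG)/(_ h); rewrite hr.
  rewrite -GsE.
  pose V := [set x | F (centered_itv s) x = x].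
  apply: (@polarization _ _ ip V (fun x => A x - Gs x)) => //.
  - by move=> a x z; rewrite /V /= (pvm_lin HF) // => -> ->.
  - move=> a x z Vx Vz; rewrite op_linear; [|exact: (bounded_in_domain s0)..].
    by rewrite (calculus_lin HF hGs) opprD addrACA scalerBr.
  - by move=> x Vx; rewrite ipBl (bounded_quadratic_form s0 Vx hGs) subrr.
  - exact: rest.
apply/eqP; rewrite -subr_eq0; apply/eqP; apply: (@ip_ext _ _ ip) => k; rewrite ip0l.
pose B m := centered_itv (r + m%:R).
have mB m : measurable (B m) by exact: measurable_centered_itv.
have cvB x : F (B m) x @[m --> \oo] --> x.
  apply: (pvm_cvg_inc Hip HF) => //.
    by move=> m n mn y; rewrite /B /centered_itv /= => /le_trans; apply; rewrite lerD2l ler_nat.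
  apply/seteqP; split => // y _; exists (Num.bound `|y : R|) => //.
  rewrite /B /centered_itv /=.
  by rewrite (le_trans (ltW (archi_boundP (normr_ge0 (y : R))))) // lerDr.
have rz x : rip ip (A h - G h) x = 0.
  have : rip ip (F (B m) x) (A h - G h) @[m --> \oo] --> rip ip x (A h - G h).
    exact: cvg_rip.
  have z m : rip ip (F (B m) x) (A h - G h) = 0.
    rewrite ripC /rip (key (r + m%:R)) ?lerDl //.
    exact: (pvm_idem HF _ (mB m)).
  under eq_fun do rewrite z.
  by rewrite ripC => /cvg_lim <- //; rewrite lim_cst.
by rewrite ipE !rz.
Qed.

End SpectralOperator.

(** * Exponentials of commuting operators *)

Section CircleExponential.
Context {R : realType}.
Implicit Types x y : R.

Lemma expiD x y : expi (x + y) = expi x * expi y.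
Proof. by apply: complex_ext; rewrite ?ReM ?ImM /= ?cosD ?sinD; ring. Qed.

Lemma expi0 : expi 0 = 1 :> R[i].
Proof. by apply: complex_ext; rewrite /= ?cos0 ?sin0. Qed.

Lemma conj_expi x : Num.conj (expi x) = expi (- x).
Proof. by apply: complex_ext; rewrite ?Re_conj ?Im_conj /= ?cosN ?sinN. Qed.

Lemma normc_expi x : normc (expi x) = 1.
Proof. by rewrite /= cos2Dsin2 sqrtr1. Qed.

Lemma MVT_bound (f f' : R -> R) (c x : R) :
  (forall y, is_derive y 1 f (f' y)) -> (forall y, `|y| <= `|x| -> `|f' y| <= c) ->
  `|f x - f 0| <= c * `|x|.
Proof.
move=> fd hc; have fc (a b : R) : {within `[a, b], continuous f}.
  apply: derivable_within_continuous => y _.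
  by have := fd y => ?; exact: ex_derive.
have [x0|x0] := leP 0 x.
  have [y yx ->] := MVT_segment x0 (fun y _ => fd y) (fc 0 x).
  rewrite subr0 normrM ler_wpM2r //; apply: hc.
  by move: yx; rewrite in_itv /= => /andP[y0 yx]; rewrite !ger0_norm.
have [y yx E] := MVT_segment (ltW x0) (fun y _ => fd y) (fc x 0).
rewrite distrC E sub0r normrM normrN ler_wpM2r //; apply: hc.
by move: yx; rewrite in_itv /= => /andP[yx y0]; rewrite !ler0_norm ?lerN2 // ltW.
Qed.

Lemma normr_sin_le1 x : `|sin x| <= 1.
Proof. by rewrite ler_norml sin_geN1 sin_le1. Qed.

Lemma normr_cos_sub1 x : `|cos x - 1| <= `|x|.
Proof.
rewrite -cos0 -[leRHS]mul1r.
apply: (@MVT_bound cos (fun y => - sin y)) => y.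
by rewrite normrN normr_sin_le1.
Qed.

Lemma normr_sin_le x : `|sin x| <= `|x|.
Proof.
rewrite -[sin x]subr0 -sin0 -[leRHS]mul1r.
apply: (@MVT_bound sin cos) => y.
by move=> _; rewrite ler_norml cos_geN1 cos_le1.
Qed.

(** The mean value theorem bounds the real and the imaginary part by x ^+ 2 each, whence the
    constant 2. *)
Lemma expi_taylor x : normc (expi x - 1 - 'i%C * x%:C) <= 2 * x ^+ 2.
Proof.
apply: (le_trans (le_normc_parts _)).
rewrite (_ : 2 * x ^+ 2 = `|x| * `|x| + `|x| * `|x|); last first.
  by rewrite -expr2 real_normK ?num_real // mulr_natl mulr2n.
apply: lerD.
  have -> : complex.Re (expi x - 1 - 'i%C * x%:C) = cos x - cos 0.
    by rewrite !ReD !ReN ReM /= cos0; ring.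
  apply: (@MVT_bound cos (fun y => - sin y)) => y.
  by move=> yx; rewrite normrN (le_trans (normr_sin_le y)).
have -> : complex.Im (expi x - 1 - 'i%C * x%:C) = (sin x - x) - (sin 0 - 0).
  have ImN (z : R[i]) : complex.Im (- z) = - complex.Im z by case: z.
  by rewrite !ImD !ImN ImM /= sin0; ring.
apply: (@MVT_bound (fun y => sin y - y) (fun y => cos y - 1)) => y.
by move=> yx; rewrite (le_trans (normr_cos_sub1 y)).
Qed.

End CircleExponential.

Section Coordinates.
Context {R : realType} {n : nat}.
Local Notation Rn := (n.-tuple (measurableTypeR R)).

Definition linear_form (xi : 'rV[R]_n) (t : Rn) : R :=
  \sum_(j < n) xi ord0 j * (tnth t j : R).

Definition cube (r : R) : set Rn := [set t | forall j, `|tnth t j : R| <= r].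

Lemma linear_formD xi eta t : linear_form (xi + eta) t = linear_form xi t + linear_form eta t.
Proof. by rewrite /linear_form -big_split; apply: eq_bigr => j _; rewrite mxE mulrDl. Qed.

Lemma linear_form0 t : linear_form 0 t = 0.
Proof. by rewrite /linear_form big1 // => j _; rewrite mxE mul0r. Qed.

Lemma linear_formN xi t : linear_form (- xi) t = - linear_form xi t.
Proof. by rewrite /linear_form -sumrN; apply: eq_bigr => j _; rewrite mxE mulNr. Qed.

Lemma linear_form_basis (s : R) j t : linear_form (s *: delta_mx ord0 j) t = s * (tnth t j : R).
Proof.
rewrite /linear_form (bigD1 j) //= big1 ?addr0 => [|k kj].
  by rewrite !mxE !eqxx mulr1.
by rewrite !mxE (negbTE kj) andbF mulr0 mul0r.
Qed.

Lemma measurable_coord j : measurable_fun setT (fun t : Rn => tnth t j).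
Proof. exact: measurable_tnth. Qed.

Lemma measurable_linear_form xi : measurable_fun setT (linear_form xi).
Proof.
apply: measurable_sum => j; apply: measurable_funM; first exact: measurable_cst.
exact: measurable_coord.
Qed.

Lemma bounded_expi xi : bounded_measC (fun t : Rn => expi (linear_form xi t)).
Proof.
have mx := measurable_linear_form xi.
split; (split; last by exists 1 => t /=; rewrite ler_norml ?cos_geN1 ?cos_le1 ?sin_geN1 ?sin_le1).
  exact: (measurableT_comp (continuous_measurable_fun (@continuous_cos R)) mx).
exact: (measurableT_comp (continuous_measurable_fun (@continuous_sin R)) mx).
Qed.

Lemma measurable_cube r : measurable (cube r).
Proof.
have -> : cube r = \bigcap_(j in setT) ((fun t : Rn => tnth t j) @^-1` centered_itv r).
  by apply/seteqP; split => t /= tr j; [move=> _|]; exact: tr.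
apply: fin_bigcap_measurable => // j _; rewrite -[_ @^-1` _]setTI.
by apply: measurable_coord => //; exact: measurable_centered_itv.
Qed.

End Coordinates.

Section JointSpectralMeasure.
Context {R : realType} {H : completeNormedModType R[i]} {ip : {dot H for Num.conj}}.
Context {n : nat}.
Local Notation Rn := (n.-tuple (measurableTypeR R)).
Variables (Hip : inner_product_of_norm ip).
Variables (E : set Rn -> H -> H) (HE : projection_valued_measure ip E).
Local Notation U := (exp_i ip E).

Lemma exp_i_calculus xi : is_calculus (E := E) (fun t => expi (linear_form xi t)) (U xi).
Proof. exact: (functional_calculusP Hip HE (bounded_expi xi)). Qed.

Let expi_le1 xi (t : Rn) : normc (expi (linear_form xi t)) <= 1.
Proof. by rewrite normc_expi. Qed.

Lemma exp_i_lin xi : linear (U xi).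
Proof. exact: (calculus_lin HE (exp_i_calculus xi)). Qed.

Lemma exp_iD xi eta h : U xi (U eta h) = U (xi + eta) h.
Proof.
have := calculusM Hip HE (exp_i_calculus xi) (exp_i_calculus eta) (expi_le1 xi) (expi_le1 eta).
under eq_fun do rewrite -expiD -linear_formD.
by move=> /(calculus_unique Hip HE (exp_i_calculus (xi + eta)))/(_ h).
Qed.

Lemma exp_i0 h : U 0 h = h.
Proof.
have := calculus_indic (E := E) (@measurableT _ Rn).
rewrite (_ : (fun t => _) = (fun t => expi (linear_form 0 t))); last first.
  by apply/funext => t; rewrite linear_form0 expi0 indicE in_setT.
move=> /(calculus_unique Hip HE (exp_i_calculus 0))/(_ h) ->.
exact: pvm_setT HE h.
Qed.

Lemma exp_iNK xi h : U (- xi) (U xi h) = h.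
Proof. by rewrite exp_iD addNr exp_i0. Qed.

Lemma exp_i_adj xi h k : ip (U xi h) k = ip h (U (- xi) k).
Proof.
apply: (calculus_adj Hip HE (exp_i_calculus xi)).
under eq_fun do rewrite conj_expi -linear_formN.
exact: exp_i_calculus.
Qed.

Lemma nrm_exp_i xi h : nrm (U xi h) = nrm h.
Proof.
apply/eqP; rewrite -(eqrXn2 (_ : 0 < 2)%N) ?nrm_ge0 //; apply/eqP/complexI.
by rewrite -!(ipxx Hip) exp_i_adj exp_iNK.
Qed.

Lemma exp_i_pvm xi A h : measurable A -> U xi (E A h) = E A (U xi h).
Proof.
move=> mA; have i1 (t : Rn) : normc ((\1_A t : R)%:C) <= 1.
  by rewrite normc_real indicE; case: (_ \in _); rewrite ?normr1 ?normr0.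
have c1 := calculusM Hip HE (exp_i_calculus xi) (calculus_indic mA) (expi_le1 xi) i1.
have c2 := calculusM Hip HE (calculus_indic mA) (exp_i_calculus xi) i1 (expi_le1 xi).
rewrite (_ : (fun t => _) = (fun t => expi (linear_form xi t) * (\1_A t)%:C)) in c2.
  exact: (calculus_unique Hip HE c1 c2).
by apply/funext => t; rewrite mulrC.
Qed.

End JointSpectralMeasure.

Section JointOperators.
Context {R : realType} {H : completeNormedModType R[i]} {ip : {dot H for Num.conj}}.
Context {n : nat}.
Local Notation Rn := (n.-tuple (measurableTypeR R)).
Variables (Hip : inner_product_of_norm ip).
Variables (X : 'I_n -> unbounded_operator H) (E : set Rn -> H -> H).
Hypothesis XE : joint_spectral_measure_of ip X E.
Local Notation U := (exp_i ip E).

Let HE : projection_valued_measure ip E.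
Proof. by case: XE. Qed.

Section CubeBounded.
Variables (r : R) (h : H).
Hypotheses (r0 : 0 <= r) (hr : E (cube r) h = h).

Lemma cube_bounded_operator j : exists G : H -> H,
  [/\ is_calculus (E := E) (fun t => truncated_id r (tnth t j)) G,
      op_dom (X j) h & X j h = G h].
Proof.
have [_ /(_ j) XFj] := XE; have [HF _ _] := XFj.
have [G hG] := calculus_exists Hip HF (bounded_truncated_id r0).
have mp := @measurable_coord R n j.
have hFr : E ((fun t : Rn => tnth t j) @^-1` centered_itv r) h = h.
  rewrite -{1}hr (pvm_setI Hip HE); last 2 first.
  - rewrite -[_ @^-1` _]setTI; apply: mp => //; exact: measurable_centered_itv.
  - exact: measurable_cube.
  rewrite -[RHS]hr; congr (E _ h); apply/seteqP; split => t /= => [[]//|tr].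
  by split => //; exact: tr.
have [dh Xh] := bounded_spectral_operator Hip XFj r0 hFr hG.
by exists G; split => //; exact: calculus_preimage mp hG.
Qed.

Lemma cube_bounded_domain j : op_dom (X j) h.
Proof. by have [G []] := cube_bounded_operator j. Qed.

Lemma nrm_cube_bounded_operator j : nrm (X j h) <= r * nrm h.
Proof.
have [G [hG _ ->]] := cube_bounded_operator j.
apply: (calculus_le Hip HE h hG) => // t; rewrite normc_real.
exact: truncated_id_le.
Qed.

Lemma exp_i_taylor (s : R) j :
  nrm (U (s *: delta_mx ord0 j) h - h - ('i%C * s%:C) *: X j h) <= 2 * (s * r) ^+ 2 * nrm h.
Proof.
have [G [hG _ ->]] := cube_bounded_operator j.
have mC := measurable_cube (n := n) r.
set xi := s *: _.
pose f (t : Rn) : R[i] := expi (linear_form xi t) + ((-1) * (\1_(cube r) t)%:C +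
  (- ('i%C * s%:C)) * truncated_id r (tnth t j)).
have cf := calculusD (exp_i_calculus Hip HE xi) (calculusD
  (calculusZ (-1) (calculus_indic (E := E) mC)) (calculusZ (- ('i%C * s%:C)) hG)).
have bf : bounded_measC f.
  apply: bounded_measCD; first exact: bounded_expi.
  apply: bounded_measCD; apply: bounded_measCM; try exact: bounded_measC_cst.
    by apply: bounded_measC_real; exact: bounded_meas_indic.
  have [[mR bR] _] := bounded_truncated_id r0; apply: bounded_measC_real; split.
    exact: (measurableT_comp mR (measurable_coord j)).
  by have [c hc] := bR; exists c => t; exact: hc.
have [c _ hc] := bounded_measC_normc bf.
have i1 (t : Rn) : normc ((\1_(cube r) t : R)%:C) <= 1.
  by rewrite normc_real indicE; case: (_ \in _); rewrite ?normr1 ?normr0.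
(* Since h is fixed by E (cube r), f may be multiplied by the indicator of the cube, where
   coordinates are at most r and the Taylor bound is uniform. *)
have cfi := calculusM Hip HE cf (calculus_indic (E := E) mC) hc i1.
have := calculus_le (e := 2 * (s * r) ^+ 2) Hip HE h cfi.
rewrite !hr scaleN1r scaleNr addrA; apply; first by rewrite mulr_ge0 // sqr_ge0.
move=> t; rewrite ComplexField.Normc.normcM.
have [tr|ntr] := pselect (cube r t); last first.
  by rewrite indicE memNset // ComplexField.Normc.normc0 mulr0 mulr_ge0 // sqr_ge0.
rewrite indicE mem_set // ComplexField.Normc.normc1 mulr1 mulr1.
rewrite /truncated_id indicE mem_set ?mulr1; last exact: tr.
rewrite /xi linear_form_basis mulNr -mulrA -rmorphM addrA.
apply: (le_trans (expi_taylor _)); rewrite ler_pM2l // -[leLHS]real_normK ?num_real //.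
rewrite !normrM exprMn (exprMn _ s) -(real_normK (num_real s)).
by rewrite ler_wpM2l ?sqr_ge0 // ler_pXn2r ?nnegrE // tr.
Qed.

End CubeBounded.

End JointOperators.

(** Integration of a derivative bound without derivatives: over N equal steps the quadratic errors
    add up to at most a ^+ 2 * |C| / N. Taking N above a keeps the steps below 1, and above a ^+ 2 *
    |C| / e keeps the total error below e. *)
Lemma linear_increment_le {R : realType} (P : R -> R) (a B C : R) : 0 <= a ->
  (forall t s, 0 <= t -> t <= a -> 0 <= s -> s <= 1 -> P (t + s) - P t <= s * B + s ^+ 2 * C) ->
  P a - P 0 <= a * B.
Proof.
move=> a0 hP; apply/ler_addgt0Pr => e e0.
pose K := a + a ^+ 2 * `|C| / e.
have K0 : 0 <= K by rewrite addr_ge0 // divr_ge0 ?(ltW e0) // mulr_ge0 // sqr_ge0.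
pose N := (Num.bound K).+1; pose s := a / N%:R.
have N0 : 0 < N%:R :> R by rewrite ltr0n.
have KN : K <= N%:R by rewrite (le_trans (ltW (archi_boundP K0))) // ler_nat.
have s0 : 0 <= s by rewrite divr_ge0 // ltW.
have s1 : s <= 1.
  rewrite ler_pdivrMr // mul1r; apply: le_trans KN; rewrite lerDl.
  by rewrite divr_ge0 ?(ltW e0) // mulr_ge0 // sqr_ge0.
have sN : s * N%:R = a by rewrite divfK // gt_eqF.
have step m : (m <= N)%N -> P (s * m%:R) - P 0 <= m%:R * (s * B + s ^+ 2 * C).
  elim: m => [|m IH] mN; first by rewrite mulr0 subrr mul0r.
  rewrite -[X in X - _](subrK (P (s * m%:R))) -addrA -natr1 mulrDl mul1r addrC.
  apply: lerD; first exact/IH/ltnW.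
  rewrite mulrDr mulr1; apply: hP => //; first by rewrite mulr_ge0.
  by rewrite -sN ler_wpM2l // ler_nat ltnW.
have := step N (leqnn N); rewrite sN => /le_trans; apply.
rewrite mulrDr mulrA (mulrC N%:R) sN lerD2l.
apply: (@le_trans _ _ (a ^+ 2 * `|C| / N%:R)).
  have -> : N%:R * (s ^+ 2 * C) = a ^+ 2 * C / N%:R.
    by rewrite /s; field; rewrite gt_eqF.
  by rewrite ler_pM2r ?invr_gt0 // ler_wpM2l ?sqr_ge0 // ler_norm.
rewrite ler_pdivrMr // [leRHS]mulrC -ler_pdivrMr //.
by apply: le_trans KN; rewrite lerDr.
Qed.

(** * Duhamel's formula *)

Section Duhamel.
Context {R : realType} {H : completeNormedModType R[i]} {ip : {dot H for Num.conj}}.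
Context {n : nat}.
Local Notation Rn := (n.-tuple (measurableTypeR R)).
Variables (Hip : inner_product_of_norm ip).
Variables (X Y : 'I_n -> unbounded_operator H) (EX EY : set Rn -> H -> H).
Hypothesis XE : joint_spectral_measure_of ip X EX.
Hypothesis YE : joint_spectral_measure_of ip Y EY.
Local Notation UX := (exp_i ip EX).
Local Notation UY := (exp_i ip EY).
Variables (j : 'I_n) (K : H -> H).
Hypothesis Ysym : self_adjoint ip (Y j).
Hypothesis XYK : op_dom (X j) = op_dom (Y j) /\ forall h, op_dom (Y j) h -> X j h = Y j h + K h.
Let e_ : 'rV[R]_n := delta_mx ord0 j.

Let HX : projection_valued_measure ip EX. Proof. by case: XE. Qed.
Let HY : projection_valued_measure ip EY. Proof. by case: YE. Qed.

(* The derivative of <exp(i s X_j) g, exp(i s Y_j) v> at s = 0 is <i K g, v>; the truncations by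
   cubes make the remainder quadratic. *)
Lemma duhamel_step (r r' s : R) g v : 0 <= r -> 0 <= r' -> 0 <= s -> s <= 1 ->
  EX (cube r) g = g -> EY (cube r') v = v ->
  rip ip (UX (s *: e_) g) (UY (s *: e_) v) - rip ip g v <=
    s * rip ip ('i%C *: K g) v +
    s ^+ 2 * ((r * r' + 2 * r * r' ^+ 2 + 2 * r ^+ 2 + 2 * r' ^+ 2) * (nrm g * nrm v)).
Proof.
move=> r0 r'0 s0 s1 gr vr.
have gX := cube_bounded_domain Hip XE r0 gr j.
have vY := cube_bounded_domain Hip YE r'0 vr j.
have gY : op_dom (Y j) g by rewrite -XYK.1.
have Xg := nrm_cube_bounded_operator Hip XE r0 gr j.
have Yv := nrm_cube_bounded_operator Hip YE r'0 vr j.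
have Tg := exp_i_taylor Hip XE r0 gr s j.
have Tv := exp_i_taylor Hip YE r'0 vr s j.
rewrite -/e_ in Tg Tv.
set ug := UX (s *: e_) g in Tg *; set uv := UY (s *: e_) v in Tv *.
set pg := ug - g - _ in Tg; set pv := uv - v - _ in Tv.
have ugE : ug = g + ('i%C * s%:C) *: X j g + pg.
  by rewrite /pg addrC -[_ - _ - _]addrA -opprD subrK.
have uvE : uv - v = ('i%C * s%:C) *: Y j v + pv by rewrite /pv [RHS]addrC subrK.
have nuv : nrm uv = nrm v by exact: (nrm_exp_i Hip HY).
have iZ (x : H) : ('i%C * s%:C) *: x = s%:C *: ('i%C *: x) by rewrite mulrC scalerA.
(* The first-order terms are <i X g, v> and <g, i Y v>; by symmetry of [Y j] they combine to <i (X -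
   Y) g, v>, that is <i K g, v>. *)
have main : rip ip ug uv - rip ip g v = s * rip ip ('i%C *: K g) v +
    (s * rip ip ('i%C *: X j g) (uv - v) + rip ip pg uv + rip ip g pv).
  have symY : rip ip g ('i%C *: Y j v) = - rip ip ('i%C *: Y j g) v.
    have [_ /(_ v (Y j v)) [_ h]] := Ysym.
    by rewrite ripiZr ripiZl opprK h.
  have -> : rip ip ('i%C *: K g) v = rip ip ('i%C *: X j g) v + rip ip g ('i%C *: Y j v).
    rewrite symY XYK.2 // scalerDr ripDl; ring.
  have -> : rip ip ug uv = rip ip g uv + s * rip ip ('i%C *: X j g) uv + rip ip pg uv.
    by rewrite {1}ugE !ripDl iZ ripZl.
  have -> : rip ip g uv = rip ip g v + s * rip ip g ('i%C *: Y j v) + rip ip g pv.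
    by rewrite -[uv](subrK v) uvE !ripDr iZ ripZr; ring.
  by rewrite ripBr; ring.
rewrite main lerD2l.
have i1 : normc ('i%C : R[i]) = 1 by rewrite /= expr0n expr1n add0r sqrtr1.
have b1 : rip ip ('i%C *: X j g) (uv - v) <= (r * nrm g) * (s * (r' * nrm v) + 2 * (s * r') ^+ 2 * nrm v).
  apply: (le_trans (rip_le Hip _ _)); rewrite nrmZ i1 mul1r.
  apply: ler_pM; rewrite ?nrm_ge0 //.
  rewrite uvE (le_trans (nrmD _ _)) // lerD //.
  by rewrite iZ nrmZr nrmZ i1 mul1r ger0_norm // ler_wpM2l.
have b2 : rip ip pg uv <= 2 * (s * r) ^+ 2 * nrm g * nrm v.
  by apply: (le_trans (rip_le Hip _ _)); rewrite nuv ler_wpM2r ?nrm_ge0.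
have b3 : rip ip g pv <= nrm g * (2 * (s * r') ^+ 2 * nrm v).
  by apply: (le_trans (rip_le Hip _ _)); rewrite ler_wpM2l ?nrm_ge0.
apply: (@le_trans _ _ (s * ((r * nrm g) * (s * (r' * nrm v) + 2 * (s * r') ^+ 2 * nrm v)) +
   2 * (s * r) ^+ 2 * nrm g * nrm v + nrm g * (2 * (s * r') ^+ 2 * nrm v))).
  by apply: lerD => //; apply: lerD => //; rewrite ler_wpM2l.
rewrite -subr_ge0.
have -> : s ^+ 2 * ((r * r' + 2 * r * r' ^+ 2 + 2 * r ^+ 2 + 2 * r' ^+ 2) * (nrm g * nrm v)) -
   (s * ((r * nrm g) * (s * (r' * nrm v) + 2 * (s * r') ^+ 2 * nrm v)) +
   2 * (s * r) ^+ 2 * nrm g * nrm v + nrm g * (2 * (s * r') ^+ 2 * nrm v)) =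
   s ^+ 2 * (2 * r * r' ^+ 2) * (nrm g * nrm v) * (1 - s) by ring.
by rewrite !mulr_ge0 ?nrm_ge0 ?sqr_ge0 ?subr_ge0.
Qed.

(** The hypothesis bounds the whole sum at each fixed t, so the step is summed over l before it is
    integrated. The radii r and r' only enter the quadratic error, which [linear_increment_le]
    eliminates; the bound is thus independent of r'. *)
Lemma duhamel_bounded I (l : seq I) (g v : I -> H) (r r' a B : R) :
  0 <= r -> 0 <= r' -> 0 <= a ->
  (forall i, EX (cube r) (g i) = g i) -> (forall i, EY (cube r') (v i) = v i) ->
  (forall i, nrm (v i) <= 1) ->
  (forall t, 0 <= t -> t <= a -> \sum_(i <- l) nrm (K (UX (t *: e_) (g i))) <= B) ->
  \sum_(i <- l) rip ip (UY (- (a *: e_)) (UX (a *: e_) (g i)) - g i) (v i) <= a * B.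
Proof.
move=> r0 r'0 a0 gr vr v1 hB.
pose P t := \sum_(i <- l) rip ip (UX (t *: e_) (g i)) (UY (t *: e_) (v i)).
have -> : \sum_(i <- l) rip ip (UY (- (a *: e_)) (UX (a *: e_) (g i)) - g i) (v i) = P a - P 0.
  rewrite /P -sumrB; apply: eq_bigr => i _; rewrite ripBl scale0r.
  by rewrite (exp_i0 Hip HX) (exp_i0 Hip HY) /rip (exp_i_adj Hip HY) opprK.
pose C := \sum_(i <- l)
  ((r * r' + 2 * r * r' ^+ 2 + 2 * r ^+ 2 + 2 * r' ^+ 2) * (nrm (g i) * nrm (v i))).
apply: (@linear_increment_le _ _ _ _ C) => // t s t0 ta s0 s1.
apply: (@le_trans _ _ (\sum_(i <- l) (s * nrm (K (UX (t *: e_) (g i))) + s ^+ 2 *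
  ((r * r' + 2 * r * r' ^+ 2 + 2 * r ^+ 2 + 2 * r' ^+ 2) * (nrm (g i) * nrm (v i)))))).
  rewrite /P -sumrB; apply: ler_sum => i _.
  set g' := UX (t *: e_) (g i); set v' := UY (t *: e_) (v i).
  have g'r : EX (cube r) g' = g'.
    by rewrite -(exp_i_pvm Hip HX) ?gr //; exact: measurable_cube.
  have v'r : EY (cube r') v' = v'.
    by rewrite -(exp_i_pvm Hip HY) ?vr //; exact: measurable_cube.
  have := duhamel_step r0 r'0 s0 s1 g'r v'r.
  rewrite (exp_iD Hip HX) (exp_iD Hip HY) -scalerDl (addrC s).
  rewrite /g' /v' (nrm_exp_i Hip HX) (nrm_exp_i Hip HY) => /le_trans; apply.
  rewrite lerD2r ler_wpM2l //; apply: (le_trans (rip_le Hip _ _)).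
  rewrite (nrm_exp_i Hip HY) nrmZ.
  have -> : normc ('i%C : R[i]) = 1 by rewrite /= expr0n expr1n add0r sqrtr1.
  by rewrite mul1r ler_piMr ?nrm_ge0.
rewrite big_split /= -mulr_sumr -[X in _ + X <= _]mulr_sumr lerD2r ler_wpM2l //.
exact: hB.
Qed.

(** Each norm is a pairing with a vector v i of norm at most 1. The v i are truncated by the cubes
    of EY so that [duhamel_bounded] applies, and the truncation is removed in the limit. *)
Lemma duhamel I (l : seq I) (g : I -> H) (r a B : R) : 0 <= r -> 0 <= a ->
  (forall i, EX (cube r) (g i) = g i) ->
  (forall t, 0 <= t -> t <= a -> \sum_(i <- l) nrm (K (UX (t *: e_) (g i))) <= B) ->
  \sum_(i <- l) nrm (UY (- (a *: e_)) (UX (a *: e_) (g i)) - g i) <= a * B.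
Proof.
move=> r0 a0 gr hB.
pose D i := UY (- (a *: e_)) (UX (a *: e_) (g i)) - g i.
have exv i : exists v, nrm v <= 1 /\ rip ip (D i) v = nrm (D i).
  have [D0|D0] := eqVneq (nrm (D i)) 0.
    by exists 0; rewrite nrm0 rip0r D0.
  exists ((nrm (D i))^-1%:C *: D i).
  rewrite nrmZr ger0_norm ?invr_ge0 ?nrm_ge0 // mulVf // ripZr (ripxx Hip).
  by rewrite expr2 mulKf.
have [v vP] := choice exv.
have mC m : measurable (cube m%:R : set Rn) by exact: measurable_cube.
have cv : \sum_(i <- l) rip ip (EY (cube m%:R) (v i)) (D i) @[m --> \oo] -->
    \sum_(i <- l) rip ip (v i) (D i).
  apply: cvg_big => [|i _]; first exact: add_continuous.
  apply: cvg_rip => //; apply: (pvm_cvg_inc Hip HY) => //.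
    by move=> m p mp t /= h k; rewrite (le_trans (h k)) // ler_nat.
  apply/seteqP; split => // t _.
  exists (\max_(k < n) Num.bound `|tnth t k : R|) => // k.
  rewrite (le_trans (ltW (archi_boundP _))) // ler_nat.
  exact: (leq_bigmax k).
rewrite (eq_bigr (fun i => rip ip (v i) (D i))); last first.
  by move=> i _; rewrite ripC; have [_ ->] := vP i.
apply: (ler_cvg_to cv (cvg_cst _)); apply: nearW => m /=.
under eq_bigr do rewrite ripC.
apply: (duhamel_bounded (r' := m%:R)) r0 _ a0 gr _ _ hB => // i.
  by rewrite (pvm_idem HY).
by rewrite (le_trans (pvm_le Hip HY _ _)) //; have [] := vP i.
Qed.

End Duhamel.

(** * Lattice exponentials in L^2 and Bessel families *)

Section TrigonometricOrthogonality.
Context {R : realType}.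
Implicit Types (a b k x : R).

Lemma sin_int_pi (m : int) : sin (m%:~R * pi) = 0 :> R.
Proof.
have nat_pi p : sin (p%:R * pi) = 0 :> R.
  elim: p => [|p IH]; first by rewrite mul0r sin0.
  by rewrite -natr1 mulrDl mul1r sinDpi IH oppr0.
case: m => p; first by rewrite nat_pi.
by rewrite NegzE mulrNz mulNr sinN nat_pi oppr0.
Qed.

Lemma is_derive_trig a b k x : is_derive x 1 (fun y => a * cos (k * y) + b * sin (k * y))
  (k * b * cos (k * x) - k * a * sin (k * x)).
Proof.
have dk : is_derive x 1 (fun y : R => k * y) k.
  by apply: (is_derive_eq (is_deriveZ k (is_derive_id x 1))); rewrite /GRing.scale /= mulr1.
have dc : is_derive x 1 (cos \o (fun y => k * y)) (- sin (k * x) * k).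
  exact: is_derive1_comp.
have ds : is_derive x 1 (sin \o (fun y => k * y)) (cos (k * x) * k).
  exact: is_derive1_comp.
have := is_deriveD (is_deriveZ a dc) (is_deriveZ b ds) => D.
by apply: (is_derive_eq D); rewrite /GRing.scale /=; ring.
Qed.

Lemma is_derive_sum_seq I (r : seq I) (F : I -> R -> R) (f : I -> R) x :
  (forall i, is_derive x 1 (F i) (f i)) ->
  is_derive x 1 (fun y => \sum_(i <- r) F i y) (\sum_(i <- r) f i).
Proof.
move=> dF; elim: r => [|i r IH].
  under eq_fun do rewrite big_nil; rewrite big_nil; exact: is_derive_cst.
under eq_fun do rewrite big_cons; rewrite big_cons; exact: is_deriveD.
Qed.

Lemma FTC2_everywhere (f F f' : R -> R) a b : a < b ->
  (forall x, is_derive x 1 F (f x)) -> (forall x, is_derive x 1 f (f' x)) ->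
  (\int[lebesgue_measure]_(x in `[a, b]) (f x)%:E = (F b - F a)%:E)%E.
Proof.
move=> ab dF df.
have cF x : F y @[y --> x] --> F x.
  by apply: differentiable_continuous; apply/derivable1_diffP; have := dF x => ?; exact: ex_derive.
rewrite EFinB; apply: continuous_FTC2 => //.
- apply: derivable_within_continuous => x _; have := df x => ?; exact: ex_derive.
- split => [x _||]; first by have := dF x => ?; exact: ex_derive.
    exact/cvg_at_right_filter/cF.
  exact/cvg_at_left_filter/cF.
- by move=> x _; rewrite derive1E; have := dF x => ?; exact: derive_val.
Qed.

(* The exponentials exp(i k x / N), k an integer, are orthogonal on [-pi N, pi N]. *)
Lemma circle_parseval (J : eqType) (s : seq J) (k : J -> int) (c : J -> R[i]) (N : nat)
    (r : R := N%:R * pi) : (0 < N)%N -> uniq s -> {in s &, injective k} ->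
  (\int[lebesgue_measure]_(x in `[(- r)%R, r])
     (normc (\sum_(w <- s) c w * expi ((k w)%:~R * x / N%:R)) ^+ 2)%R%:E =
   (2 * r * \sum_(w <- s) normc (c w) ^+ 2)%R%:E)%E.
Proof.
move=> N0 us kinj.
have Np : 0 < N%:R :> R by rewrite ltr0n.
have r0 : 0 < r by rewrite mulr_gt0 // pi_gt0.
pose g w v : R[i] := c w * Num.conj (c v).
pose q w v : R := (k w - k v)%:~R / N%:R.
pose f w v x := complex.Re (g w v) * cos (q w v * x) + - complex.Im (g w v) * sin (q w v * x).
(* F w v is an antiderivative of f w v. Off the diagonal its cosine part is even and its sine part
   vanishes at - r and r, integer multiples of pi after scaling; so only the diagonal
   contributes. *)
pose F w v x := if k w == k v then complex.Re (g w v) * x else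
  ((q w v)^-1 * complex.Im (g w v)) * cos (q w v * x) +
  ((q w v)^-1 * complex.Re (g w v)) * sin (q w v * x).
have fE x : normc (\sum_(w <- s) c w * expi ((k w)%:~R * x / N%:R)) ^+ 2 =
    \sum_(w <- s) \sum_(v <- s) f w v x.
  have -> (z : R[i]) : normc z ^+ 2 = complex.Re (z * Num.conj z).
    by rewrite sqr_normcE ReM Re_conj Im_conj; ring.
  rewrite rmorph_sum mulr_suml Re_sum; apply: eq_bigr => w _.
  rewrite mulr_sumr Re_sum; apply: eq_bigr => v _.
  rewrite rmorphM /= conj_expi mulrACA -expiD ReM /= /f mulNr; congr (_ * cos _ - _ * sin _);
    by rewrite /q rmorphB /=; ring.
have q0 w v : k w != k v -> q w v != 0.
  move=> kwv; apply: mulf_neq0; first by rewrite intr_eq0 subr_eq0.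
  by rewrite invr_eq0 gt_eqF.
have dF w v x : is_derive x 1 (F w v) (f w v x).
  rewrite /F; case: eqVneq => [kwv|kwv].
    rewrite /f /q kwv subrr mul0r mul0r cos0 sin0 mulr0 addr0 mulr1.
    by apply: (is_derive_eq (is_deriveZ _ (is_derive_id x 1))); rewrite /GRing.scale /= mulr1.
  apply: (is_derive_eq (is_derive_trig _ _ _ _)); rewrite /f.
  by rewrite !mulrA divff ?q0 // !mul1r mulNr.
have -> : (fun x => (normc (\sum_(w <- s) c w * expi ((k w)%:~R * x / N%:R)) ^+ 2)%:E) =
    (fun x => (\sum_(w <- s) \sum_(v <- s) f w v x)%:E).
  by apply/funext => x; rewrite fE.
have D1 x : is_derive x 1 (fun x => \sum_(w <- s) \sum_(v <- s) F w v x)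
    (\sum_(w <- s) \sum_(v <- s) f w v x).
  by apply: is_derive_sum_seq => w; apply: is_derive_sum_seq => v; exact: dF.
have D2 x : is_derive x 1 (fun x => \sum_(w <- s) \sum_(v <- s) f w v x)
    (\sum_(w <- s) \sum_(v <- s) (q w v * - complex.Im (g w v) * cos (q w v * x) -
     q w v * complex.Re (g w v) * sin (q w v * x))).
  by apply: is_derive_sum_seq => w; apply: is_derive_sum_seq => v; exact: is_derive_trig.
rewrite (FTC2_everywhere _ D1 D2) ?gtrN //.
congr (_%:E); rewrite -sumrB mulr_sumr big_seq [RHS]big_seq; apply: eq_bigr => w ws.
rewrite -sumrB (bigD1_seq w) //= big_seq_cond big1 => [|v /andP[vs vw]].
  by rewrite addr0 /F eqxx sqr_normcE /g ReM Re_conj Im_conj; ring.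
have kwv : k w != k v.
  by apply/negP => /eqP /(kinj _ _ ws vs) wv; rewrite wv eqxx in vw.
have qr : q w v * r = (k w - k v)%:~R * pi.
  by rewrite /q /r; field; rewrite gt_eqF.
by rewrite /F (negbTE kwv) !mulrN cosN sinN qr sin_int_pi oppr0 !mulr0 subrr.
Qed.

End TrigonometricOrthogonality.

Lemma sigma_finite_product (R : realType) d1 d2 (T1 : measurableType d1)
    (T2 : measurableType d2) (m1 : {sigma_finite_measure set T1 -> \bar R})
    (m2 : {sigma_finite_measure set T2 -> \bar R}) :
  sigma_finite setT (m1 \x m2)%E.
Proof.
have /sigma_finiteP[F [TF ndF Foo]] := sigma_finiteT m1.
have /sigma_finiteP[G [TG ndG Goo]] := sigma_finiteT m2.
exists (fun i => F i `*` G i) => [|i]; last first.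
  have [mF Fi] := Foo i; have [mG Gi] := Goo i.
  split; first exact: measurableX.
  by rewrite product_measure1E// lte_mul_pinfty// ge0_fin_numE.
apply/seteqP; split => // -[x y] _.
have [j _ Fx] : (\bigcup_i F i) x by rewrite -TF.
have [k _ Gy] : (\bigcup_i G i) y by rewrite -TG.
exists (maxn j k) => //; split.
  by move/subsetPset : (ndF _ _ (leq_maxl j k)); exact.
by move/subsetPset : (ndG _ _ (leq_maxr j k)); exact.
Qed.

(** * Lebesgue measure on tuples and Parseval's identity on a cube *)

Section LebesgueTuple.
Context {R : realType}.
Local Notation mR := (measurableTypeR R).

Definition tuple_cons n (p : mR * n.-tuple mR) : n.+1.-tuple mR := [tuple of p.1 :: p.2].

Lemma measurable_tuple_cons n : measurable_fun setT (@tuple_cons n).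
Proof. exact: measurable_cons. Qed.

Definition int_form n (N : nat) (w : n.-tuple int) (t : n.-tuple mR) : R :=
  \sum_(j < n) (tnth w j)%:~R * (tnth t j : R) / N%:R.

Lemma int_form_cons n N (w : n.+1.-tuple int) (p : mR * n.-tuple mR) :
  int_form N w (tuple_cons p) =
  (thead w)%:~R * (p.1 : R) / N%:R + int_form N [tuple of behead w] p.2.
Proof.
rewrite /int_form big_ord_recl; congr (_ * _ / _ + _).
  by apply: eq_bigr => j _; rewrite {1}(tuple_eta w) !tnthS.
Qed.

Definition trig_square n (s : seq (n.-tuple int)) (c : n.-tuple int -> R[i]) N t : R :=
  normc (\sum_(w <- s) c w * expi (int_form N w t)) ^+ 2.

Lemma trig_square_ge0 n s c N (t : n.-tuple mR) : 0 <= trig_square s c N t.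
Proof. exact: sqr_ge0. Qed.

Lemma measurable_sqr_normc_expi_sum d (T : measurableType d) (W : Type) (s : seq W)
    (c : W -> R[i]) (f : W -> T -> R) :
  (forall w, measurable_fun setT (f w)) ->
  measurable_fun setT (fun t => normc (\sum_(w <- s) c w * expi (f w t)) ^+ 2).
Proof.
move=> mf; under eq_fun do rewrite sqr_normcE Re_sum Im_sum.
have mc w := measurableT_comp (continuous_measurable_fun (@continuous_cos R)) (mf w).
have ms w := measurableT_comp (continuous_measurable_fun (@continuous_sin R)) (mf w).
apply: measurable_funD; apply: measurable_funX; apply: measurable_sum => w.
  under eq_fun do rewrite ReM.
  by apply: measurable_funB; (apply: measurable_funM; [exact: measurable_cst|]);
    [exact: mc|exact: ms].
under eq_fun do rewrite ImM.
by apply: measurable_funD; (apply: measurable_funM; [exact: measurable_cst|]);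
  [exact: ms|exact: mc].
Qed.

Lemma measurable_trig_square n s c N : measurable_fun setT (@trig_square n s c N).
Proof.
apply: measurable_sqr_normc_expi_sum => w.
apply: measurable_sum => j; apply: measurable_funM; last exact: measurable_cst.
by apply: measurable_funM; [exact: measurable_cst|exact: measurable_tnth].
Qed.

Lemma sum_by_class (T T' : eqType) (V : nmodType) (s : seq T) (p : T -> T') (F : T -> V) :
  \sum_(w <- s) F w = \sum_(v <- undup (map p s)) \sum_(w <- s | p w == v) F w.
Proof.
under [RHS]eq_bigr do rewrite big_mkcond; rewrite exchange_big /=.
rewrite big_seq [RHS]big_seq; apply: eq_bigr => w ws.
rewrite -big_mkcond (eq_bigl (fun v => v == p w)) => [|v]; last by rewrite eq_sym.
rewrite -big_filter filter_pred1_uniq ?undup_uniq ?big_seq1//.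
by rewrite mem_undup map_f.
Qed.

(** A property of the measure, so that it can be carried through the same induction on n as the
    construction of the measure. *)
Definition parseval n (la : set (n.-tuple mR) -> \bar R) := forall N s c,
  (0 < N)%N -> uniq s ->
  (\int[la]_(t in cube (N%:R * pi)%R) (trig_square s c N t)%:E =
   ((2 * (N%:R * pi)) ^+ n * \sum_(w <- s) normc (c w) ^+ 2)%R%:E)%E.

Section ConsMeasure.
Context {n : nat} (la : {sigma_finite_measure set (n.-tuple mR) -> \bar R}).

(** [lebesgue_measure_tuple] is a mere set function, while Tonelli and Radon-Nikodym need a measure;
    this one agrees with it on measurable sets by [cons_measureE]. *)
Definition cons_measure : set (n.+1.-tuple mR) -> \bar R :=
  pushforward ((@lebesgue_measure R) \x la)%E (@tuple_cons n).

Let cons_measure0 : cons_measure set0 = 0%E.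
Proof. by rewrite /cons_measure /pushforward preimage_set0 measure0. Qed.

Let cons_measure_ge0 A : (0 <= cons_measure A)%E.
Proof. by rewrite /cons_measure /pushforward; exact: measure_ge0. Qed.

Let mpre (A : set (n.+1.-tuple mR)) : measurable A -> measurable (@tuple_cons n @^-1` A).
Proof. by move=> mA; rewrite -[X in measurable X]setTI; exact: measurable_tuple_cons. Qed.

Let cons_measure_sigma_additive : semi_sigma_additive cons_measure.
Proof.
move=> F mF tF mUF; rewrite /cons_measure /pushforward preimage_bigcup.
apply: measure_semi_sigma_additive.
- by move=> i; exact: mpre.
- apply/trivIsetP => /= i j _ _ ij; rewrite -preimage_setI.
  by move/trivIsetP : tF => /(_ _ _ _ _ ij) ->//; rewrite preimage_set0.
- by rewrite -preimage_bigcup; exact: mpre.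
Qed.

HB.instance Definition _ := isMeasure.Build _ _ _ cons_measure cons_measure0
  cons_measure_ge0 cons_measure_sigma_additive.

Let cons_measure_sigma_finite : sigma_finite setT cons_measure.
Proof.
have [F TF mF] := sigma_finite_product (@lebesgue_measure R) la.
pose u (t : n.+1.-tuple mR) : mR * n.-tuple mR := (thead t, [tuple of behead t]).
have mu : measurable_fun setT u.
  by apply: measurable_fun_pair; [exact: measurable_tnth|exact: measurable_behead].
have uc p : u (tuple_cons p) = p.
  by case: p => x t; rewrite /u /tuple_cons /= theadE; congr (_, _); apply: val_inj.
exists (fun i => u @^-1` F i).
  apply/seteqP; split => // t _; have : setT (u t) by [].
  by rewrite TF => -[i _ Fi]; exists i.
move=> i; have [mFi Foo] := mF i; split.
  by rewrite -[X in measurable X]setTI; exact: mu.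
rewrite /cons_measure /pushforward (_ : _ @^-1` _ = F i) //.
by apply/seteqP; split => p /=; rewrite uc.
Qed.

HB.instance Definition _ := Measure_isSigmaFinite.Build _ _ _ cons_measure
  cons_measure_sigma_finite.

Lemma cons_measureE : (forall A, measurable A -> la A = lebesgue_measure_tuple A) ->
  forall A, measurable A -> cons_measure A = lebesgue_measure_tuple A.
Proof.
move=> laE A mA; rewrite /cons_measure /pushforward /= /product_measure1.
apply: eq_integral => x _ /=.
have E : xsection (@tuple_cons n @^-1` A) x = [set t : n.-tuple _ | A [tuple of x :: t]].
  by apply/seteqP; split => t; rewrite /xsection /= inE.
by rewrite E laE // -E; exact: measurable_xsection (mpre mA).
Qed.

(** Tonelli: for a fixed first coordinate x, grouping the w by their tails gives a trigonometric sum
    in n variables with coefficients cv x v. Parseval in these variables leaves the squares of the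
    cv x v, sums of exponentials in x whose frequencies are distinct since heads differ when tails
    agree. *)
Lemma cons_parseval : parseval la -> parseval cons_measure.
Proof.
move=> P N s c N0 us; set r := (N%:R * pi)%R.
set f := trig_square s c N.
have mf : measurable_fun setT f by exact: measurable_trig_square.
have r0 : 0 <= r by rewrite mulr_ge0 // pi_ge0.
have mC : measurable (cube r : set (n.+1.-tuple mR)) by exact: measurable_cube.
rewrite ge0_integral_pushforward //; last 3 first.
- exact: measurable_tuple_cons.
- exact/measurable_EFinP/measurable_funTS.
- by move=> t _; rewrite lee_fin trig_square_ge0.
pose g (p : mR * n.-tuple mR) : R := f (tuple_cons p).
have mg : measurable_fun setT g by exact: (measurableT_comp mf (@measurable_tuple_cons n)).
rewrite integral_mkcond fubini_tonelli1; last 2 first.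
- apply/(measurable_restrictT _ (mpre mC)); apply: measurable_funTS.
  exact/measurable_EFinP.
- by move=> p; apply: erestrict_ge0 => q _; rewrite lee_fin trig_square_ge0.
pose tl (w : n.+1.-tuple int) : n.-tuple int := [tuple of behead w].
pose cv x v := \sum_(w <- s | tl w == v) c w * expi ((thead w)%:~R * x / N%:R).
have gE x t : g (x, t) = trig_square (undup (map tl s)) (cv x) N t.
  rewrite /g /f /trig_square; congr (normc _ ^+ 2).
  rewrite (sum_by_class _ tl); apply: eq_bigr => v _; rewrite /cv mulr_suml.
  apply: eq_bigr => w /eqP <-; rewrite int_form_cons expiD mulrA //.
pose K := (2 * r) ^+ n.
have K0 : 0 <= K by rewrite exprn_ge0 // mulr_ge0.
have inner x : fubini_F la ((EFin \o f \o @tuple_cons n) \_ (@tuple_cons n @^-1` cube r)) x =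
    ((fun x => (K * \sum_(v <- undup (map tl s)) normc (cv x v) ^+ 2)%:E) \_ `[(- r)%R, r]) x.
  rewrite /fubini_F /patch; case: ifPn => xr.
    rewrite -(P N _ (cv x) N0 (undup_uniq _)) [RHS]integral_mkcond.
    apply: eq_integral => t _; rewrite /patch.
    have -> : ((x, t) \in @tuple_cons n @^-1` cube r) = (t \in cube r).
      apply/idP/idP; rewrite !inE /= => h j; first by have := h (lift ord0 j); rewrite /tuple_cons tnthS.
      case: (unliftP ord0 j) => [k ->|->]; first by rewrite /tuple_cons tnthS.
      by move: xr; rewrite inE /= in_itv /= ler_norml.
    by case: ifP => // _; rewrite -gE.
  apply: integral0_eq => t _; case: ifPn => //; rewrite inE /= => /(_ ord0) h.
  by move: xr; rewrite notin_setE /= in_itv /= -ler_norml.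
under eq_integral do rewrite inner.
rewrite -integral_mkcond.
under eq_integral do rewrite mulr_sumr -sumEFin.
have mcv v : measurable_fun setT (fun x : mR => K * normc (cv x v) ^+ 2).
  apply: measurable_funM; first exact: measurable_cst.
  rewrite /cv; under eq_fun do rewrite -big_filter.
  apply: measurable_sqr_normc_expi_sum => w.
  apply: measurable_funM; last exact: measurable_cst.
  by apply: measurable_funM; first exact: measurable_cst.
rewrite ge0_integral_sum //; last 2 first.
- by move=> v; apply/measurable_EFinP/measurable_funTS; exact: mcv.
- by move=> v x _; rewrite lee_fin mulr_ge0 // sqr_ge0.
have int_cv v : (\int[lebesgue_measure]_(x in `[(- r)%R, r]) (K * normc (cv x v) ^+ 2)%:E =
    (K * (2 * r * \sum_(w <- s | tl w == v) normc (c w) ^+ 2))%R%:E)%E.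
  under eq_integral do rewrite EFinM.
  rewrite ge0_integralZl //; last 2 first.
  - apply/measurable_EFinP/measurable_funTS.
    rewrite /cv; under eq_fun do rewrite -big_filter.
    apply: measurable_sqr_normc_expi_sum => w.
    apply: measurable_funM; last exact: measurable_cst.
    by apply: measurable_funM; first exact: measurable_cst.
  - by move=> x _; rewrite lee_fin sqr_ge0.
  rewrite EFinM -[in RHS]big_filter -(circle_parseval (k := fun w : n.+1.-tuple int => thead w)) ?filter_uniq //.
    by congr (_ * _)%E; apply: eq_integral => x _; rewrite /cv -big_filter.
  move=> w w'; rewrite !mem_filter => /andP[/eqP wv _] /andP[/eqP w'v _] ww'.
  by rewrite (tuple_eta w) (tuple_eta w'); apply/val_inj; rewrite /= ww';
    have /(congr1 val) /= -> : tl w = tl w' by rewrite wv w'v.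
under eq_bigr do rewrite int_cv; rewrite sumEFin; congr (_%:E).
rewrite -!mulr_sumr -(sum_by_class _ tl) mulrA exprSr //.
Qed.

End ConsMeasure.

Lemma parseval_tuple0 : @parseval 0 (\d_[tuple] : set (0.-tuple mR) -> \bar R).
Proof.
move=> N s c N0 us; rewrite integral_dirac; last 2 first.
- exact: measurable_cube.
- by apply/measurable_EFinP/measurable_funTS; exact: measurable_trig_square.
rewrite diracE mem_set ?mul1e; last by case.
congr (_%:E); rewrite expr0 mul1r /trig_square.
have -> : \sum_(w <- s) c w * expi (int_form N w [tuple]) = \sum_(w <- s) c w.
  by apply: eq_bigr => w _; rewrite /int_form big_ord0 expi0 mulr1.
case: s us => [|w [|v s]]; rewrite ?big_nil ?big_seq1 //.
  by rewrite ComplexField.Normc.normc0 expr0n.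
by rewrite cons_uniq (tuple0 w) (tuple0 v) mem_head.
Qed.

Lemma lebesgue_tuple_exists n : exists la : {sigma_finite_measure set (n.-tuple mR) -> \bar R},
  (forall A, measurable A -> la A = lebesgue_measure_tuple A) /\ parseval la.
Proof.
elim: n => [|n [la [laE laP]]].
  by exists (\d_[tuple] : {sigma_finite_measure set (0.-tuple mR) -> \bar R}); split => //; exact: parseval_tuple0.
exists (cons_measure la : {sigma_finite_measure set (n.+1.-tuple mR) -> \bar R}).
by split; [exact: cons_measureE|exact: cons_parseval].
Qed.

End LebesgueTuple.

(** * Bessel bounds for spectral measures with bounded density *)

Section Bessel.
Context {R : realType} {H : completeNormedModType R[i]} {ip : {dot H for Num.conj}}.
Context {n : nat}.
Local Notation Rn := (n.-tuple (measurableTypeR R)).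
Variables (Hip : inner_product_of_norm ip).
Variables (E : set Rn -> H -> H) (HE : projection_valued_measure ip E).
Local Notation U := (exp_i ip E).
Local Notation mu := (spectral_measure Hip HE).
Variable la : {sigma_finite_measure set Rn -> \bar R}.

Definition mesh (N : nat) (w : 'rV[int]_n) : 'rV[R]_n := N%:R^-1 *: map_mx intr w.

Let tup (w : 'rV[int]_n) : n.-tuple int := [tuple w ord0 j | j < n].
Let untup (v : n.-tuple int) : 'rV[int]_n := \row_j tnth v j.

Let tupK : cancel tup untup.
Proof. by move=> w; apply/rowP => j; rewrite mxE tnth_mktuple. Qed.

Let linear_form_mesh N w t : linear_form (mesh N w) t = int_form N (tup w) t.
Proof.
rewrite /linear_form /int_form; apply: eq_bigr => j _.
by rewrite /mesh !mxE tnth_mktuple [RHS]mulrC [RHS]mulrA.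
Qed.

Lemma calculus_sum I (s : seq I) (c : I -> R[i]) (xi : I -> 'rV[R]_n) :
  is_calculus (E := E) (fun t => \sum_(w <- s) c w * expi (linear_form (xi w) t))
    (fun h => \sum_(w <- s) c w *: U (xi w) h).
Proof.
elim: s => [|w s IH].
  move: (calculusZ 0 (exp_i_calculus Hip HE 0)); congr (is_calculus _ _).
    by apply/funext => t; rewrite big_nil mul0r.
  by apply/funext => h; rewrite big_nil scale0r.
move: (calculusD (calculusZ (c w) (exp_i_calculus Hip HE (xi w))) IH).
by congr (is_calculus _ _); apply/funext => t; rewrite big_cons.
Qed.

Lemma bounded_expi_sum I (s : seq I) (c : I -> R[i]) (xi : I -> 'rV[R]_n) :
  bounded_measC (fun t : Rn => \sum_(w <- s) c w * expi (linear_form (xi w) t)).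
Proof.
elim: s => [|w s IH]; first by under eq_fun do rewrite big_nil; exact: bounded_measC_cst.
under eq_fun do rewrite big_cons; apply: bounded_measCD => //.
by apply: bounded_measCM; [exact: bounded_measC_cst|exact: bounded_expi].
Qed.

Lemma spectral_measure_exp_i xi g A : measurable A -> mu (U xi g) A = mu g A.
Proof. by move=> mA; rewrite /spectral_measure -(exp_i_pvm Hip HE) // (nrm_exp_i Hip HE). Qed.

Lemma pvm_setC0 A g : measurable A -> E A g = g -> E (~` A) g = 0.
Proof.
move=> mA <-; apply: (pvm_orth Hip HE) => //; first exact: measurableC.
exact: setICl.
Qed.

Hypothesis laP : parseval la.

Section Dominated.
Variables (N : nat) (s : seq 'rV[int]_n) (g : H) (r C : R).
Hypotheses (N0 : (0 < N)%N) (us : uniq s) (rN : r <= N%:R * pi) (C0 : 0 <= C).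
Hypotheses (gr : E (cube r) g = g).
Hypothesis gC : forall A, measurable A -> (mu g A <= C%:E * la A)%E.

(** The spectral measure of g lives on the cube of side 2 N pi, a common period cell of the
    exponentials, and is dominated there by C times Lebesgue measure; Parseval on that cube gives
    the bound. *)
Lemma sqr_nrm_mesh_sum (c : 'rV[int]_n -> R[i]) :
  nrm (\sum_(w <- s) c w *: U (mesh N w) g) ^+ 2 <=
    C * (2 * (N%:R * pi)) ^+ n * \sum_(w <- s) normc (c w) ^+ 2.
Proof.
rewrite (sqr_nrm_calculus Hip HE g (bounded_expi_sum s c (mesh N)) (calculus_sum s c (mesh N))).
set D := C * _ ^+ n; pose f := trig_square (map tup s) (c \o untup) N : Rn -> R.
under eq_Rintegral => t _.
  rewrite (_ : normc _ ^+ 2 = f t); last first.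
    rewrite /f /trig_square big_map; congr (normc _ ^+ 2).
    by apply: eq_bigr => w _; rewrite /= tupK linear_form_mesh.
  over.
have mf : measurable_fun setT (EFin \o f) by apply/measurable_EFinP; exact: measurable_trig_square.
have f0 t : (0 <= (f t)%:E)%E by rewrite lee_fin trig_square_ge0.
have mC : measurable (cube (N%:R * pi) : set Rn) by exact: measurable_cube.
have gN : E (cube (N%:R * pi)) g = g.
  rewrite -{1}gr (pvm_setI Hip HE) ?measurable_cube //; last exact: measurable_cube.
  rewrite (_ : _ `&` _ = cube r) //; apply/seteqP; split => [t [] //|t tr].
  by split => // j; apply: le_trans rN.
have le_D : (\int[mu g]_t (f t)%:E <= (D * \sum_(w <- s) normc (c w) ^+ 2)%:E)%E.
  rewrite (ge0_negligible_integral (N := ~` cube (N%:R * pi))) //; last 2 first.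
  - exact: measurableC.
  - by rewrite /= /spectral_measure [E _ g]pvm_setC0 // nrm0 expr0n.
  rewrite setTD setCK.
  apply: (@le_trans _ _ (\int[mscale (NngNum C0) la]_(t in cube (N%:R * pi)) (f t)%:E)%E).
    by apply: ge0_le_measure_integral => // A mA; exact: gC.
  rewrite ge0_integral_mscale //; last exact: measurable_funTS.
  rewrite laP //; last by rewrite map_inj_uniq //; exact: can_inj tupK.
  rewrite /= -EFinM lee_fin big_map /D -mulrA ler_wpM2l // ler_wpM2l //.
    by rewrite exprn_ge0 // !mulr_ge0 // pi_ge0.
  by apply: ler_sum => w _; rewrite /= tupK.
rewrite /Rintegral -lee_fin fineK // ge0_fin_numE; last exact: integral_ge0.
exact: le_lt_trans le_D (ltry _).
Qed.

(** Dual form of [sqr_nrm_mesh_sum]. With the conjugate pairings as coefficients, S is the pairing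
    of F with e, so S ^+ 2 is at most D * S * nrm e ^+ 2, and S cancels. *)
Lemma mesh_bessel e :
  \sum_(w <- s) normc (ip (U (mesh N w) g) e) ^+ 2 <= C * (2 * (N%:R * pi)) ^+ n * nrm e ^+ 2.
Proof.
set D := C * _ ^+ n; set S := \sum_(w <- s) _.
have S0 : 0 <= S by apply: sumr_ge0 => w _; exact: sqr_ge0.
pose c w := Num.conj (ip (U (mesh N w) g) e).
pose F := \sum_(w <- s) c w *: U (mesh N w) g.
have FS : nrm F ^+ 2 <= D * S.
  by apply: (le_trans (sqr_nrm_mesh_sum c)); rewrite /c; under eq_bigr do rewrite normc_conj.
have SF : S = rip ip F e.
  rewrite /rip ip_suml Re_sum; apply: eq_bigr => w _.
  by rewrite ipZl /c mulrC ReM Re_conj Im_conj sqr_normcE -!expr2 mulrN opprK.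
have D0 : 0 <= D by rewrite mulr_ge0 // exprn_ge0 // !mulr_ge0 // pi_ge0.
have [->|Sn0] := eqVneq S 0; first by rewrite mulr_ge0 // sqr_ge0.
have Sp : 0 < S by rewrite lt_neqAle eq_sym Sn0.
rewrite -(ler_pM2l Sp) -expr2.
apply: (@le_trans _ _ ((nrm F * nrm e) ^+ 2)).
  rewrite lerXn2r ?nnegrE ?mulr_ge0 ?nrm_ge0 // SF; exact: rip_le.
by rewrite exprMn [leRHS]mulrA [S * D]mulrC ler_wpM2r // sqr_ge0.
Qed.

End Dominated.

Hypothesis laE : forall A, measurable A -> la A = lebesgue_measure_tuple A.

(** With f the Radon-Nikodym density of the spectral measure of h, the vector g m is the part of h
    on the set where f <= m inside the cube of radius m; these sets exhaust the space because f is
    finite. *)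
Lemma ac_approximation h : lebesgue_ac_subspace ip E h -> exists g : nat -> H,
  g m @[m --> \oo] --> h /\ forall m, E (cube m%:R) (g m) = g m /\
    forall A, measurable A -> (mu (g m) A <= m%:R%:E * la A)%E.
Proof.
move=> hac; have hla : mu h `<< la.
  apply/null_content_dominatesP => A mA A0; rewrite -(spectral_distE Hip HE) //.
  apply: (hac A) => // B mB BA; rewrite -laE //; apply/eqP; rewrite eq_le measure_ge0 andbT.
  by rewrite -A0 le_measure ?inE.
have [f [f0 ffin fint fE]] := radon_nikodym_sigma_finite hla.
have mf : measurable_fun setT f by case/integrableP: fint.
pose B m : set Rn := f @^-1` [set x | x <= m%:R%:E]%E `&` cube m%:R.
have mB m : measurable (B m).
  apply: measurableI; last exact: measurable_cube.
  rewrite -[X in measurable X]setTI (_ : [set x | _] = `]-oo, m%:R%:E]%classic).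
    by apply: mf => //; exact: emeasurable_itv.
  by apply/seteqP; split => x /=; rewrite in_itv.
exists (fun m => E (B m) h); split.
  apply: (pvm_cvg_inc Hip HE) => // [m k mk t [fm tm]|].
    split; first by apply: (le_trans fm); rewrite lee_fin ler_nat.
    by move=> j; apply: le_trans (tm j) _; rewrite ler_nat.
  apply/seteqP; split => // t _.
  pose x := fine (f t) + \sum_j `|tnth t j : R|.
  have s0 : 0 <= \sum_j `|tnth t j : R| by apply: sumr_ge0.
  have ft0 : 0 <= fine (f t) by exact: fine_ge0.
  exists (Num.bound x) => //.
  have xb : x <= (Num.bound x)%:R by apply/ltW/archi_boundP; rewrite addr_ge0.
  split; first by rewrite /= -(fineK (ffin t)) lee_fin (le_trans _ xb) // lerDl.
  move=> j; apply: le_trans xb; rewrite /x (bigD1 j) //= addrCA lerDl addr_ge0 //.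
  exact: sumr_ge0.
move=> m; split.
  rewrite (pvm_setI Hip HE) //; last exact: measurable_cube.
  by congr (E _ h); apply/seteqP; split => t; [case|case=> ? ?; split].
move=> A mA; have mAB := measurableI _ _ mA (mB m).
have -> : mu (E (B m) h) A = mu h (A `&` B m).
  by rewrite /spectral_measure (pvm_setI Hip HE).
rewrite fE //; apply: (@le_trans _ _ (\int[la]_(t in A `&` B m) (cst m%:R%:E t))%E).
  apply: ge0_le_integral => //; first exact: measurable_funTS.
  by move=> t [_ [? _]].
rewrite integral_cst //; apply: lee_wpmul2l => //.
by apply: le_measure; rewrite ?inE //; exact: subIsetl.
Qed.

End Bessel.

(** * Wave operators *)

Section SingularSums.
Context {R : realType} {H : completeNormedModType R[i]} {ip : {dot H for Num.conj}}.
Hypothesis Hip : inner_product_of_norm ip.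

(** Cauchy-Schwarz, read off from the nonnegativity of the sum of the (m * a i - A) ^+ 2 with m the
    length of l. *)
Lemma sum_le_sqrt I (l : seq I) (a : I -> R) : (forall i, 0 <= a i) ->
  \sum_(i <- l) a i <= Num.sqrt ((size l)%:R * \sum_(i <- l) a i ^+ 2).
Proof.
move=> a0; set A := \sum_(i <- l) a i; set Q := \sum_(i <- l) a i ^+ 2.
have A0 : 0 <= A by exact: sumr_ge0.
rewrite -[leLHS]ger0_norm // -sqrtr_sqr; apply: ler_wsqrtr.
case: l @A @Q A0 => [|i0 l'] A Q A0; first by rewrite /A big_nil expr0n mul0r.
set l := i0 :: l' in A Q A0 *; pose m : R := (size l)%:R.
have m0 : 0 < m by rewrite ltr0n.
have mE : m = (size l)%:R by [].
have : 0 <= \sum_(i <- l) (m * a i - A) ^+ 2 by apply: sumr_ge0 => i _; exact: sqr_ge0.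
have -> : \sum_(i <- l) (m * a i - A) ^+ 2 = m * (m * Q - A ^+ 2).
  have sqrE i : (m * a i - A) ^+ 2 = m ^+ 2 * a i ^+ 2 - 2 * m * A * a i + A ^+ 2.
    by move: m A {m0 A0 mE} => m A; ring.
  rewrite (eq_bigr _ (fun i _ => sqrE i)).
  rewrite big_split sumrB /= -!mulr_sumr -/A -/Q big_const_seq count_predT iter_addr_0.
  by rewrite -[A *+ size l]mulr_natl -mE; move: m A Q {sqrE A0 mE m0} => m A Q; ring.
by rewrite pmulr_rge0 // subr_ge0.
Qed.

Section OneOperator.
Variables (K : H -> H) (s : R^nat).
Hypotheses (cK : compact_operator K) (sK : singular_values ip K s).

(* P projects onto the first 2 ^ q singular vectors: K \o P is controlled by the Bessel bound, and
   K - K \o P has norm at most s (2 ^ q). *)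
Lemma compact_sum_le q (D G : R) I (l : seq I) (x : I -> H) : 0 <= D -> 
  (forall i, nrm (x i) <= G) -> size l = (2 ^ q)%N ->
  (forall e, \sum_(i <- l) normc (ip (x i) e) ^+ 2 <= D * nrm e ^+ 2) ->
  \sum_(i <- l) nrm (K (x i)) <=
    2 ^+ q * (Num.sqrt (D + G ^+ 2) * Num.sqrt ((\sum_(0 <= j < 2 ^ q) s j ^+ 2) / 2 ^+ q)).
Proof.
move=> D0 xG sz xD; have [snoninc s0 _] := sK; have [linK _] := cK.
have [e [M [Ms eo e1 eK Ks]]] := singular_vectors Hip cK sK.
pose N := (2 ^ q)%N; pose P x := \sum_(i < N) ip x (e i) *: e i.
have PE g (j : 'I_N) : ip (g - P g) (e j) = 0.
  rewrite ipDl ipNl ip_suml (bigD1 j) //= big1 => [|i ij]; last by rewrite ipZl eo ?mulr0.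
  by rewrite addr0 ipZl; have [_ ->] := e1 j; rewrite subrr.
have PE' g (j : 'I_N) : ip (e j) (g - P g) = 0 by rewrite (ipC ip) PE conjC0.
have KPE g k : ip (K (P g)) (K k) = \sum_(i < N) ip g (e i) * (M i ^+ 2)%:C * ip (e i) k.
  rewrite lin_sum // ip_suml; apply: eq_bigr => i _.
  by rewrite linZ // ipZl eK mulrA.
(* The e i are eigenvectors of K^* K, so K maps P g and g - P g to orthogonal vectors. *)
have perp g : ip (K (P g)) (K (g - P g)) = 0.
  rewrite KPE big1 // => i _.
  by rewrite PE' mulr0.
have perp1 g : ip (P g) (g - P g) = 0.
  rewrite ip_suml big1 // => i _; by rewrite ipZl PE' mulr0.
have split_nrm g : nrm (g - P g) <= nrm g.
  rewrite -(@ler_pXn2r _ 2) ?nnegrE ?nrm_ge0 //.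
  have -> : nrm g = nrm (P g + (g - P g)) by rewrite addrC subrK.
  rewrite (sqr_nrmD Hip (P g)) /rip perp1 /= mulr0 addr0.
  by rewrite lerDr sqr_ge0.
have KP g : nrm (K (P g)) ^+ 2 <= \sum_(i < N) s i ^+ 2 * normc (ip g (e i)) ^+ 2.
  rewrite -(ripxx Hip) /rip KPE Re_sum; apply: ler_sum => i _.
  have -> : ip (e i) (P g) = Num.conj (ip g (e i)).
    rewrite (ipC ip) -[in RHS](subrK (P g) g) ipDl PE add0r //.
  have -> : ip g (e i) * (M i ^+ 2)%:C * Num.conj (ip g (e i)) =
     (M i ^+ 2)%:C * (ip g (e i) * Num.conj (ip g (e i))) by ring.
  rewrite ReM /= mul0r subr0 ReM Re_conj Im_conj mulrN opprK -!expr2 -sqr_normcE.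
  rewrite ler_wpM2r ?sqr_ge0 // lerXn2r ?nnegrE //; have /andP[M0 Mi] := Ms i => //.
have Kx g : nrm (K g) ^+ 2 <=
    \sum_(i < N) s i ^+ 2 * normc (ip g (e i)) ^+ 2 + s N ^+ 2 * nrm g ^+ 2.
  rewrite (_ : K g = K (P g) + K (g - P g)); last by rewrite linB // [RHS]addrC subrK.
  rewrite (sqr_nrmD Hip) /rip perp mulr0 addr0 lerD // -exprMn.
  rewrite lerXn2r ?nnegrE ?mulr_ge0 ?nrm_ge0 //.
  apply: (@le_trans _ _ (s N * nrm (g - P g))).
    by apply: Ks => i iN; exact: (PE g (Ordinal iN)).
  by rewrite ler_wpM2l.
set S := \sum_(0 <= j < 2 ^ q) _.
have S0 : 0 <= S by apply: sumr_ge0 => j _; exact: sqr_ge0.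
(* Monotonicity of s lets S absorb the contribution of the part of K beyond the first 2 ^ q singular
   vectors, at the price of the summand G ^+ 2 in D + G ^+ 2. *)
have sN : N%:R * s N ^+ 2 <= S.
  rewrite /S big_mkord -/N mulr_natl.
  have -> : s N ^+ 2 *+ N = \sum_(j < N) s N ^+ 2 by rewrite sumr_const card_ord.
  apply: ler_sum => j _.
  by rewrite lerXn2r ?nnegrE //; apply: snoninc; exact: ltnW.
have DG : 0 <= D + G ^+ 2 by rewrite addr_ge0 // sqr_ge0.
have sumK : \sum_(i <- l) nrm (K (x i)) ^+ 2 <= (D + G ^+ 2) * S.
  apply: (@le_trans _ _ (\sum_(i <- l) (\sum_(j < N) s j ^+ 2 * normc (ip (x i) (e j)) ^+ 2 +
      s N ^+ 2 * G ^+ 2))).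
    apply: ler_sum => i _; apply: (le_trans (Kx _)); rewrite lerD2l ler_wpM2l ?sqr_ge0 //.
    by rewrite lerXn2r ?nnegrE ?nrm_ge0 // (le_trans (nrm_ge0 (x i))).
  rewrite big_split /= big_const_seq count_predT sz iter_addr_0 exchange_big /= mulrDl lerD //.
    rewrite /S big_mkord -/N mulr_sumr; apply: ler_sum => j _; rewrite -mulr_sumr mulrC.
    rewrite ler_wpM2r ?sqr_ge0 //; apply: (le_trans (xD _)); rewrite -[leRHS]mulr1 ler_wpM2l //.
    by have [ej _] := e1 j; rewrite expr_le1 ?nrm_ge0.
  by rewrite -mulrnAl -mulr_natl mulrC ler_wpM2l ?sqr_ge0.
apply: (le_trans (sum_le_sqrt _ _)) => [i|]; first exact: nrm_ge0.
rewrite sz natrX.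
have q0 : 0 < (2 ^+ q : R) by rewrite exprn_gt0.
have -> : 2 ^+ q * (Num.sqrt (D + G ^+ 2) * Num.sqrt (S / 2 ^+ q)) =
    Num.sqrt (2 ^+ q * ((D + G ^+ 2) * S)).
  rewrite -sqrtrM // -{1}(ger0_norm (ltW q0)) -sqrtr_sqr -sqrtrM ?sqr_ge0 //.
  by congr Num.sqrt; field; rewrite gt_eqF.
by apply: ler_wsqrtr; rewrite ler_wpM2l // ltW.
Qed.

End OneOperator.
End SingularSums.

(** * Cauchy estimates for the wave operators *)

Section Wave.
Context {R : realType} {H : completeNormedModType R[i]} {ip : {dot H for Num.conj}}.
Context {n : nat}.
Local Notation Rn := (n.+1.-tuple (measurableTypeR R)).
Variables (Hip : inner_product_of_norm ip) (n3 : (3 <= n.+1)%N).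
Variables (X Y : 'I_n.+1 -> unbounded_operator H) (EX EY : set Rn -> H -> H).
Hypothesis XE : joint_spectral_measure_of ip X EX.
Hypothesis YE : joint_spectral_measure_of ip Y EY.
Hypothesis Ysym : forall j, self_adjoint ip (Y j).
Variable K : 'I_n.+1 -> H -> H.
Hypothesis XYK : forall j, op_dom (X j) = op_dom (Y j) /\
  forall h, op_dom (Y j) h -> X j h = Y j h + K j h.
Hypothesis KJ : forall j, lorentz_ideal ip n.+1 (K j).
Local Notation UX := (exp_i ip EX).
Local Notation UY := (exp_i ip EY).
Local Notation e_ j := (delta_mx ord0 j : 'rV[R]_n.+1).

Let HX : projection_valued_measure ip EX. Proof. by case: XE. Qed.
Let HY : projection_valued_measure ip EY. Proof. by case: YE. Qed.

Definition wave (xi : 'rV[R]_n.+1) (h : H) : H := UY (- xi) (UX xi h).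

Lemma wave_lin xi : linear (wave xi).
Proof.
by move=> a h k; rewrite /wave (exp_i_lin Hip HX) (exp_i_lin Hip HY).
Qed.

Lemma nrm_wave xi h : nrm (wave xi h) = nrm h.
Proof. by rewrite /wave (nrm_exp_i Hip HY) (nrm_exp_i Hip HX). Qed.

Section CubeBounded.
Variables (g : H) (r : R).
Hypotheses (r0 : 0 <= r) (gr : EX (cube r) g = g).

Let gr_exp xi : EX (cube r) (UX xi g) = UX xi g.
Proof. by rewrite -(exp_i_pvm Hip HX) ?gr //; exact: measurable_cube. Qed.

(** The isometry UY (- xi i) factors out of each increment; what is left is the Duhamel difference
    at the vector UX (xi i) g. *)
Lemma sum_wave_step I (l : seq I) (xi : I -> 'rV[R]_n.+1) j (a B : R) : 0 <= a ->
  (forall t, 0 <= t -> t <= a ->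
    \sum_(i <- l) nrm (K j (UX (xi i) (UX (t *: e_ j) g))) <= B) ->
  \sum_(i <- l) nrm (wave (xi i + a *: e_ j) g - wave (xi i) g) <= a * B.
Proof.
move=> a0 hB; pose f i := UX (xi i) g.
have := duhamel Hip XE YE (Ysym j) (XYK j) (l := l) (g := f) (B := B) r0 a0.
move=> /(_ (fun i => gr_exp (xi i))) du.
have E i : nrm (wave (xi i + a *: e_ j) g - wave (xi i) g) =
    nrm (UY (- (a *: e_ j)) (UX (a *: e_ j) (f i)) - f i).
  rewrite /wave opprD -(exp_iD Hip HY) [xi i + _]addrC -(exp_iD Hip HX).
  by rewrite -linB ?(nrm_exp_i Hip HY) //; exact: exp_i_lin.
under eq_bigr do rewrite E.
apply: du => t t0 ta; apply: le_trans (hB t t0 ta); rewrite le_eqVlt; apply/orP; left.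
by apply/eqP; apply: eq_bigr => i _; rewrite /f !(exp_iD Hip HX) addrC.
Qed.

(** The displacement is made one coordinate at a time. The constant involves only bounds of the K j
    and nrm g, so it is available before the mesh is chosen. *)
Lemma wave_lipschitz : exists2 c : R, 0 <= c & forall (l : seq 'I_n.+1) (a : 'I_n.+1 -> R) xi,
  (forall j, 0 <= a j) ->
  nrm (wave (xi + \sum_(j <- l) a j *: e_ j) g - wave xi g) <= c * \sum_(j <- l) a j.
Proof.
have hc j : exists B, forall h, nrm (K j h) <= B * nrm h.
  by have [cK _] := KJ j; have [_] := compact_operator_bounded cK.
have [b hb] := choice hc; pose c := (\sum_j `|b j|) * nrm g.
have c0 : 0 <= c by rewrite mulr_ge0 ?nrm_ge0 // sumr_ge0.
exists c => // l a xi a0; elim: l xi => [|j l IH] xi.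
  by rewrite !big_nil addr0 subrr nrm0 mulr0.
rewrite !big_cons addrA mulrDr.
apply: (le_trans (nrm_sub_trans (wave (xi + a j *: e_ j) g) _ _)).
rewrite [leRHS]addrC lerD //; have := @sum_wave_step unit [:: tt] (fun=> xi) j (a j) c (a0 j).
rewrite big_seq1 [c * _]mulrC; apply => t _ _; rewrite big_seq1.
apply: (le_trans (hb _ _)); rewrite !(nrm_exp_i Hip HX) ler_wpM2r ?nrm_ge0 //.
apply: (le_trans (ler_norm _)); rewrite (bigD1 j) //= lerDl.
exact: sumr_ge0.
Qed.

Variables (la : {sigma_finite_measure set Rn -> \bar R}) (C : R).
Hypotheses (laP : parseval la) (C0 : 0 <= C).
Hypothesis gC : forall A, measurable A -> (spectral_measure Hip HX g A <= C%:E * la A)%E.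

Lemma wave_mesh_cauchy (N : nat) (eps : R) : (0 < N)%N -> r <= N%:R * pi -> 0 < eps ->
  exists S : set 'rV[int]_n.+1, finite_set S /\
    forall z z', ~ S z -> ~ S z' -> nrm (wave (mesh N z) g - wave (mesh N z') g) <= eps.
Proof.
move=> N0 rN; pose D := C * (2 * (N%:R * pi)) ^+ n.+1; pose a : R := N%:R^-1.
have D0 : 0 <= D by rewrite mulr_ge0 // exprn_ge0 // !mulr_ge0 // pi_ge0.
have a0 : 0 <= a by rewrite invr_ge0.
have hs j : exists s : R^nat, singular_values ip (K j) s /\ exists B, forall Q, \sum_(0 <= q < Q)
    2 ^+ (q %/ n.+1) * Num.sqrt ((\sum_(0 <= i < 2 ^ q) s i ^+ 2) / 2 ^+ q) <= B.
  have [_ [s sK sfin]] := KJ j; exists s; split => //.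
  by have [snoninc s0 _] := sK; exact: lorentz_quadratic_means.
have [s sP] := choice hs.
have [B hB] := choice (fun j => (sP j).2).
pose G := Num.sqrt (D + nrm g ^+ 2).
pose m j q := Num.sqrt ((\sum_(0 <= i < 2 ^ q) s j i ^+ 2) / 2 ^+ q).
(* [lattice_cauchy] takes one bound for all directions, hence the sum over j. *)
pose b q := \sum_j a * (G * m j q).
have m0 j q : 0 <= a * (G * m j q) by rewrite !mulr_ge0 // sqrtr_ge0.
apply: (@lattice_cauchy R n H nrm (@nrmD _ _) (@nrmN _ _) (@nrmMn _ _)
  (fun z => wave (mesh N z) g)
  (fun j z => nrm (wave (mesh N z + a *: e_ j) g - wave (mesh N z) g)) b
  (\sum_j a * (G * B j))).
- move=> j z; rewrite (_ : mesh N (z + lattice_basis j) = mesh N z + a *: e_ j) //.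
  rewrite /mesh -scalerDr; congr (_ *: _); apply/rowP => k.
  by rewrite !mxE intrD; congr (_ + _); case: (_ && _).
- by move=> q; apply: sumr_ge0.
- move=> j q l ul sz; apply: (@le_trans _ _ (2 ^+ q * (a * (G * m j q)))); last first.
    rewrite ler_wpM2l ?exprn_ge0 // /b (bigD1 j) //= lerDl.
    exact: sumr_ge0.
  rewrite mulrCA; apply: sum_wave_step => // t t0 ta.
  have [cK _] := KJ j; have [sK _] := sP j.
  apply: (compact_sum_le Hip cK sK (x := fun w => UX (mesh N w) (UX (t *: e_ j) g)) D0) => //.
    by move=> w; rewrite !(nrm_exp_i Hip HX).
  (* UX (t *: e_ j) g has the same spectral measure as g, so the Bessel constant is the same for all
     t in the Duhamel integral. *)
  move=> e; apply: (mesh_bessel (HE := HX) laP N0 ul rN C0) => // A mA.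
  by rewrite spectral_measure_exp_i //; exact: gC.
- move=> Q; rewrite /b; under eq_bigr do rewrite mulr_sumr; rewrite exchange_big /=.
  apply: ler_sum => j _; apply: le_trans (_ : a * (G * \sum_(0 <= q < Q) 2 ^+ (q %/ n.+1) * m j q) <= _).
    by rewrite !mulr_sumr; apply: ler_sum => q _; rewrite mulrCA [2 ^+ _ * (G * _)]mulrCA.
  rewrite ler_wpM2l // ler_wpM2l ?sqrtr_ge0 //; exact: hB.
Qed.

Lemma wave_cauchy_cube (eps : R) : 0 < eps -> exists rho : R, forall xi xi' : 'rV[R]_n.+1,
  (exists j, rho < `|xi ord0 j|) -> (exists j, rho < `|xi' ord0 j|) ->
  nrm (wave xi g - wave xi' g) <= eps.
Proof.
move=> e0; have [c c0 lip] := wave_lipschitz.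
have e3 : 0 < eps / 3 by rewrite divr_gt0.
(* The first summand yields r <= N * pi, the second makes the Lipschitz error over one mesh cell, c
   * n.+1 / N, at most eps / 3. *)
pose N := (Num.bound r + Num.bound (c * n.+1%:R / (eps / 3))).+1.
have N0 : 0 < N%:R :> R by rewrite ltr0n.
have rN : r <= N%:R * pi.
  apply: (@le_trans _ _ N%:R).
    by rewrite (le_trans (ltW (archi_boundP r0))) // ler_nat /N ltnW // ltnS leq_addr.
  by rewrite ler_peMr // (le_trans _ (pi_ge2 R)) // ler1n.
have cN : c * (N%:R^-1 *+ n.+1) <= eps / 3.
  have x0 : 0 <= c * n.+1%:R / (eps / 3) by rewrite divr_ge0 ?mulr_ge0 // ltW.
  have : c * n.+1%:R / (eps / 3) <= N%:R.
    by rewrite (le_trans (ltW (archi_boundP x0))) // ler_nat /N ltnW // ltnS leq_addl.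
  rewrite ler_pdivrMr // => xN; rewrite -[_ *+ n.+1]mulr_natl mulrA ler_pdivrMr //.
  by rewrite (le_trans xN) // [leLHS]mulrC.
have [S [finS hS]] := wave_mesh_cauchy (ltn0Sn _ : (0 < N)%N) rN e3.
pose z (xi : 'rV[R]_n.+1) : 'rV[int]_n.+1 := \row_j Num.floor (N%:R * xi ord0 j).
have fl (y : R) : (Num.floor y)%:~R <= y /\ y < (Num.floor y)%:~R + 1.
  by have /andP[? yf] := floor_itv y; rewrite intrD in yf.
have near_z xi : nrm (wave xi g - wave (mesh N (z xi)) g) <= eps / 3.
  pose a j := xi ord0 j - mesh N (z xi) ord0 j.
  have aE j : a j = (N%:R * xi ord0 j - (Num.floor (N%:R * xi ord0 j))%:~R) / N%:R.
    by rewrite /a /mesh !mxE; field; rewrite gt_eqF.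
  have a0 j : 0 <= a j by rewrite aE divr_ge0 // subr_ge0; case: (fl (N%:R * xi ord0 j)).
  have a1 j : a j <= N%:R^-1.
    rewrite aE ler_pdivrMr // mulVf ?gt_eqF // lerBlDl ltW //.
    by case: (fl (N%:R * xi ord0 j)).
  have xiE : xi = mesh N (z xi) + \sum_(j <- index_enum 'I_n.+1) a j *: e_ j.
    rewrite -[LHS](subrK (mesh N (z xi))) addrC; congr (_ + _).
    apply/rowP => k; rewrite summxE (bigD1 k) //= big1 ?addr0 => [|j jk].
      by rewrite !mxE !eqxx mulr1 /a !mxE.
    by rewrite !mxE [k == j]eq_sym (negbTE jk) andbF mulr0.
  rewrite {1}xiE; apply: (le_trans (lip _ _ _ a0)); apply: le_trans cN.
  rewrite ler_wpM2l //; have -> : N%:R^-1 *+ n.+1 = \sum_(j < n.+1) N%:R^-1 :> R.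
    by rewrite sumr_const card_ord.
  exact: ler_sum.
have [rho hrho] : exists rho : R, forall w, S w -> forall j, `|(w ord0 j)%:~R : R| <= rho.
  have /finite_seqP[l ->] := finS.
  exists (\sum_(w <- l) \sum_j `|(w ord0 j)%:~R|) => w /= wl j.
  have nn (w' : 'rV[int]_n.+1) : 0 <= \sum_j `|(w' ord0 j)%:~R : R| by exact: sumr_ge0.
  rewrite (big_rem w) //= (bigD1 j) //= -addrA lerDl addr_ge0 ?sumr_ge0 //.
(* The floor loses at most 1 and N >= 1, so a coordinate beyond rho + 1 puts the mesh point outside
   the finite set S. *)
exists (rho + 1) => xi xi' far far'.
have out (x : 'rV[R]_n.+1) : (exists j, rho + 1 < `|x ord0 j|) -> ~ S (z x).
  move=> [j xj] /hrho /(_ j); rewrite mxE; apply/negP; rewrite -ltNge.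
  have [f0 f1] := fl (N%:R * x ord0 j); set f : R := (Num.floor _)%:~R in f0 f1 *.
  have xN : `|x ord0 j| <= `|N%:R * x ord0 j|.
    by rewrite normrM ler_peMl // ger0_norm // ler1n.
  have : `|N%:R * x ord0 j| <= `|f| + 1.
    rewrite -{1}(subrK f (N%:R * x ord0 j)) addrC (le_trans (ler_normD _ _)) // lerD2l.
    by rewrite ger0_norm ?subr_ge0 // lerBlDr addrC ltW.
  by move=> fN; rewrite -(ltrD2r 1); apply: (lt_le_trans xj); apply: le_trans fN.
apply: (le_trans (nrm_sub_trans (wave (mesh N (z xi)) g) _ _)).
rewrite (_ : eps = eps / 3 + (eps / 3 + eps / 3)); last by field.
apply: lerD; first exact: near_z.
apply: (le_trans (nrm_sub_trans (wave (mesh N (z xi')) g) _ _)).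
by apply: lerD; [exact: hS (out _ far) (out _ far')|rewrite nrmBC; exact: near_z].
Qed.

End CubeBounded.

Lemma wave_cauchy_ac h (eps : R) : lebesgue_ac_subspace ip EX h -> 0 < eps ->
  exists rho : R, forall xi xi' : 'rV[R]_n.+1,
    (exists j, rho < `|xi ord0 j|) -> (exists j, rho < `|xi' ord0 j|) ->
    nrm (wave xi h - wave xi' h) <= eps.
Proof.
move=> hac e0; have [la [laE laP]] := @lebesgue_tuple_exists R n.+1.
have [g [gh gP]] := ac_approximation Hip HX laE hac.
have e3 : 0 < eps / 3 by rewrite divr_gt0.
have [m _ /(_ m (leqnn m)) hm] := (cvg_nrmP _ _).1 gh _ e3.
have [gm gC] := gP m.
have [rho hrho] := wave_cauchy_cube (ler0n _ m) gm laP (ler0n _ m) gC e3.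
exists rho => xi xi' far far'.
have close x : nrm (wave x h - wave x (g m)) <= eps / 3.
  by rewrite -(linB _ _ (wave_lin x)) nrm_wave nrmBC ltW.
apply: (le_trans (nrm_sub_trans (wave xi (g m)) _ _)).
rewrite (_ : eps = eps / 3 + (eps / 3 + eps / 3)); last by field.
apply: lerD; first exact: close.
apply: (le_trans (nrm_sub_trans (wave xi' (g m)) _ _)).
by apply: lerD; [exact: hrho|rewrite nrmBC; exact: close].
Qed.

End Wave.

(** * The strong limit *)

Section PointAtInfinity.
Context {R : realType} {n : nat}.

Lemma rV_inftyP (A : set 'rV[R]_n) : rV_infty A <->
  exists W : set 'rV[R]_n, [/\ compact W, closed W & forall xi, ~ W xi -> A xi].
Proof.
split=> [[W [cW clW] hW]|[W [cW clW hW]]]; exists W => //.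
- by split => // xi Wxi; apply: (hW (Some xi)) => //; left; exists xi.
- by move=> [xi|]; case=> // -[y Wy [<-]] _; exact: hW.
Qed.

Lemma rV_infty_far (rho : R) : rV_infty [set xi : 'rV[R]_n | exists j, rho < `|xi ord0 j|].
Proof.
pose W := [set xi : 'rV[R]_n | forall j, `[(- rho)%R, rho]%classic (xi ord0 j)].
have cW : compact W by apply: (@rV_compact R n (fun=> `[(- rho)%R, rho]%classic)) => _; exact: segment_compact.
apply/rV_inftyP; exists W; split => //.
  by apply: compact_closed => //; exact: norm_hausdorff.
move=> xi nW; apply: contrapT => nex; apply: nW => j; rewrite /= in_itv /= -ler_norml leNgt.
by apply/negP => jr; apply: nex; exists j.
Qed.

(** For n = 0 the space is a single point, hence compact, and the filter is improper. For n > 0 a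
    large constant vector escapes any compact set. *)
Lemma rV_infty_proper : (0 < n)%N -> ProperFilter (@rV_infty R n).
Proof.
move=> n0; apply: Build_ProperFilter_ex.
move=> A /rV_inftyP[W [cW clW hW]].
pose j0 : 'I_n := Ordinal n0.
have [M [_ hM]] : bounded_set ((fun xi : 'rV[R]_n => xi ord0 j0) @` W).
  apply: compact_bounded; apply: continuous_compact => //.
  exact/continuous_subspaceT/coord_continuous.
exists (const_mx (`|M| + 2)); apply: hW => Wx.
have MM : M < `|M| + 1 by rewrite (le_lt_trans (ler_norm M)) // ltrDl.
have : `|(`|M| + 2 : R)| <= `|M| + 1.
  by apply: (hM _ MM); exists (const_mx (`|M| + 2)) => //; rewrite mxE.
by rewrite ger0_norm ?addr_ge0 //; lra.
Qed.

End PointAtInfinity.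

(** * The projection onto the absolutely continuous subspace *)

Section AbsolutelyContinuousSubspace.
Context {R : realType} {H : completeNormedModType R[i]} {ip : {dot H for Num.conj}}.
Context {n : nat}.
Local Notation Rn := (n.-tuple (measurableTypeR R)).
Variables (Hip : inner_product_of_norm ip).
Variables (E : set Rn -> H -> H) (HE : projection_valued_measure ip E).
Local Notation V := (lebesgue_ac_subspace ip E).
Local Notation P := (orth_proj_on ip V).

(** As E A is a projection, the quadratic condition <E A h, h> = 0 is the linear one E A h = 0;
    linearity and closedness of the subspace follow from it. *)
Lemma ac_subspaceP h : V h <-> forall N, (@lebesgue_measure_tuple R n).-null_set N ->
  forall A, measurable A -> A `<=` N -> E A h = 0.
Proof.
split=> hV N N0 A mA AN; have := hV N N0 A mA AN.
  rewrite (spectral_distE Hip HE) // => -[/eqP]; rewrite sqrf_eq0 => /eqP.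
  exact: nrm_eq0.
by rewrite (spectral_distE Hip HE) // /spectral_measure => ->; rewrite nrm0 expr0n.
Qed.

Lemma ac_subspace0 : V 0.
Proof. by apply/ac_subspaceP => N _ A mA _; rewrite lin0 //; exact: (pvm_lin HE). Qed.

Lemma ac_subspaceD (a : R[i]) x y : V x -> V y -> V (a *: x + y).
Proof.
move=> /ac_subspaceP Vx /ac_subspaceP Vy; apply/ac_subspaceP => N N0 A mA AN.
by rewrite (pvm_lin HE) // (Vx N) // (Vy N) // scaler0 addr0.
Qed.

Lemma ac_subspace_closed (f : nat -> H) l : (forall m, V (f m)) -> f @ \oo --> l -> V l.
Proof.
move=> Vf fl; apply/ac_subspaceP => N N0 A mA AN.
have bE : bounded_operator (E A).
  split; first exact: (pvm_lin HE).
  by exists 1 => h; rewrite mul1r (pvm_le Hip HE).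
have E0 : E A (f m) @[m --> \oo] --> E A l by exact: bounded_operator_cvg.
move: E0; have -> : (fun m => E A (f m)) = (fun=> 0).
  by apply/funext => m; have /ac_subspaceP Vm := Vf m; exact: (Vm N).
move=> E0; apply: (cvg_unique (@norm_hausdorff _ H) E0); exact: cvg_cst.
Qed.

Lemma ac_projP h : V (P h) /\ forall k, V k -> ip (h - P h) k = 0.
Proof.
have [p pP] := projection_exists Hip ac_subspace0 ac_subspaceD ac_subspace_closed h.
exact: (@xgetPex _ 0 [set p | V p /\ forall k, V k -> ip (h - p) k = 0] (ex_intro _ p pP)).
Qed.

Lemma ac_proj_unique h p : V p -> (forall k, V k -> ip (h - p) k = 0) -> P h = p.
Proof.
move=> Vp hp; have [VP hP] := ac_projP h.
apply/eqP; rewrite -subr_eq0; apply/eqP/(@ip_ext _ _ ip) => k0.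
have Vd : V (P h - p) by rewrite -scaleN1r addrC; exact: ac_subspaceD.
have d0 : nrm (P h - p) ^+ 2 = 0.
  rewrite -(ripxx Hip) /rip (_ : ip (P h - p) _ = ip (h - p) (P h - p) - ip (h - P h) (P h - p)).
    by rewrite hp // hP // subr0.
  rewrite -ipBl; congr (ip _ _).
  by rewrite opprB [RHS]addrC addrA subrK.
by move/eqP: d0; rewrite sqrf_eq0 => /eqP/nrm_eq0 ->.
Qed.

Lemma ac_proj_lin : linear P.
Proof.
move=> a h k; have [Vh hP] := ac_projP h; have [Vk kP] := ac_projP k.
apply: ac_proj_unique => [|x Vx]; first exact: ac_subspaceD.
rewrite (_ : _ - _ = a *: (h - P h) + (k - P k)).
  by rewrite ipDl ipZl hP // kP // mulr0 addr0.
by rewrite scalerBr opprD addrACA.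
Qed.

Lemma nrm_ac_proj h : nrm (P h) <= nrm h.
Proof.
have [Vh hP] := ac_projP h; rewrite -(@ler_pXn2r _ 2) ?nnegrE ?nrm_ge0 //.
rewrite -{2}(subrK (P h) h) (sqr_nrmD Hip (h - P h)) /rip hP // mulr0 addr0 lerDr.
exact: sqr_ge0.
Qed.

End AbsolutelyContinuousSubspace.

Lemma linear_strong_limit {R : realType} {H : completeNormedModType R[i]} {I : Type}
    {F : set_system I} {FF : ProperFilter F} (T : I -> H -> H) (B : R) :
  (forall x, linear (T x)) -> (forall x h, nrm (T x h) <= B * nrm h) ->
  (forall h, exists l : H, T x h @[x --> F] --> l) ->
  exists W : H -> H, [/\ linear W, continuous W & forall h, T x h @[x --> F] --> W h].
Proof.
move=> Tlin TB /choice[W TW]; exists W.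
have HH := @norm_hausdorff _ H.
have linW : linear W.
  move=> a h k; apply: (cvg_unique HH (TW (a *: h + k))).
  rewrite /= (_ : (fun x => T x _) = fun x => a *: T x h + T x k); last first.
    by apply/funext => x; exact: Tlin.
  apply: cvgD; last exact: TW.
  apply: (@bounded_operator_cvg _ _ (fun h => a *: h) _ _ _ _ _ _ (TW h)).
  split; last by exists (normc a) => x; rewrite nrmZ.
  by move=> b x y; rewrite scalerDr !scalerA mulrC.
split => // h; apply: (@bounded_operator_cvg _ _ W _ _ _ id h) => //.
split => //; exists B => k.
have cv : nrm (T x k) @[x --> F] --> nrm (W k) by exact: cvg_nrm.
rewrite -(cvg_lim (@Rhausdorff R) cv); apply: limr_le; first by apply/cvg_ex; exists (nrm (W k)).
by apply: nearW => x; exact: TB.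
Qed.

Theorem theorem1 (R : realType) (H : completeNormedModType R[i])
    (ip : {dot H for Num.conj}) (n : nat)
    (X Y : 'I_n -> unbounded_operator H)
    (EX EY : set (n.-tuple (measurableTypeR R)) -> H -> H) :
  inner_product_of_norm ip ->
  separable_space H ->
  infinite_dimensional H ->
  (3 <= n)%N ->
  (forall j, self_adjoint ip (X j)) ->
  (forall j, self_adjoint ip (Y j)) ->
  (forall j k, strongly_commute ip (X j) (X k)) ->
  (forall j k, strongly_commute ip (Y j) (Y k)) ->
  joint_spectral_measure_of ip X EX ->
  joint_spectral_measure_of ip Y EY ->
  (forall j, difference_in (lorentz_ideal ip n) (X j) (Y j)) ->
  let Eac := orth_proj_on ip (lebesgue_ac_subspace ip EX) in
  exists W : H -> H,
    [/\ linear W, continuous W &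
        forall h : H,
          exp_i ip EY (- xi) (exp_i ip EX xi (Eac h))
            @[xi --> @rV_infty R n] --> W h].
Proof.
move=> Hip _ _; case: n X Y EX EY => // n X Y EX EY n3 _ Ysym _ _ XE YE XY Eac.
have [HX _] := XE.
have hK j : exists K : H -> H, lorentz_ideal ip n.+1 K /\ (op_dom (X j) = op_dom (Y j) /\
    forall h, op_dom (Y j) h -> X j h = Y j h + K h).
  by have [dXY [K KJ KXY]] := XY j; exists K.
have [K KP] := choice hK.
have FF := @rV_infty_proper R n.+1 isT.
(* Isometries composed with an orthogonal projection are bounded by 1, so it remains to find the
   limit at each h separately. *)
apply: (@linear_strong_limit R H _ _ FF (fun xi h => wave EX EY xi (Eac h)) 1).
- move=> xi a h k; rewrite /Eac (ac_proj_lin Hip HX) (wave_lin Hip XE YE) //.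
- by move=> xi h; rewrite (nrm_wave Hip XE YE) mul1r (nrm_ac_proj Hip HX).
move=> h; apply: cauchy_nrm_cvg => e e0.
have [Vh _] := ac_projP Hip HX h.
have [rho hrho] := wave_cauchy_ac Hip n3 XE YE Ysym (fun j => (KP j).2) (fun j => (KP j).1) Vh e0.
exists [set xi | exists j, rho < `|xi ord0 j|]; first exact: rV_infty_far.
by move=> xi xi' ? ?; exact: hrho.
Qed.
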